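(* Let $M$ be a smooth manifold and $k\ge 1$. A graded bundle of degree $k$ over $M$ is uniquely determined by an associative graded vector bundle morphism $m:\mathrm{Sym}^2E_0\to E_0$ such that the induced morphisms $$m^j:\mathrm{Sym}^j\hat E\to E_0/(E_0)^{j+1}$$ are injective for $j=2,3,\dots,k$. Here $E_0=\bigoplus_{i=1}^kE^i\to M$ is a graded vector bundle of degree $k$, and $\hat E=E_0/(E_0\cdot E_0)$.
   Context: A graded bundle is a smooth manifold $F$ with a smooth action $h:\mathbb R\times F\to F$ of the multiplicative monoid $(\mathbb R,\cdot)$ ($h_t\circ h_s=h_{ts}$, $h_1=\mathrm{id}$). Its base is $M=h_0(F)$ and its projection is $h_0:F\to M$. It is locally trivial with one typical fibre: there is $\mathbf d=(d_1,\dots,d_r)$, $d_i\in\{0,1,2,\dots\}$, such that locally over $M$ it is isomorphic to $U\times\mathbb R^{d_1}\times\dots\times\mathbb R^{d_r}$ with $h_t(x,y_1,\dots,y_r)=(x,ty_1,\dots,t^ry_r)$. It is of degree $k$ (meaning at most $k$) if one can take $r=k$. A smooth function $g$ on $F$ is homogeneous of degree $i$ if $g\circ h_t=t^ig$ for all $t\in\mathbb R$; such functions form a locally free finitely generated $C^\infty(M)$-module, hence the module of sections of a vector bundle over $M$. The correspondence meant in the claim: for a graded bundle $F\to M$ of degree $k$, $E^i$ ($1\le i\le k$) is the vector bundle over $M$ whose sections are the functions on $F$ homogeneous of degree $i$, and $m$ is induced by multiplication of functions, products of degree greater than $k$ being set to $0$. In $E_0=\bigoplus_{i=1}^kE^i$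 the summand $E^i$ has weight $i$. Vector bundle morphisms here cover $\mathrm{id}_M$. A graded morphism $m:\mathrm{Sym}^2E_0\to E_0$ maps the product of $E^i$ and $E^{i'}$ into $E^{i+i'}$ (it is zero there if $i+i'>k$); write $a\cdot b=m(a\otimes b)$. Associative means $(a\cdot b)\cdot c=a\cdot(b\cdot c)$ fibrewise. $(E_0)^j$ denotes the fibrewise span of all products of $j$ elements of $E_0$, and $E_0\cdot E_0=(E_0)^2$; quotients are fibrewise. The $j$-fold product $a_1\otimes\dots\otimes a_j\mapsto a_1\cdots a_j \bmod (E_0)^{j+1}$ is symmetric and vanishes if some $a_i\in E_0\cdot E_0$, hence it induces $m^j:\mathrm{Sym}^j\hat E\to E_0/(E_0)^{j+1}$.
   Formalization: Injectivity of m^j is required only on the part of Sym^j Ê of weight at most k; on all of Sym^j Ê it fails, e.g. over a point with k=2 and F=R^2 of weights 1 and 2, where m^2 kills the weight-3 product. *)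

(* Defs.v *)
From HB Require Import structures.
From mathcomp Require Import all_boot all_order all_algebra all_fingroup.
From mathcomp Require Import all_classical all_reals all_analysis.

Set Implicit Arguments.
Unset Strict Implicit.
Unset Printing Implicit Defensive.

Import Order.TTheory GRing.Theory Num.Theory.
Import numFieldNormedType.Exports.

Local Open Scope classical_set_scope.
Local Open Scope ring_scope.

(** * Smooth manifolds *)

(* C^r and smooth functions; meant for open [U]. *)
Fixpoint Cr (R : realType) (n r : nat) (U : set 'rV[R]_n) (f : 'rV[R]_n -> R)
    : Prop :=
  (forall x, U x -> {for x, continuous f}) /\
  if r is r'.+1 then
    forall i : 'I_n,
      (forall x, U x -> derivable f x (delta_mx 0 i)) /\
      Cr r' U ('D_(delta_mx 0 i) f)
  else True.

Definition euclidean_smooth (R : realType) (m n : nat) (U : set 'rV[R]_m)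
    (f : 'rV[R]_m -> 'rV[R]_n) : Prop :=
  forall (i : 'I_n) (r : nat), Cr r U (fun x => f x 0 i).

(* A chart is only meaningful on its domain; the value of [chart_map] outside
   of it is irrelevant. *)
Record chart (R : realType) (T : Type) (n : nat) := Chart {
  chart_dom : set T;
  chart_map :> T -> 'rV[R]_n }.

(* Raw data of a manifold; the axioms are in [is_manifold]. *)
Record chartedSpace (R : realType) := ChartedSpace {
  carrier :> topologicalType;
  mdim : nat;
  atlas : set (chart R carrier mdim) }.

Arguments atlas {R} X _ : rename.

(* In the charts [a] and [b], the map [f] restricted to [U] is smooth. *)
Definition chart_smooth (R : realType) (S T : Type) (m n : nat)
    (a : chart R S m) (b : chart R T n) (U : set S) (f : S -> T) : Prop :=
  let D := chart_dom a `&` U `&` f @^-1` chart_dom b in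
  exists2 tau : 'rV[R]_m -> 'rV[R]_n,
    euclidean_smooth (a @` D) tau & forall x, D x -> b (f x) = tau (a x).

Record is_manifold (R : realType) (X : chartedSpace R) : Prop := IsManifold {
  mfd_hausdorff : hausdorff_space X;
  mfd_second_countable : @second_countable X;
  mfd_cover : forall x : X, exists2 a, atlas X a & chart_dom a x;
  mfd_open_dom : forall a, atlas X a -> open (chart_dom a);
  mfd_chart_inj : forall a, atlas X a ->
    forall x y, chart_dom a x -> chart_dom a y -> a x = a y -> x = y;
  mfd_chart_continuous : forall a, atlas X a ->
    forall x, chart_dom a x -> {for x, continuous a};
  mfd_chart_open : forall a, atlas X a ->
    forall O : set X, open O -> O `<=` chart_dom a -> open (a @` O);
  mfd_compatible : forall a b, atlas X a -> atlas X b ->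
    chart_smooth a b setT id }.

Record manifold (R : realType) := Manifold {
  mfd_space :> chartedSpace R;
  mfd_axioms : is_manifold mfd_space }.

Definition euclidean (R : realType) (n : nat) : chartedSpace R :=
  @ChartedSpace R 'rV[R]_n n [set Chart setT id].

Definition real_line (R : realType) : chartedSpace R :=
  @ChartedSpace R R 1 [set Chart setT (fun x => const_mx x)].

Definition prod_chart (R : realType) (S T : Type) (m n : nat)
    (a : chart R S m) (b : chart R T n) : chart R (S * T)%type (m + n) :=
  Chart (chart_dom a `*` chart_dom b) (fun p => row_mx (a p.1) (b p.2)).

Definition prod_space (R : realType) (X Y : chartedSpace R) : chartedSpace R :=
  @ChartedSpace R (X * Y)%type (mdim X + mdim Y)
    [set c | exists a b, [/\ atlas X a, atlas Y b & c = prod_chart a b]].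

(* Smoothness of [f] on the open subset [U] of [X]. *)
Definition smooth_on (R : realType) (X Y : chartedSpace R) (U : set X)
    (f : X -> Y) : Prop :=
  (forall x, U x -> {for x, continuous f}) /\
  forall a b, atlas X a -> atlas Y b -> chart_smooth a b U f.

Definition smooth (R : realType) (X Y : chartedSpace R) (f : X -> Y) : Prop :=
  smooth_on setT f.

Definition smooth_fun (R : realType) (X : chartedSpace R) (f : X -> R) : Prop :=
  @smooth R X (real_line R) f.

(* [f] and [g] are mutually inverse diffeomorphisms of the open subsets [U]
   and [V]. *)
Definition diffeo_on (R : realType) (X Y : chartedSpace R) (U : set X)
    (V : set Y) (f : X -> Y) (g : Y -> X) : Prop :=
  [/\ smooth_on U f, smooth_on V g,
      forall x, U x -> V (f x) /\ g (f x) = x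
    & forall y, V y -> U (g y) /\ f (g y) = y].

(** * Graded bundles *)

(* (y_1, .., y_k) |-> (t y_1, .., t^k y_k) on R^{d_1} x .. x R^{d_k}; the block
   with index [i : 'I_k] has weight [i.+1]. *)
Definition weighted_scaling (R : realType) (k : nat) (d : 'I_k -> nat) (t : R)
    (y : 'rV[R]_(\sum_i d i)) : 'rV[R]_(\sum_i d i) :=
  \mxrow_i (t ^+ i.+1 *: submxrow y i).

(* Graded bundles of degree (at most) [k] over [M]. The base h_0(F) is
   identified with [M] through [gb_proj]: [gb_proj] is onto and has the same
   fibres as h_0, and by local triviality the identification is a
   diffeomorphism. *)
Record gradedBundle (R : realType) (M : manifold R) (k : nat) := GradedBundle {
  gb_total :> manifold R;
  gb_proj : gb_total -> M;
  gb_act : R -> gb_total -> gb_total;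
  gb_rank : 'I_k -> nat;
  gb_proj_smooth : smooth gb_proj;
  gb_act_smooth : @smooth R (prod_space (real_line R) gb_total) gb_total
    (fun p => gb_act p.1 p.2);
  gb_act1 : forall p, gb_act 1 p = p;
  gb_actM : forall t s p, gb_act t (gb_act s p) = gb_act (t * s) p;
  gb_proj_surj : forall x, exists p, gb_proj p = x;
  gb_proj_act0 : forall p q, gb_proj p = gb_proj q <-> gb_act 0 p = gb_act 0 q;
  gb_locally_trivial : forall x : M,
    exists (U : set M) (y : gb_total -> 'rV[R]_(\sum_i gb_rank i))
           (psi : M * 'rV[R]_(\sum_i gb_rank i) -> gb_total),
    [/\ open U, U x,
        @diffeo_on R gb_total (prod_space M (euclidean R (\sum_i gb_rank i)))
          (gb_proj @^-1` U) (U `*` setT) (fun p => (gb_proj p, y p)) psi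
      & forall t p, U (gb_proj p) ->
          y (gb_act t p) = weighted_scaling t (y p)] }.

Definition homogeneous (R : realType) (M : manifold R) (k : nat)
    (F : gradedBundle M k) (w : nat) (g : F -> R) : Prop :=
  smooth_fun g /\ forall t p, g (gb_act t p) = t ^+ w * g p.

Definition gb_isomorphic (R : realType) (M : manifold R) (k : nat)
    (F F' : gradedBundle M k) : Prop :=
  exists (f : F -> F') (g : F' -> F),
    [/\ @diffeo_on R F F' setT setT f g,
        forall p, gb_proj (f p) = gb_proj p
      & forall t p, f (gb_act t p) = gb_act t (f p)].

(** * Graded vector bundles *)

(* A local trivialization over [triv_dom] of a family [V] of vector spaces. *)
Record trivialization (R : realType) (M : Type) (V : M -> vectType R) (n : nat)
  := Trivialization {
  triv_dom : set M;
  triv_map :> forall x, 'Hom(V x, 'rV[R]_n) }.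

(* E_0 = E^1 (+) .. (+) E^k over [M], given by its fibres, the graded pieces
   [gv_grade x w] (the fibre of E^w at [x]) and a smooth bundle atlas of
   trivializations sending E^w onto the block of weight [w]. [gv_trivP]
   entails that [gv_grade x w] vanishes unless 1 <= w <= k, and that each
   fibre over [M] is the direct sum of its graded pieces. [(phi x)^-1%VF] is
   the library's inverse of a linear map. *)
Record gradedVectorBundle (R : realType) (M : manifold R) (k : nat) :=
  GradedVectorBundle {
  gv_fibre :> M -> vectType R;
  gv_grade : forall x, nat -> {vspace gv_fibre x};
  gv_rank : 'I_k -> nat;
  gv_atlas : set (trivialization gv_fibre (\sum_i gv_rank i));
  gv_cover : forall x, exists2 phi, gv_atlas phi & triv_dom phi x;
  gv_open : forall phi, gv_atlas phi -> open (triv_dom phi);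
  gv_bij : forall phi, gv_atlas phi -> forall x, triv_dom phi x ->
    bijective (phi x);
  gv_trivP : forall phi, gv_atlas phi -> forall x, triv_dom phi x ->
    forall (w : nat) (v : gv_fibre x),
      v \in gv_grade x w <->
      (forall i : 'I_k, i.+1 != w -> submxrow (phi x v) i = 0);
  gv_transition : forall phi psi, gv_atlas phi -> gv_atlas psi ->
    forall u, @smooth_on R M (euclidean R (\sum_i gv_rank i))
      (triv_dom phi `&` triv_dom psi) (fun x => psi x ((phi x)^-1%VF u)) }.

Arguments gv_atlas {R M k} E _ : rename.
Arguments gv_grade {R M k} E _ _ : rename.

Definition smooth_section (R : realType) (M : manifold R) (k : nat)
    (E : gradedVectorBundle M k) (s : forall x, E x) : Prop :=
  forall phi, gv_atlas E phi ->
    @smooth_on R M (euclidean R _) (triv_dom phi) (fun x => phi x (s x)).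

(* Smooth sections of E^w. *)
Definition graded_section (R : realType) (M : manifold R) (k : nat)
    (E : gradedVectorBundle M k) (w : nat) (s : forall x, E x) : Prop :=
  smooth_section s /\ forall x, s x \in gv_grade E x w.

(* A vector bundle morphism from Sym^2 E_0 to E_0: a family of symmetric
   bilinear maps depending smoothly on the base point. *)
Definition bundle_product (R : realType) (M : manifold R) (k : nat)
    (E : gradedVectorBundle M k) := forall x, 'Hom(E x, 'End(E x)).

Definition is_sym2_morphism (R : realType) (M : manifold R) (k : nat)
    (E : gradedVectorBundle M k) (m : bundle_product E) : Prop :=
  (forall x a b, m x a b = m x b a) /\
  forall phi, gv_atlas E phi ->
    forall u v, @smooth_on R M (euclidean R _) (triv_dom phi)
      (fun x => phi x (m x ((phi x)^-1%VF u) ((phi x)^-1%VF v))).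

(* If [i + j > k] this says that the product vanishes. *)
Definition is_graded_product (R : realType) (M : manifold R) (k : nat)
    (E : gradedVectorBundle M k) (m : bundle_product E) : Prop :=
  forall x i j a b, a \in gv_grade E x i -> b \in gv_grade E x j ->
    m x a b \in gv_grade E x (i + j).

Definition is_associative_product (R : realType) (M : manifold R) (k : nat)
    (E : gradedVectorBundle M k) (m : bundle_product E) : Prop :=
  forall x a b c, m x (m x a b) c = m x a (m x b c).

(** * The induced morphisms m^j *)

Definition lspan (R : realType) (V : lmodType R) (A : set V) : set V :=
  [set v | exists (n : nat) (c : 'I_n -> R) (a : 'I_n -> V),
     (forall i, A (a i)) /\ v = \sum_i c i *: a i].

Definition is_quotient (R : realType) (V Q : vectType R) (N : set V)
    (q : 'Hom(V, Q)) : Prop :=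
  (forall z, exists v, q v = z) /\ (forall v, q v = 0 <-> N v).

Definition ffupd (j : nat) (V : Type) (a : {ffun 'I_j -> V}) (i : 'I_j) (u : V)
    : {ffun 'I_j -> V} :=
  [ffun l => if l == i then u else a l].

Definition symmetric_multilinear (R : realType) (j : nat) (V W : vectType R)
    (f : {ffun 'I_j -> V} -> W) : Prop :=
  (forall a i c u v,
     f (ffupd a i (c *: u + v)) = c *: f (ffupd a i u) + f (ffupd a i v)) /\
  (forall (a : {ffun 'I_j -> V}) (s : 'S_j), f [ffun i => a (s i)] = f a).

(* [S], with the product [sigma], is the symmetric power Sym^j V. *)
Definition is_sympower (R : realType) (j : nat) (V S : vectType R)
    (sigma : {ffun 'I_j -> V} -> S) : Prop :=
  symmetric_multilinear sigma /\
  forall (W : vectType R) (f : {ffun 'I_j -> V} -> W),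
    symmetric_multilinear f ->
    exists! g : 'Hom(S, W), forall a, g (sigma a) = f a.

(* a_1 a_2 .. a_j; only used for j >= 1. *)
Definition iter_prod (R : realType) (V : vectType R) (mu : 'Hom(V, 'End(V)))
    (s : seq V) : V :=
  if s is a :: s' then foldl (fun u v => mu u v) a s' else 0.

Definition power_span (R : realType) (V : vectType R) (mu : 'Hom(V, 'End(V)))
    (j : nat) : set V :=
  lspan [set v | exists a : {ffun 'I_j -> V}, v = iter_prod mu (codom a)].

(* Injectivity, at one fibre [V] with graded pieces [G w] and product [mu], of
   the map m^j from Sym^j Ehat to V/V^{j+1}, with Ehat = V/V^2.
   As everything is of degree k, Sym^j Ehat is the symmetric power in the
   category of graded vector spaces of degree k, i.e. only the part of weight
   at most [k] of the usual symmetric power is considered: the usual one has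
   elements of weight > k, which m^j kills for trivial reasons. *)
Definition induced_injective (R : realType) (k : nat) (V : vectType R)
    (G : nat -> {vspace V}) (mu : 'Hom(V, 'End(V))) (j : nat) : Prop :=
  exists (Ehat Q S : vectType R) (p : 'Hom(V, Ehat)) (q : 'Hom(V, Q))
         (sigma : {ffun 'I_j -> Ehat} -> S) (mj : 'Hom(S, Q)),
  [/\ is_quotient (power_span mu 2) p,
      is_quotient (power_span mu j.+1) q,
      is_sympower sigma,
      forall a : {ffun 'I_j -> V},
        mj (sigma [ffun i => p (a i)]) = q (iter_prod mu (codom a))
    & forall z,
        lspan [set y | exists (a : {ffun 'I_j -> V}) (w : 'I_j -> nat),
          [/\ forall i, a i \in G (w i), (\sum_i w i <= k)%N
            & y = sigma [ffun i => p (a i)]]] z ->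
        mj z = 0 -> z = 0].

(* The pairs (E_0, m) of the theorem. *)
Record productBundle (R : realType) (M : manifold R) (k : nat) :=
  ProductBundle {
  pb_bundle :> gradedVectorBundle M k;
  pb_prod : bundle_product pb_bundle;
  pb_sym2 : is_sym2_morphism pb_prod;
  pb_graded : is_graded_product pb_prod;
  pb_assoc : is_associative_product pb_prod;
  pb_injective : forall x j, (2 <= j <= k)%N ->
    induced_injective k (gv_grade pb_bundle x) (pb_prod x) j }.

Definition pb_isomorphic (R : realType) (M : manifold R) (k : nat)
    (E E' : productBundle M k) : Prop :=
  exists f : forall x, 'Hom(E x, E' x),
    [/\ forall x, bijective (f x),
        forall phi psi, gv_atlas E phi -> gv_atlas E' psi ->
          forall u, @smooth_on R M (euclidean R _)
            (triv_dom phi `&` triv_dom psi)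
            (fun x => psi x (f x ((phi x)^-1%VF u))),
        forall x w, (f x @: gv_grade E x w)%VS = gv_grade E' x w
      & forall x a b, f x (pb_prod E x a b) = pb_prod E' x (f x a) (f x b)].

(* (E_0, m) is the pair attached to F: for 1 <= w <= k, [Phi] identifies the
   C^oo(M)-module of sections of E^w with that of the functions on F that are
   homogeneous of degree w, and m with the multiplication of functions. *)
Definition corresponds (R : realType) (M : manifold R) (k : nat)
    (F : gradedBundle M k) (E : productBundle M k) : Prop :=
  exists Phi : (forall x, E x) -> F -> R,
    [/\ forall (f : M -> R) (s s' : forall x, E x), smooth_fun f ->
          smooth_section s -> smooth_section s' -> forall p,
          Phi (fun x => f x *: s x + s' x) p =
          f (gb_proj p) * Phi s p + Phi s' p,
        forall w s, (1 <= w <= k)%N -> graded_section w s ->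
          homogeneous w (Phi s),
        forall w g, (1 <= w <= k)%N -> homogeneous w g ->
          exists! s, graded_section w s /\ Phi s = g
      & forall i j s s', (1 <= i)%N -> (1 <= j)%N -> (i + j <= k)%N ->
          graded_section i s -> graded_section j s' -> forall p,
          Phi (fun x => pb_prod E x (s x) (s' x)) p = Phi s p * Phi s' p].

(* Main.v *)
(* A graded bundle is locally M x R^n with weighted fibre coordinates y_a, and by
   Euler's identity its homogeneous functions are polynomials in the y_a with
   coefficients in C^oo(M). On the algebraic side, the m^j of a nilpotent graded
   algebra are injective if and only if it is freely generated up to weight k:
   lifts e_a of a graded basis of Ehat have monomials of weight at most k that
   form a basis. Both kinds of objects are thus tied together by a pairing
   ev : E_x x F_x -> R which, in suitable local frames e_a and coordinates y_a,
   evaluates the polynomials in e_a at y. A correspondence is the same thing as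
   such a pairing: bump functions show that Phi s p only depends on s at the base
   point of p. Either of E, F determines the other through the pairing, because
   vectors of E_x are separated by the points of F_x and conversely. A pairing
   exists for every F (take truncated polynomials in the coordinates, glued by
   the coordinate changes) and for every E (take the space of characters of the
   fibres, glued from the local frames of free generators, which extend from one
   fibre to its neighbours since being a basis is an open condition). *)

Require Import Defs.
From HB Require Import structures.
From mathcomp Require Import all_boot all_order all_algebra all_fingroup.
From mathcomp Require Import all_classical all_reals all_analysis.
From mathcomp Require Import ring lra zify.

Set Implicit Arguments.
Unset Strict Implicit.
Unset Printing Implicit Defensive.

Import Order.TTheory GRing.Theory Num.Theory.
Import numFieldNormedType.Exports.

Local Open Scope classical_set_scope.
Local Open Scope ring_scope.

(** The predicate [dual_pairing] is local over [M], whereas a correspondence speaks of global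
    sections and global functions: the expansions supplied by Euler's identity only hold over small
    open sets and have to be cut off before they can be compared through [Phi]. A map between two
    objects paired with the same third one is defined by equality of the values of the pairings. It
    is therefore unique at each point, hence compatible with the actions or the products, and only
    its smoothness has to be read in local frames. Truncation shapes the algebra. Products above
    weight [k] vanish in [E], while the corresponding products of functions do not; all statements
    about characters and monomials thus stop at weight [k], and the fibres have no unit since weight
    0 is absent. The typical fibre has to be the same over all of [M], which may be disconnected.
    The numbers of generators are recovered from the dimensions of the graded pieces, constant by
    the definition of a graded vector bundle. *)

(** * Calculus of C^r functions of several real variables *)

Lemma Cr_sub (R : realType) n r (U V : set 'rV[R]_n) f :
  V `<=` U -> Cr r U f -> Cr r V f.
Proof.
move=> VU; elim: r f => [|r IH] f /= [cf df]; split => //.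
- by move=> x /VU; exact: cf.
- by move=> x /VU; exact: cf.
- move=> i; have [d1 d2] := df i; split; last exact: IH.
  by move=> x /VU; exact: d1.
Qed.

Lemma CrW (R : realType) n r (U : set 'rV[R]_n) f : Cr r.+1 U f -> Cr r U f.
Proof.
elim: r f => [|r IH] f [cf df]; split => //.
by move=> i; have [d1 d2] := df i; split => //; exact: IH.
Qed.

Lemma Cr_continuous (R : realType) n r (U : set 'rV[R]_n) f :
  Cr r U f -> forall x, U x -> {for x, continuous f}.
Proof. by case: r => [|r] []. Qed.

(** Every clause of [Cr] is a condition at single points on functions defined on the whole space, so
    the sets [V] can be arbitrary. *)
Lemma Cr_local (R : realType) n r (U : set 'rV[R]_n) f :
  (forall x, U x -> exists2 V : set 'rV[R]_n, V x & Cr r V f) -> Cr r U f.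
Proof.
elim: r f => [|r IH] f H; split => //.
- by move=> x /H [V Vx [+ _]]; exact.
- by move=> x /H [V Vx [+ _]]; exact.
- move=> i; split.
    by move=> x /H [V Vx [_ /(_ i) [+ _]]]; exact.
  by apply: IH => x /H [V Vx [_ /(_ i) [_ ?]]]; exists V.
Qed.

(** Openness matters here: the derivatives at a point of [U] depend on the values at all nearby
    points. *)
Lemma eq_Cr (R : realType) n r (U : set 'rV[R]_n) f g :
  open U -> (forall x, U x -> f x = g x) -> Cr r U f -> Cr r U g.
Proof.
move=> oU; elim: r f g => [|r IH] f g fg [cf df];
  have nfg x : U x -> \near x, f x = g x by move=> Ux;
    apply: filterS (open_nbhs_nbhs (conj oU Ux)) => y; exact: fg.
- split => // x Ux; rewrite /prop_for /continuous_at -(fg _ Ux).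
  exact: cvg_trans (near_eq_cvg (nfg _ Ux)) (cf _ Ux).
- have cg x : U x -> {for x, continuous g}.
    move=> Ux; rewrite /prop_for /continuous_at -(fg _ Ux).
    exact: cvg_trans (near_eq_cvg (nfg _ Ux)) (cf _ Ux).
  split => // i; have [d1 d2] := df i; split.
    by move=> x Ux; apply: near_eq_derivable (d1 _ Ux); exact: nfg.
  by apply: IH d2 => x Ux; apply: near_eq_derive; exact: nfg.
Qed.

Lemma Cr_cst (R : realType) n r (U : set 'rV[R]_n) (c : R) : Cr r U (cst c).
Proof.
elim: r c => [|r IH] c; split => //=; [by move=> x _; apply: cst_continuous|by move=> x _; apply: cst_continuous|].
move=> i; split; first by move=> x _; exact: derivable_cst.
rewrite (_ : 'D_(delta_mx 0 i) (cst c) = cst 0) //.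
by apply/funext => x; rewrite derive_cst.
Qed.

Lemma is_derive_coord (R : realType) n (i : 'I_n) (x v : 'rV[R]_n) :
  is_derive x v (fun y : 'rV[R]_n => y 0 i) (v 0 i).
Proof.
have H : (fun h : R => h^-1 *: (((fun y : 'rV[R]_n => y 0 i) \o shift x) (h *: v)
            - x 0 i)) @ 0^' --> v 0 i.
  apply: cvg_near_cst; rewrite near_withinE; near=> h => h0.
  by rewrite /= !mxE addrK /GRing.scale /= mulrA mulVf // mul1r.
by split; [apply/cvg_ex; exists (v 0 i)|exact: cvg_lim H].
Unshelve. all: by end_near.
Qed.

Lemma Cr_coord (R : realType) n r (U : set 'rV[R]_n) (i : 'I_n) :
  Cr r U (fun x => x 0 i).
Proof.
case: r => [|r]; split => //=; try by move=> x _; exact: coord_continuous.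
move=> j; split; first by move=> x _; have [] := is_derive_coord i x (delta_mx 0 j).
rewrite (_ : 'D_(delta_mx 0 j) _ = cst ((delta_mx 0 j : 'rV[R]_n) 0 i)).
  exact: Cr_cst.
by apply/funext => x; have [_ ->] := is_derive_coord i x (delta_mx 0 j).
Qed.

Lemma CrD (R : realType) n r (U : set 'rV[R]_n) f g : open U ->
  Cr r U f -> Cr r U g -> Cr r U (f + g).
Proof.
move=> oU; elim: r f g => [|r IH] f g [cf df] [cg dg].
  by split => // x Ux; apply: continuousD; [exact: cf|exact: cg].
split; first by move=> x Ux; apply: continuousD; [exact: cf|exact: cg].
move=> i; have [f1 f2] := df i; have [g1 g2] := dg i.
split; first by move=> x Ux; apply: derivableD; [exact: f1|exact: g1].
apply: eq_Cr (IH _ _ f2 g2) => // x Ux.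
by rewrite deriveD //; [exact: f1|exact: g1].
Qed.

Lemma CrM (R : realType) n r (U : set 'rV[R]_n) f g : open U ->
  Cr r U f -> Cr r U g -> Cr r U (f * g).
Proof.
move=> oU; elim: r f g => [|r IH] f g Cf Cg; have [cf df] := Cf; have [cg dg] := Cg.
  by split => // x Ux; apply: continuousM; [exact: cf|exact: cg].
split; first by move=> x Ux; apply: continuousM; [exact: cf|exact: cg].
move=> i; have [f1 f2] := df i; have [g1 g2] := dg i.
split; first by move=> x Ux; apply: derivableM; [exact: f1|exact: g1].
apply: eq_Cr (CrD oU (IH _ _ (CrW Cf) g2) (IH _ _ (CrW Cg) f2)) => // x Ux.
by rewrite deriveM //; [exact: f1|exact: g1].
Qed.

Lemma Cr_sum (R : realType) n r (U : set 'rV[R]_n) (I : Type) (s : seq I)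
    (P : pred I) (F : I -> 'rV[R]_n -> R) : open U ->
  (forall i, P i -> Cr r U (F i)) -> Cr r U (fun x => \sum_(i <- s | P i) F i x).
Proof.
move=> oU H; rewrite (_ : (fun _ => _) = \sum_(i <- s | P i) F i); last first.
  by apply/funext => x; rewrite fct_sumE.
elim/big_rec : _ => [|i f Pi Cf]; first exact: Cr_cst.
by apply: CrD => //; exact: H.
Qed.

Lemma CrN (R : realType) n r (U : set 'rV[R]_n) f : open U ->
  Cr r U f -> Cr r U (- f).
Proof.
move=> oU Cf; rewrite (_ : - f = cst (-1) * f); last first.
  by apply/funext => x; rewrite /GRing.mul /GRing.opp /= mulN1r.
by apply: CrM => //; exact: Cr_cst.
Qed.

(** The partial derivatives of the inverse are [- f^-1 * f^-1 * D f], so that its own regularity of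
    order [r] yields the order [r.+1]. *)
Lemma CrV (R : realType) n r (U : set 'rV[R]_n) f : open U ->
  (forall x, U x -> f x != 0) -> Cr r U f -> Cr r U (fun x => (f x)^-1).
Proof.
move=> oU f0; elim: r => [|r IH] Cf; have [cf df] := Cf.
  by split => // x Ux; apply: continuousV; [exact: f0|exact: cf].
split; first by move=> x Ux; apply: continuousV; [exact: f0|exact: cf].
move=> i; have [f1 f2] := df i.
split; first by move=> x Ux; apply: derivableV; [exact: f0|exact: f1].
have Ci := IH (CrW Cf).
apply: eq_Cr (CrN oU (CrM oU (CrM oU Ci Ci) f2)) => // x Ux.
rewrite deriveV; [|exact: f0|exact: f1].
by rewrite /GRing.mul /GRing.opp /GRing.scale /= expr2 invfM mulNr.
Qed.

(** The segment is parametrized by [s] in [0, 1], which treats all signs of [t] alike, [t = 0]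
    included. *)
Lemma mvt_line (R : realType) n (f : 'rV[R]_n -> R) (y v : 'rV[R]_n) (t : R) :
  (forall s : R, 0 <= s <= 1 -> derivable f (y + (s * t) *: v) v) ->
  exists2 s : R, 0 <= s <= 1 &
    f (y + t *: v) - f y = t * 'D_v f (y + (s * t) *: v).
Proof.
move=> H; pose g (s : R) := f (y + (s * t) *: v).
have dg (s : R) : 0 <= s <= 1 -> is_derive s 1 g ('D_v f (y + (s * t) *: v) * t).
  move=> Hs; set a := y + _; have da : derivable f a v by exact: H.
  pose G (h : R) := f (h *: v + a).
  pose phi (u : R) := (u - s) * t.
  have dG : is_derive (phi s) 1 G ('D_v f a).
    rewrite /phi subrr mul0r; split; first exact: (derivable1P f a v).1 da.
    rewrite /derive; set g1 := fun h => h^-1 *: _; set g2 := fun h => h^-1 *: _.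
    suff -> : g1 = g2 by [].
    by rewrite funeqE /g1 /g2 /G => h /=; rewrite addr0 scale0r add0r [_%:A]mulr1.
  have di : is_derive s 1 phi t.
    by rewrite /phi; apply: is_derive_eq; rewrite /GRing.scale /= mulr0 add0r subr0 mulr1.
  have := is_derive1_comp dG di; congr (is_derive _ _ _ _).
  apply/funext => u /=; rewrite /G /g /a /phi; congr f.
  by rewrite addrCA -scalerDl -mulrDl subrK.
have [|||s /= Hs E] := @MVT_segment R g (fun s => 'D_v f (y + (s * t) *: v) * t) 0 1.
- exact: ler01.
- by move=> s; rewrite in_itv /= => /andP[s0 s1]; apply: dg; rewrite !ltW.
- apply: derivable_within_continuous => s; rewrite in_itv /= => Hs.
  by have [] := dg s Hs.
exists s => //; move: E; rewrite /g mul0r mul1r scale0r addr0 subr0 mulr1 => ->.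
by rewrite mulrC.
Qed.

Lemma ball_rVP (R : realType) n (p z : 'rV[R]_n) (e : R) : 0 < e ->
  ball p e z <-> forall i, `|p 0 i - z 0 i| < e.
Proof.
move=> e0; split; first by case=> _ H i; exact: H.
by move=> H; split => // i j; rewrite ord1; exact: H.
Qed.

Lemma cvg_rV (R : realType) (T : Type) (F : set_system T) {FF : Filter F} n
    (f : T -> 'rV[R]_n) (l : 'rV[R]_n) :
  (forall i, f x 0 i @[x --> F] --> l 0 i) -> f @ F --> l.
Proof.
move=> H; apply/cvg_ballP => e e0.
have : \forall z \near F, forall i, ball (l 0 i) e (f z 0 i).
  by apply: filter_forall => i; have /cvg_ballP := H i; exact.
by apply: filterS => z Hz; apply/ball_rVP.
Qed.

(* Follow the increments of [f] along a path parallel to the axes. *)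
Lemma increment (R : realType) n (f : 'rV[R]_n -> R) (p z : 'rV[R]_n) (e : R) :
  ball p e z ->
  (forall (x : 'rV[R]_n) (i : 'I_n), ball p e x -> derivable f x (delta_mx 0 i)) ->
  exists2 xi : 'I_n -> 'rV[R]_n,
    (forall i (e' : R), ball p e' z -> ball p e' (xi i)) &
    f z - f p = \sum_i (z 0 i - p 0 i) * 'D_(delta_mx 0 i) f (xi i).
Proof.
move=> pz H.
pose q (j : nat) : 'rV[R]_n := \row_l (if (l < j)%N then z 0 l else p 0 l).
have qS (i : 'I_n) : q i.+1 = q i + (z 0 i - p 0 i) *: delta_mx 0 i.
  apply/rowP => l; rewrite !mxE eqxx /= ltnS leq_eqVlt.
  have [->|li] := eqVneq l i; first by rewrite eqxx ltnn mulr1 addrC subrK.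
  by rewrite (negbTE (_ : nat_of_ord l != i)) //= mulr0 addr0.
(* The i-th edge of the path stays in every ball around [p] that contains [z], whatever its radius;
   hence the intermediate points tend to [p] whenever [z] does. *)
have qb (i : 'I_n) (s e' : R) : 0 <= s <= 1 -> ball p e' z ->
    ball p e' (q i + (s * (z 0 i - p 0 i)) *: delta_mx 0 i).
  move=> /andP[s0 s1] pe; have e_gt0 : 0 < e' by case: pe.
  move: pe => /ball_rVP => /(_ e_gt0) pe; apply/ball_rVP => // l.
  rewrite !mxE eqxx /=; have [->|li] := eqVneq l i.
    rewrite ltnn mulr1 opprD addrA subrr add0r normrN normrM (ger0_norm s0).
    rewrite distrC; apply: le_lt_trans (pe i); exact: ler_piMl.
  rewrite mulr0 addr0; case: ifP => // _; by rewrite subrr normr0.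
have step (i : 'I_n) : exists s : R, 0 <= s <= 1 /\
   f (q i.+1) - f (q i) = (z 0 i - p 0 i) *
     'D_(delta_mx 0 i) f (q i + (s * (z 0 i - p 0 i)) *: delta_mx 0 i).
  rewrite qS; have [|s Hs E] := @mvt_line R n f (q i) (delta_mx 0 i) (z 0 i - p 0 i).
    by move=> s Hs; apply: H; exact: qb.
  by exists s.
pose s i := sval (cid (step i)).
have Hs i : 0 <= s i <= 1 by rewrite /s; case: cid => ? [].
exists (fun i : 'I_n => q i + (s i * (z 0 i - p 0 i)) *: delta_mx 0 i).
  by move=> i e'; exact: qb.
rewrite (eq_bigr (fun i : 'I_n => f (q i.+1) - f (q i))); last first.
  by move=> i _; rewrite /s; case: cid => ? [].
rewrite -(big_mkord xpredT (fun i => f (q i.+1) - f (q i))) telescope_sumr //.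
by congr (f _ - f _); apply/rowP => l; rewrite !mxE ?ltn_ord.
Qed.

(** Chain rule from continuous partial derivatives: the increment of [f] is a combination of its
    partial derivatives at intermediate points, and these tend to [tau x]. *)
Lemma is_derive_comp_rV (R : realType) (V : normedModType R) n (x v : V)
    (tau : V -> 'rV[R]_n) (dtau : 'I_n -> R) (W : set 'rV[R]_n) f :
  open W -> W (tau x) -> Cr 1 W f -> {for x, continuous tau} ->
  (forall i, is_derive x v (fun z => tau z 0 i) (dtau i)) ->
  is_derive x v (f \o tau) (\sum_i dtau i * 'D_(delta_mx 0 i) f (tau x)).
Proof.
move=> oW Wx [_ Cf] ct dt.
have [e /= e0 eW] : exists2 e : R, 0 < e & ball (tau x) e `<=` W.
  by apply/nbhs_ballP; exact: open_nbhs_nbhs.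
have /boolp.choice [xi Hxi] : forall z : 'rV[R]_n, exists xi : 'I_n -> 'rV[R]_n,
   ball (tau x) e z ->
   (forall i (e' : R), ball (tau x) e' z -> ball (tau x) e' (xi i)) /\
    f z - f (tau x) = \sum_i (z 0 i - tau x 0 i) * 'D_(delta_mx 0 i) f (xi i).
  move=> z.
  have [ze|nze] := pselect (ball (tau x) e z); last by exists (fun=> 0).
  have [|xi H1 H2] := increment ze (f := f); last by exists xi.
  by move=> y i /eW Wy; have [+ _] := Cf i; apply.
have c0 : tau (h *: v + x) @[h --> (0 : R)^'] --> tau x.
  have l0 : (h *: v + x) @[h --> (0 : R)^'] --> x.
    rewrite -[X in _ --> X]add0r -(scale0r v); apply: cvgD; last exact: cvg_cst.
    by apply: cvgZr_tmp; apply: cvg_within.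
  exact: (cvg_comp _ _ l0 ct).
have near_e (e' : R) : 0 < e' -> \forall h \near (0 : R)^', ball (tau x) e' (tau (h *: v + x)).
  by move=> e'0; apply: (c0 (ball (tau x) e')); exact: nbhsx_ballx.
have L : (fun h : R => h^-1 *: (((f \o tau) \o shift x) (h *: v) - (f \o tau) x)) @
     0^' --> \sum_i dtau i * 'D_(delta_mx 0 i) f (tau x).
  apply: (@cvg_trans _ (\sum_i (h^-1 * (tau (h *: v + x) 0 i - tau x 0 i)) *
      'D_(delta_mx 0 i) f (xi (tau (h *: v + x)) i) @[h --> (0 : R)^'])).
    apply: near_eq_cvg; near=> h; rewrite /= (Hxi _ _).2; last by near: h; exact: near_e.
    by rewrite scaler_sumr; apply: eq_bigr => i _; rewrite /GRing.scale /= mulrA.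
  apply: cvg_big => [|i _]; first exact: add_continuous.
  apply: cvgM.
    have [d1 d2] := dt i; rewrite -d2; exact: d1.
  have [_ [cD _]] := Cf i.
  have cxi : xi (tau (h *: v + x)) i @[h --> (0 : R)^'] --> tau x.
    apply/cvg_ballP => e' e'0; near=> h.
    by apply: (Hxi _ _).1; near: h; exact: near_e.
  exact: (cvg_comp _ _ cxi (cD _ Wx)).
by split; [apply/cvg_ex; eexists; exact: L|exact: cvg_lim L].
Unshelve. all: by end_near.
Qed.

(** Induction on [r]: the chain rule expresses the derivatives of the composite by those of [tau]
    and by composites of [tau] with the derivatives of [f], which are one order less regular. *)
Lemma Cr_comp (R : realType) m n r (U : set 'rV[R]_m) (W : set 'rV[R]_n)
    (tau : 'rV[R]_m -> 'rV[R]_n) f :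
  open U -> open W -> (forall x, U x -> W (tau x)) ->
  (forall i, Cr r U (fun x => tau x 0 i)) -> Cr r W f -> Cr r U (f \o tau).
Proof.
move=> oU oW UW Ct.
have ctau : forall x, U x -> {for x, continuous tau}.
  move=> x Ux; apply: (@cvg_rV _ _ (nbhs x)) => i.
  exact: Cr_continuous (Ct i) _ Ux.
elim: r f Ct => [|r IH] f Ct Cf; have [cf df] := Cf.
  split => // x Ux; apply: continuous_comp; first exact: ctau.
  exact: cf (UW _ Ux).
have Ct' i : Cr r U (fun x => tau x 0 i) by exact: CrW.
have dc x (i : 'I_m) : U x -> is_derive x (delta_mx 0 i) (f \o tau)
    (\sum_j 'D_(delta_mx 0 i) (fun x => tau x 0 j) x * 'D_(delta_mx 0 j) f (tau x)).
  move=> Ux; apply: (is_derive_comp_rV oW); [exact: UW| |exact: ctau|].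
    have : Cr 1 W f by move: Cf; clear; elim: r => [//|r IH /CrW]; exact: IH.
    by [].
  by move=> j; have [_ /(_ i) [H _]] := Ct j; apply: derivableP; exact: H.
split; first by move=> x Ux; apply: continuous_comp; [exact: ctau|exact: cf (UW _ Ux)].
move=> i; split; first by move=> x Ux; have [] := dc x i Ux.
apply: (@eq_Cr _ _ _ _ (fun x => \sum_j 'D_(delta_mx 0 i) (fun x => tau x 0 j) x *
    'D_(delta_mx 0 j) f (tau x))) => //.
  by move=> x Ux; have [_ ->] := dc x i Ux.
apply: Cr_sum => // j _; apply: CrM => //.
  by have [_ /(_ i) []] := Ct j.
by apply: (IH ('D_(delta_mx 0 j) f)) => //; have [_ ] := df j.
Qed.

(** * Smooth functions and maps *)

Definition Cinf (R : realType) n (U : set 'rV[R]_n) (f : 'rV[R]_n -> R) :=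
  forall r, Cr r U f.

(* Smoothness needs neither the Hausdorff property nor second countability,
   which are thus not proved for the products. *)
Record is_premanifold (R : realType) (X : chartedSpace R) : Prop := IsPremanifold {
  pmf_cover : forall x : X, exists2 a, atlas X a & chart_dom a x;
  pmf_open_dom : forall a, atlas X a -> open (chart_dom a);
  pmf_chart_inj : forall a, atlas X a ->
    forall x y, chart_dom a x -> chart_dom a y -> a x = a y -> x = y;
  pmf_chart_continuous : forall a, atlas X a ->
    forall x, chart_dom a x -> {for x, continuous a};
  pmf_chart_open : forall a, atlas X a ->
    forall O : set X, open O -> O `<=` chart_dom a -> open (a @` O);
  pmf_compatible : forall a b, atlas X a -> atlas X b ->
    chart_smooth a b setT id }.

Lemma manifold_premanifold (R : realType) (X : chartedSpace R) :
  is_manifold X -> is_premanifold X.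
Proof. by case=> _ _ *; split. Qed.

(** A germ condition in a single chart, chosen because it is easy to establish; [rsmooth_at_chart]
    passes to any other chart. The representation holds on a whole neighbourhood, so smoothness at
    [x] implies smoothness near [x]. *)
Definition rsmooth_at (R : realType) (X : chartedSpace R) (x : X) (f : X -> R) :=
  exists a (W : set 'rV[R]_(mdim X)) tau,
    [/\ atlas X a, chart_dom a x, open W /\ W (a x), Cinf W tau
      & \forall z \near x, f z = tau (a z)].

(** Continuity is a separate clause because the coordinates [b (f z)] mean nothing once [f z] leaves
    the domain of [b]. *)
Definition smooth_at (R : realType) (X Y : chartedSpace R) (x : X) (f : X -> Y) :=
  {for x, continuous f} /\
  forall b, atlas Y b -> chart_dom b (f x) ->
    forall i, rsmooth_at x (fun z => b (f z) 0 i).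

Lemma open_preimageI (S T : topologicalType) (U : set S) (W : set T) (f : S -> T) :
  open U -> open W -> (forall x, U x -> {for x, continuous f}) ->
  open (U `&` f @^-1` W).
Proof.
move=> oU oW cf; rewrite openE => x [Ux Wx]; apply: filterI.
  exact: open_nbhs_nbhs.
apply: cf => //; exact: open_nbhs_nbhs.
Qed.

Lemma open_bigcap_fin (T : topologicalType) (I : finType) (V : I -> set T) :
  (forall i, open (V i)) -> open (\bigcap_(i in [set: I]) V i).
Proof.
move=> oV; rewrite openE => u Vu.
have : \forall y \near u, forall i, V i y.
  by apply: filter_forall => i; apply: open_nbhs_nbhs; split; [|exact: Vu].
by apply: filterS => y Hy i _; exact: Hy.
Qed.

Lemma euclidean_smooth_continuous (R : realType) m n (U : set 'rV[R]_m)
    (tau : 'rV[R]_m -> 'rV[R]_n) :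
  euclidean_smooth U tau -> forall x, U x -> {for x, continuous tau}.
Proof.
move=> st x Ux; apply: (@cvg_rV _ _ (nbhs x)) => i.
exact: Cr_continuous (st i 0%N) _ Ux.
Qed.

Lemma rsmooth_at_near (R : realType) (X : chartedSpace R) (x : X) (f g : X -> R) :
  (\forall z \near x, f z = g z) -> rsmooth_at x f -> rsmooth_at x g.
Proof.
move=> fg [a [W [tau [Aa ax Wa Ct ft]]]]; exists a, W, tau; split => //.
by apply: filterS2 fg ft => z <-.
Qed.

Lemma rsmooth_at_chart (R : realType) (X : chartedSpace R) (x : X) (f : X -> R) b :
  is_premanifold X -> rsmooth_at x f -> atlas X b -> chart_dom b x ->
  exists (W : set 'rV[R]_(mdim X)) tau,
    [/\ open W, W (b x), Cinf W tau & \forall z \near x, f z = tau (b z)].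
Proof.
move=> pX [a [W [tau [Aa ax [oW Wa] Ct ft]]]] Ab bx.
have [tau' st' Et'] := pmf_compatible pX Ab Aa.
set D := _ `&` _ in st' Et'.
have oD : open D.
  by apply: openI; [apply: openI; [exact: (pmf_open_dom pX)|exact: openT]|exact: (pmf_open_dom pX)].
have obD : open (b @` D).
  by apply: (pmf_chart_open pX) => // z [[]].
have Dx : D x by [].
have ct' := euclidean_smooth_continuous st'.
exists (b @` D `&` tau' @^-1` W), (tau \o tau'); split.
- exact: open_preimageI.
- by split; [exists x|rewrite /= -Et'].
- move=> r; apply: (Cr_comp (W := W)) => //.
  + exact: open_preimageI.
  + by move=> y [].
  + by move=> i; apply: Cr_sub (st' i r) => y [].
- near=> z; rewrite /= -Et' /=; first by near: z.
  by near: z; exact: open_nbhs_nbhs.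
Unshelve. all: by end_near.
Qed.

Lemma rsmooth_at_cst (R : realType) (X : chartedSpace R) (x : X) (c : R) :
  is_premanifold X -> rsmooth_at x (fun=> c).
Proof.
move=> pX; have [a Aa ax] := pmf_cover pX x.
exists a, setT, (cst c); split => //; first by split => //; exact: openT.
  by move=> r; exact: Cr_cst.
exact: filterE.
Qed.

Lemma rsmooth_at_chartE (R : realType) (X : chartedSpace R) (x : X) a i :
  atlas X a -> chart_dom a x -> rsmooth_at x (fun z => a z 0 i).
Proof.
move=> Aa ax; exists a, setT, (fun u => u 0 i); split => //.
- by split => //; exact: openT.
- by move=> r; exact: Cr_coord.
- exact: filterE.
Qed.

(** Sums, products and inverses of smooth functions all reduce to this statement, by packing the
    functions into a row vector. *)
Lemma rsmooth_at_comp_Cinf (R : realType) (X : chartedSpace R) (x : X) n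
    (F : X -> 'rV[R]_n) (W : set 'rV[R]_n) (tau : 'rV[R]_n -> R) :
  is_premanifold X -> (forall i, rsmooth_at x (fun z => F z 0 i)) ->
  open W -> W (F x) -> Cinf W tau -> rsmooth_at x (fun z => tau (F z)).
Proof.
move=> pX sF oW Wx Ct; have [a Aa ax] := pmf_cover pX x.
have /boolp.choice [V HV] : forall i, exists V : set 'rV[R]_(mdim X), exists t,
    [/\ open V, V (a x), Cinf V t & \forall z \near x, F z 0 i = t (a z)].
  by move=> i; have [V [t H]] := rsmooth_at_chart pX (sF i) Aa ax; exists V, t.
have {HV} /boolp.choice [t Ht] := HV.
pose V0 := \bigcap_(i in [set: 'I_n]) V i.
have oV0 : open V0 by apply: open_bigcap_fin => i; have [] := Ht i.
have V0x : V0 (a x) by move=> i _; have [] := Ht i.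
pose T (u : 'rV[R]_(mdim X)) : 'rV[R]_n := \row_i t i u.
have sT : euclidean_smooth V0 T.
  move=> i r; apply: (@eq_Cr _ _ _ _ (t i)) => //; first by move=> u _; rewrite mxE.
  by have [_ _ Cti _] := Ht i; apply: Cr_sub (Cti r) => u /(_ i I).
have cT := euclidean_smooth_continuous sT.
have nT : \forall z \near x, F z = T (a z).
  have : \forall z \near x, forall i, F z 0 i = t i (a z).
    by apply: filter_forall => i; have [] := Ht i.
  by apply: filterS => z Hz; apply/rowP => i; rewrite mxE.
exists a, (V0 `&` T @^-1` W), (tau \o T); split => //.
- split; first exact: open_preimageI.
  by split => //; rewrite /= -(nbhs_singleton nT).
- move=> r; apply: (Cr_comp (W := W)) => //.
  + exact: open_preimageI.
  + by move=> y [].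
  + by move=> i; apply: Cr_sub (sT i r) => y [].
- by apply: filterS nT => z ->.
Qed.

Lemma rsmooth_at_continuous (R : realType) (X : chartedSpace R) (x : X) (f : X -> R) :
  is_premanifold X -> rsmooth_at x f -> {for x, continuous f}.
Proof.
move=> pX [a [W [tau [Aa ax [oW Wa] Ct ft]]]].
rewrite /prop_for /continuous_at (nbhs_singleton ft).
apply: (@cvg_trans _ (tau (a z) @[z --> x])).
  by apply: near_eq_cvg; apply: filterS ft => z.
apply: (continuous_comp (pmf_chart_continuous pX Aa ax)).
exact: Cr_continuous (Ct 0%N) _ Wa.
Qed.

Section rsmooth_algebra.
Variables (R : realType) (X : chartedSpace R) (pX : is_premanifold X) (x : X).
Implicit Types f g : X -> R.

Lemma rsmooth_atD f g : rsmooth_at x f -> rsmooth_at x g ->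
  rsmooth_at x (fun z => f z + g z).
Proof.
move=> sf sg; pose F (z : X) : 'rV[R]_2 := \row_i (if i == 0 then f z else g z).
apply: (@rsmooth_at_near _ _ _ (fun z => F z 0 0 + F z 0 1)).
  by apply: filterE => z; rewrite /F !mxE.
apply: (@rsmooth_at_comp_Cinf _ _ _ _ _ setT (fun u => u 0 0 + u 0 1)) => //.
- by move=> i; apply: rsmooth_at_near (if i == 0 as b return
    rsmooth_at x (fun z => if b then f z else g z) then sf else sg);
    apply: filterE => z; rewrite mxE.
- exact: openT.
- by move=> r; apply: CrD; [exact: openT|exact: Cr_coord..].
Qed.

Lemma rsmooth_atM f g : rsmooth_at x f -> rsmooth_at x g ->
  rsmooth_at x (fun z => f z * g z).
Proof.
move=> sf sg; pose F (z : X) : 'rV[R]_2 := \row_i (if i == 0 then f z else g z).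
apply: (@rsmooth_at_near _ _ _ (fun z => F z 0 0 * F z 0 1)).
  by apply: filterE => z; rewrite /F !mxE.
apply: (@rsmooth_at_comp_Cinf _ _ _ _ _ setT (fun u => u 0 0 * u 0 1)) => //.
- by move=> i; apply: rsmooth_at_near (if i == 0 as b return
    rsmooth_at x (fun z => if b then f z else g z) then sf else sg);
    apply: filterE => z; rewrite mxE.
- exact: openT.
- by move=> r; apply: CrM; [exact: openT|exact: Cr_coord..].
Qed.

Lemma rsmooth_at_sum (I : Type) (s : seq I) (P : pred I) (F : I -> X -> R) :
  (forall i, P i -> rsmooth_at x (F i)) ->
  rsmooth_at x (fun z => \sum_(i <- s | P i) F i z).
Proof.
move=> H; rewrite (_ : (fun _ => _) = \sum_(i <- s | P i) F i); last first.
  by apply/funext => z; rewrite fct_sumE.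
elim/big_rec : _ => [|i f Pi Cf]; first exact: rsmooth_at_cst.
by apply: rsmooth_atD => //; exact: H.
Qed.

Lemma rsmooth_at_prod (I : Type) (s : seq I) (P : pred I) (F : I -> X -> R) :
  (forall i, P i -> rsmooth_at x (F i)) ->
  rsmooth_at x (fun z => \prod_(i <- s | P i) F i z).
Proof.
move=> H; rewrite (_ : (fun _ => _) = \prod_(i <- s | P i) F i); last first.
  by apply/funext => z; rewrite fct_prodE.
elim/big_rec : _ => [|i f Pi Cf]; first exact: rsmooth_at_cst.
by apply: rsmooth_atM => //; exact: H.
Qed.

Lemma rsmooth_atX f n : rsmooth_at x f -> rsmooth_at x (fun z => f z ^+ n).
Proof.
move=> sf; apply: (@rsmooth_at_near _ _ _ (fun z => \prod_(i < n) f z)).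
  by apply: filterE => z; rewrite prodr_const card_ord.
exact: rsmooth_at_prod.
Qed.

Lemma rsmooth_atN f : rsmooth_at x f -> rsmooth_at x (fun z => - f z).
Proof.
move=> sf; apply: (@rsmooth_at_near _ _ _ (fun z => (-1) * f z)).
  by apply: filterE => z; rewrite mulN1r.
by apply: rsmooth_atM => //; exact: rsmooth_at_cst.
Qed.

Lemma rsmooth_atV f : f x != 0 -> rsmooth_at x f ->
  rsmooth_at x (fun z => (f z)^-1).
Proof.
move=> fx0 sf; pose F (z : X) : 'rV[R]_1 := \row_i f z.
pose W := [set: 'rV[R]_1] `&` (fun u : 'rV[R]_1 => u 0 0) @^-1` [set t | t != 0].
have oW : open W.
  apply: open_preimageI; [exact: openT|exact: open_neq|].
  by move=> u _; exact: coord_continuous.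
apply: (@rsmooth_at_near _ _ _ (fun z => (F z 0 0)^-1)).
  by apply: filterE => z; rewrite mxE.
apply: (@rsmooth_at_comp_Cinf _ _ _ _ _ W (fun u => (u 0 0)^-1)) => //.
- by move=> i; apply: rsmooth_at_near sf; apply: filterE => z; rewrite mxE.
- by split => //=; rewrite mxE.
- by move=> r; apply: CrV => [//|u []//|]; exact: Cr_coord.
Qed.

End rsmooth_algebra.

(** The bridge between the definition by pairs of charts and the pointwise notion. In the converse
    direction the expression in charts is defined globally by inverting [a], and its regularity is
    checked locally. *)
Lemma smooth_onP (R : realType) (X Y : chartedSpace R) (U : set X) (f : X -> Y) :
  is_premanifold X -> is_premanifold Y -> open U ->
  smooth_on U f <-> forall x, U x -> smooth_at x f.
Proof.
move=> pX pY oU; split.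
  move=> [cf sf] x Ux; split; first exact: cf.
  move=> b Ab bx i; have [a Aa ax] := pmf_cover pX x.
  have [tau st Et] := sf a b Aa Ab; set D := _ `&` _ in st Et.
  have oD : open D.
    rewrite /D -setIA; apply: openI; first exact: (pmf_open_dom pX).
    by apply: open_preimageI => //; exact: (pmf_open_dom pY).
  exists a, (a @` D), (fun u => tau u 0 i); split => //.
  - split; last by exists x.
    by apply: (pmf_chart_open pX) => // z [[]].
  - have Dx : D x by [].
    by apply: filterS (open_nbhs_nbhs (conj oD Dx)) => z Dz; rewrite Et.
move=> H; split; first by move=> x /H [].
move=> a b Aa Ab; rewrite /chart_smooth; set D := _ `&` _ `&` _.
have oD : open D.
  rewrite /D -setIA; apply: openI; first exact: (pmf_open_dom pX).
  apply: open_preimageI => //; first exact: (pmf_open_dom pY).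
  by move=> x /H [].
(* This is [b \o f \o a^-1] on the image of [D], where [a] is injective; the value 0 elsewhere is a
   default. *)
pose tau (u : 'rV[R]_(mdim X)) : 'rV[R]_(mdim Y) :=
  match pselect (exists2 z, D z & a z = u) with
  | left E => b (f (s2val (cid2 E))) | right _ => 0 end.
have tauE x : D x -> b (f x) = tau (a x).
  move=> Dx; rewrite /tau; case: pselect => [E|]; last by case; exists x.
  case: cid2 => /= z Dz az; congr (b (f _)).
  by apply: (pmf_chart_inj pX Aa) => //; [case: Dx => [[]]|case: Dz => [[]]].
exists tau => // i r; apply: Cr_local => _ [x Dx <-].
have [[ax Ux] bx] := Dx; have [_ sx] := H x Ux.
have [W [t [oW Wx Ct nt]]] := rsmooth_at_chart pX (sx b Ab bx i) Aa ax.
have [V [oV Vx VH]] : exists V : set X, [/\ open V, V x &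
    V `<=` [set z | D z /\ b (f z) 0 i = t (a z)]].
  have : nbhs x [set z | D z /\ b (f z) 0 i = t (a z)].
    by apply: filterI => //; exact: open_nbhs_nbhs.
  by rewrite nbhsE => -[V [? ?] ?]; exists V.
have oaV : open (a @` V).
  by apply: (pmf_chart_open pX) => // z /VH [[[]]].
exists (a @` V `&` W); first by split => //; exists x.
apply: (@eq_Cr _ _ _ _ t); first exact: openI.
  by move=> _ [[z /VH [Dz tz] <-] _]; rewrite -tauE.
by apply: Cr_sub (Ct r) => u [].
Qed.

Lemma rsmooth_at_pullback (R : realType) (X Y : chartedSpace R) (x : X) (f : X -> Y)
    (g : Y -> R) :
  is_premanifold X -> smooth_at x f -> rsmooth_at (f x) g ->
  rsmooth_at x (g \o f).
Proof.
move=> pX [cf sf] [b [W [tau [Ab bx [oW Wb] Ct gt]]]].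
apply: (@rsmooth_at_near _ _ _ (fun z => tau (b (f z)))).
  have := cf _ gt; rewrite nbhs_simpl /=.
  by apply: filterS => z /= ->.
apply: (@rsmooth_at_comp_Cinf _ _ _ _ (fun z => b (f z)) W) => //.
by move=> i; exact: sf.
Qed.

Lemma smooth_at_comp (R : realType) (X Y Z : chartedSpace R) (x : X) (f : X -> Y)
    (g : Y -> Z) :
  is_premanifold X -> smooth_at x f -> smooth_at (f x) g -> smooth_at x (g \o f).
Proof.
move=> pX sf [cg sg]; split.
  by apply: continuous_comp => //; exact: sf.1.
move=> c Ac cx i.
exact: (rsmooth_at_pullback pX sf (sg c Ac cx i)).
Qed.

Lemma smooth_at_near (R : realType) (X Y : chartedSpace R) (x : X) (f g : X -> Y) :
  (\forall z \near x, f z = g z) -> smooth_at x f -> smooth_at x g.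
Proof.
move=> fg [cf sf]; have fgx := nbhs_singleton fg; split.
  rewrite /prop_for /continuous_at -fgx.
  exact: cvg_trans (near_eq_cvg fg) cf.
move=> b Ab; rewrite -fgx => bx i; apply: rsmooth_at_near (sf b Ab bx i).
by apply: filterS fg => z ->.
Qed.

(** One chart around [f x] is enough, since the coordinates in any other chart are smooth functions
    of those in [b]. *)
Lemma smooth_at_chart (R : realType) (X Y : chartedSpace R) (x : X) (f : X -> Y) b :
  is_premanifold X -> is_premanifold Y -> {for x, continuous f} ->
  atlas Y b -> chart_dom b (f x) ->
  (forall i, rsmooth_at x (fun z => b (f z) 0 i)) -> smooth_at x f.
Proof.
move=> pX pY cf Ab bx H; split => // c Ac cx i.
have [W [tau [oW Wb Ct ct]]] :=
  rsmooth_at_chart pY (rsmooth_at_chartE i Ac cx) Ab bx.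
apply: (@rsmooth_at_near _ _ _ (fun z => tau (b (f z)))).
  have := cf _ ct; rewrite nbhs_simpl /=.
  by apply: filterS => z /= ->.
exact: (@rsmooth_at_comp_Cinf _ _ _ _ (fun z => b (f z)) W).
Qed.

(** * Euclidean spaces, the real line and products *)

Lemma euclidean_premanifold (R : realType) n : is_premanifold (euclidean R n).
Proof.
split => /=.
- by move=> x; exists (Chart setT id).
- by move=> _ ->; exact: openT.
- by move=> _ -> x y.
- by move=> _ -> x _; exact: cvg_id.
- by move=> _ -> O; rewrite image_id.
- move=> _ _ -> ->; exists id => // i r; exact: Cr_coord.
Qed.

Lemma smooth_at_euclidean (R : realType) (X : chartedSpace R) (x : X) n
    (f : X -> euclidean R n) : is_premanifold X ->
  smooth_at x f <-> forall i, rsmooth_at x (fun z => (f z : 'rV[R]_n) 0 i).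
Proof.
move=> pX; split; first by move=> [_ H] i; exact: (H (Chart setT id)).
move=> H; split; last by move=> _ -> _ i; exact: H.
apply: (@cvg_rV _ _ (nbhs x)) => i.
exact: rsmooth_at_continuous (H i).
Qed.

Lemma real_line_premanifold (R : realType) : is_premanifold (real_line R).
Proof.
split => /=.
- by move=> x; exists (Chart setT (fun x => const_mx x)).
- by move=> _ ->; exact: openT.
- by move=> _ -> x y _ _ /= /matrixP /(_ 0 0); rewrite !mxE.
- move=> _ -> x _; apply: (@cvg_rV _ _ (nbhs x)) => i; rewrite mxE.
  by under eq_fun do rewrite /= mxE; exact: cvg_id.
- move=> _ -> O oO _ /=.
  rewrite (_ : _ @` O = setT `&` (fun u : 'rV[R]_1 => u 0 0) @^-1` O).
    apply: open_preimageI => //; first exact: openT.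
    by move=> u _; exact: coord_continuous.
  apply/seteqP; split; first by move=> _ [t Ot <-]; split => //=; rewrite mxE.
  move=> u [_ Ou]; exists (u 0 0) => //; apply/matrixP => i j.
  by rewrite mxE !ord1.
- move=> _ _ -> ->; exists id => // i r; exact: Cr_coord.
Qed.

Lemma smooth_at_real_line (R : realType) (X : chartedSpace R) (x : X)
    (f : X -> real_line R) : is_premanifold X ->
  smooth_at x f <-> rsmooth_at x (f : X -> R).
Proof.
move=> pX; split.
  move=> [_ H]; have := H (Chart setT (fun x => const_mx x)) erefl I ord0.
  by apply: rsmooth_at_near; apply: filterE => z /=; rewrite mxE.
move=> H; split; last first.
  move=> _ -> _ i; apply: rsmooth_at_near H.
  by apply: filterE => z /=; rewrite mxE.
exact: rsmooth_at_continuous H.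
Qed.

Lemma smooth_funP (R : realType) (X : chartedSpace R) (f : X -> R) :
  is_premanifold X -> smooth_fun f <-> forall x, rsmooth_at x f.
Proof.
move=> pX; rewrite /smooth_fun /smooth.
rewrite (smooth_onP _ pX (real_line_premanifold R) openT); split.
  by move=> H x; have [+ _] := @smooth_at_real_line _ _ x f pX; apply; exact: H.
by move=> H x _; have [_] := @smooth_at_real_line _ _ x f pX; apply; exact: H.
Qed.

Lemma rsmooth_at_real_id (R : realType) (t : R) :
  @rsmooth_at R (real_line R) t (fun s => s).
Proof.
have := @rsmooth_at_chartE R (real_line R) t (Chart setT (fun x => const_mx x)) ord0 erefl I.
by apply: rsmooth_at_near; apply: filterE => z /=; rewrite mxE.
Qed.

Lemma open_row_mx (R : realType) m n (A : set 'rV[R]_m) (B : set 'rV[R]_n) :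
  open A -> open B ->
  open [set u : 'rV[R]_(m + n) | A (lsubmx u) /\ B (rsubmx u)].
Proof.
move=> oA oB; rewrite openE => u [Au Bu]; apply: filterI.
  have cl : lsubmx v @[v --> u] --> lsubmx u.
    apply: (@cvg_rV _ _ (nbhs u)) => i; rewrite mxE.
    by under eq_fun do rewrite mxE; exact: coord_continuous.
  by apply: cl; apply: open_nbhs_nbhs.
have cr : rsubmx v @[v --> u] --> rsubmx u.
  apply: (@cvg_rV _ _ (nbhs u)) => i; rewrite mxE.
  by under eq_fun do rewrite mxE; exact: coord_continuous.
by apply: cr; apply: open_nbhs_nbhs.
Qed.

Lemma prod_premanifold (R : realType) (X Y : chartedSpace R) :
  is_premanifold X -> is_premanifold Y -> is_premanifold (prod_space X Y).
Proof.
move=> pX pY; split => /=.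
- move=> [x y]; have [a Aa ax] := pmf_cover pX x; have [b Ab bx] := pmf_cover pY y.
  by exists (prod_chart a b); [exists a, b|].
- move=> _ [a [b [Aa Ab ->]]] /=; rewrite openE => -[x y] [/= ax bx].
  exists (chart_dom a, chart_dom b) => //=; split; apply: open_nbhs_nbhs.
    by split => //; exact: (pmf_open_dom pX).
  by split => //; exact: (pmf_open_dom pY).
- move=> _ [a [b [Aa Ab ->]]] [x y] [x' y'] /= [ax bx] [ax' bx'] /eq_row_mx [E1 E2].
  congr pair; first exact: (pmf_chart_inj pX Aa).
  exact: (pmf_chart_inj pY Ab).
- move=> _ [a [b [Aa Ab ->]]] [x y] [/= ax bx].
  apply: (@cvg_rV _ _ (nbhs (x, y))) => i /=; case: (split_ordP i) => j ->.
    rewrite row_mxEl; under eq_fun do rewrite row_mxEl.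
    apply: (@cvg_comp _ _ _ fst (fun z => a z 0 j) _ (nbhs x)); first exact: cvg_fst.
    exact: rsmooth_at_continuous (rsmooth_at_chartE j Aa ax).
  rewrite row_mxEr; under eq_fun do rewrite row_mxEr.
  apply: (@cvg_comp _ _ _ snd (fun z => b z 0 j) _ (nbhs y)); first exact: cvg_snd.
  exact: rsmooth_at_continuous (rsmooth_at_chartE j Ab bx).
- move=> _ [a [b [Aa Ab ->]]] /= O oO Od; rewrite openE => _ [[x y] Oxy <-] /=.
  move: (oO); rewrite openE => /(_ _ Oxy) [[P Q] /= [nP nQ] PQ].
  have [ax bx] := Od _ Oxy.
  have [P' [oP' P'x P'P]] : exists P' : set X, [/\ open P', P' x & P' `<=` P `&` chart_dom a].
    have : nbhs x (P `&` chart_dom a).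
      by apply: filterI => //; apply: open_nbhs_nbhs; split => //; exact: (pmf_open_dom pX).
    by rewrite nbhsE => -[P' [? ?] ?]; exists P'.
  have [Q' [oQ' Q'x Q'Q]] : exists Q' : set Y, [/\ open Q', Q' y & Q' `<=` Q `&` chart_dom b].
    have : nbhs y (Q `&` chart_dom b).
      by apply: filterI => //; apply: open_nbhs_nbhs; split => //; exact: (pmf_open_dom pY).
    by rewrite nbhsE => -[Q' [? ?] ?]; exists Q'.
  pose S := [set u : 'rV[R]_(mdim X + mdim Y) | (a @` P') (lsubmx u) /\ (b @` Q') (rsubmx u)].
  have oS : open S.
    apply: open_row_mx.
      by apply: (pmf_chart_open pX) => // z /P'P [].
    by apply: (pmf_chart_open pY) => // z /Q'Q [].
  have Sx : S (row_mx (a x) (b y)).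
    by split; rewrite ?row_mxKl ?row_mxKr; [exists x|exists y].
  apply: filterS (open_nbhs_nbhs (conj oS Sx)) => u [[z P'z az] [w Q'w bw]].
  exists (z, w); first by apply: PQ; split; [have [] := P'P _ P'z|have [] := Q'Q _ Q'w].
  by rewrite /= az bw hsubmxK.
- move=> _ _ [a [b [Aa Ab ->]]] [a' [b' [Aa' Ab' ->]]].
  have [t1 st1 Et1] := pmf_compatible pX Aa Aa'.
  have [t2 st2 Et2] := pmf_compatible pY Ab Ab'.
  set D1 := _ `&` _ in st1 Et1; set D2 := _ `&` _ in st2 Et2.
  rewrite /chart_smooth /=; set D := _ `&` _ `&` _.
  have oD1 : open (a @` D1).
    apply: (pmf_chart_open pX) => //; last by move=> z [[]].
    apply: openI; last exact: (pmf_open_dom pX).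
    by apply: openI; [exact: (pmf_open_dom pX)|exact: openT].
  have oD2 : open (b @` D2).
    apply: (pmf_chart_open pY) => //; last by move=> z [[]].
    apply: openI; last exact: (pmf_open_dom pY).
    by apply: openI; [exact: (pmf_open_dom pY)|exact: openT].
  pose S := [set u : 'rV[R]_(mdim X + mdim Y) | (a @` D1) (lsubmx u) /\ (b @` D2) (rsubmx u)].
  have oS : open S by exact: open_row_mx.
  exists (fun u => row_mx (t1 (lsubmx u)) (t2 (rsubmx u))); last first.
    move=> [x y] [[[/= ax bx] _] [/= ax' bx']].
    by rewrite row_mxKl row_mxKr -Et1 // -Et2.
  move=> i r; apply: (@Cr_sub _ _ _ S).
    move=> _ [[x y] [[[/= ax bx] _] [/= ax' bx']] <-].
    by split; rewrite ?row_mxKl ?row_mxKr; [exists x|exists y].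
  case: (split_ordP i) => j ->.
    under eq_fun do rewrite row_mxEl.
    apply: (Cr_comp (tau := lsubmx) (f := fun u => t1 u 0 j) oS oD1) => //.
    + by move=> u [].
    + by move=> l; under eq_fun do rewrite mxE; exact: Cr_coord.
  under eq_fun do rewrite row_mxEr.
  apply: (Cr_comp (tau := rsubmx) (f := fun u => t2 u 0 j) oS oD2) => //.
  + by move=> u [].
  + by move=> l; under eq_fun do rewrite mxE; exact: Cr_coord.
Qed.

Lemma smooth_at_pair (R : realType) (X Y Z : chartedSpace R) (x : X)
    (f : X -> Y) (g : X -> Z) :
  smooth_at x f -> smooth_at x g ->
  @smooth_at R X (prod_space Y Z) x (fun z => (f z, g z)).
Proof.
move=> [cf sf] [cg sg]; split; first exact: cvg_pair.
move=> _ [b [c [Ab Ac ->]]] [/= bx cx] i; case: (split_ordP i) => j ->.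
  apply: rsmooth_at_near (sf b Ab bx j).
  by apply: filterE => z /=; rewrite row_mxEl.
apply: rsmooth_at_near (sg c Ac cx j).
by apply: filterE => z /=; rewrite row_mxEr.
Qed.

Lemma smooth_at_fst (R : realType) (X Y : chartedSpace R) (p : X * Y) :
  is_premanifold Y -> @smooth_at R (prod_space X Y) X p fst.
Proof.
case: p => x y pY; split; first exact: cvg_fst.
move=> a Aa ax i; have [b Ab bx] := pmf_cover pY y.
have Aab : atlas (prod_space X Y) (prod_chart a b) by exists a, b.
have := @rsmooth_at_chartE R (prod_space X Y) (x, y) _ (lshift _ i) Aab (conj ax bx : chart_dom (prod_chart a b) (x, y)).
by apply: rsmooth_at_near; apply: filterE => z /=; rewrite row_mxEl.
Qed.

Lemma smooth_at_snd (R : realType) (X Y : chartedSpace R) (p : X * Y) :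
  is_premanifold X -> @smooth_at R (prod_space X Y) Y p snd.
Proof.
case: p => x y pX; split; first exact: cvg_snd.
move=> b Ab bx i; have [a Aa ax] := pmf_cover pX x.
have Aab : atlas (prod_space X Y) (prod_chart a b) by exists a, b.
have := @rsmooth_at_chartE R (prod_space X Y) (x, y) _ (rshift _ i) Aab (conj ax bx : chart_dom (prod_chart a b) (x, y)).
by apply: rsmooth_at_near; apply: filterE => z /=; rewrite row_mxEr.
Qed.

(** * Bump functions *)

(** The classical flat function exp(-1/x) multiplied by powers of 1/x. The derivative of a member is
    a combination of members with larger [n], which allows an induction on the order of
    differentiation. *)
Definition exp_flat (R : realType) (n : nat) (x : R) : R :=
  if 0 < x then x^-1 ^+ n * expR (- x^-1) else 0.

(** With y = 1/x this bounds y^n / exp y by (n+1)! / y, and follows from the term of degree n+1 of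
    the exponential series. *)
Lemma flat_le (R : realType) n (x : R) : 0 < x ->
  exp_flat n x <= (n.+1)`!%:R * x.
Proof.
move=> x0; rewrite /exp_flat x0 expRN.
have y0 : 0 < x^-1 by rewrite invr_gt0.
have f0 : 0 < (n.+1)`!%:R :> R by rewrite ltr0n fact_gt0.
have /(le_trans _) H := expR_ge1Dxn n (ltW y0).
have {H} H : (x^-1) ^+ n.+1 / (n.+1)`!%:R <= expR x^-1 by apply: H; rewrite lerDr.
rewrite ler_pdivrMr ?expR_gt0 //.
apply: (@le_trans _ _ ((n.+1)`!%:R * x * ((n.+1)`!%:R^-1 * x^-1 ^+ n.+1))); last first.
  by apply: ler_wpM2l; [rewrite mulr_ge0 // ltW|rewrite mulrC].
by rewrite mulrACA mulfV ?gt_eqF // mul1r exprS mulrA mulfV ?gt_eqF // mul1r.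
Qed.

Lemma flat_ge0 (R : realType) n (x : R) : 0 <= exp_flat n x.
Proof.
rewrite /exp_flat; case: ifP => // x0; apply: mulr_ge0; last exact: expR_ge0.
by rewrite exprn_ge0 // invr_ge0 ltW.
Qed.

Lemma flat_cvg0 (R : realType) n : exp_flat n x @[x --> (0 : R)] --> (0 : R).
Proof.
apply: (@squeeze_cvgr _ _ _ _ (cst 0) (fun x : R => (n.+1)`!%:R * `|x|)).
- apply: filterE => x; rewrite flat_ge0 /=.
  have [x0|x0] := ltP 0 x; first by rewrite gtr0_norm //; exact: flat_le.
  by rewrite /exp_flat ltNge x0 mulr_ge0.
- exact: cvg_cst.
- rewrite -[X in _ --> X](mulr0 ((n.+1)`!%:R)); apply: cvgM; first exact: cvg_cst.
  by rewrite -[X in _ --> X](@normr0 _ R); apply: cvg_norm; exact: cvg_id.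
Qed.

Lemma is_derive_flat (R : realType) n (x : R) :
  is_derive x 1 (exp_flat n) (- n%:R * exp_flat n.+1 x + exp_flat n.+2 x).
Proof.
have [x0|x0|->] := ltrgtP x 0.
- apply: (@near_eq_is_derive _ _ _ (cst 0)).
    near=> y; rewrite /exp_flat ifF //=; apply/negbTE; rewrite -leNgt ltW //.
    by near: y; apply: open_nbhs_nbhs; split => //; exact: open_lt.
  apply: is_derive_eq; rewrite /exp_flat ifF ?ifF ?mulr0 ?addr0 //;
  by apply/negbTE; rewrite -leNgt ltW.
- pose inv (y : R) := y^-1.
  have invX m y : (inv ^+ m) y = y^-1 ^+ m.
    by elim: m => [|m IH] //; rewrite !exprS -IH.
  apply: (@near_eq_is_derive _ _ _ (inv ^+ n * (expR \o (- inv)))).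
    near=> y; rewrite /exp_flat ifT; first by rewrite -invX.
    by near: y; apply: open_nbhs_nbhs; split => //; exact: open_gt.
  have xn0 : x != 0 by rewrite gt_eqF.
  have di : is_derive x 1 inv (- x ^- 2).
    rewrite /inv; apply: is_derive_eq; first exact: (@is_deriveV _ id x 1 1).
    by rewrite /GRing.scale /= mulr1.
  have dn : is_derive x 1 (- inv) (x ^- 2).
    by apply: is_derive_eq (is_deriveN di) _; rewrite opprK.
  have de := is_derive1_comp (is_derive_expR ((- inv) x)) dn.
  apply: is_derive_eq (is_deriveM (is_deriveX n di) de) _.
  rewrite /exp_flat x0 /GRing.scale /=.
  rewrite invX.
  have -> : (- inv) x = - x^-1 by [].
  rewrite /inv; case: n => [|n]; first by rewrite !expr0 !mul1r expr1 !mul0r oppr0 mul0r mulr0 addr0 add0r mulrC exprVn.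
  have key (E c y : R) : y ^+ n.+1 * (E * y ^+ 2) + E * (c * y ^+ n * - y ^+ 2) =
      - c * (y ^+ n.+2 * E) + y ^+ n.+3 * E by rewrite !exprS expr0; ring.
  rewrite -!exprVn; exact: key.
(* Away from 0 the difference quotient of [exp_flat n] at 0 is [exp_flat n.+1]. *)
- have H : (fun h : R => h^-1 *: ((exp_flat n \o shift 0) (h *: 1) - exp_flat n 0)) @ 0^' --> (0 : R).
    apply: (@cvg_trans _ (exp_flat n.+1 h @[h --> (0 : R)^'])); last first.
      by apply: cvg_within_filter; exact: flat_cvg0.
    apply: near_eq_cvg; rewrite near_withinE; near=> h => h0.
    rewrite /= addr0 [h%:A]mulr1 /exp_flat ltxx subr0 /GRing.scale /=.
    by case: ifP => _; rewrite ?mulr0 // exprS mulrA.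
  rewrite /exp_flat ltxx mulr0 addr0.
  by split; [apply/cvg_ex; eexists; exact: H|exact: cvg_lim H].
Unshelve. all: by end_near.
Qed.

Lemma Cinf_flat (R : realType) n : Cinf setT (fun u : 'rV[R]_1 => exp_flat n (u 0 0)).
Proof.
move=> r; elim: r n => [|r IH] n.
  split => // u _; apply: (@continuous_comp _ _ _ (fun u : 'rV[R]_1 => u 0 0) (exp_flat n)).
    exact: coord_continuous.
  apply/differentiable_continuous/derivable1_diffP.
  by have [] := is_derive_flat n (u 0 0).
have D (u : 'rV[R]_1) (i : 'I_1) : is_derive u (delta_mx 0 i) (fun u : 'rV[R]_1 => exp_flat n (u 0 0))
   (- n%:R * exp_flat n.+1 (u 0 0) + exp_flat n.+2 (u 0 0)).
  have [d1 d2] := is_derive_flat n (u 0 0).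
  have E : (fun h : R => h^-1 *: (((fun u : 'rV[R]_1 => exp_flat n (u 0 0)) \o shift u) (h *: delta_mx 0 i) - exp_flat n (u 0 0)))
     = (fun h : R => h^-1 *: ((exp_flat n \o shift (u 0 0)) (h *: 1) - exp_flat n (u 0 0))).
    by apply/funext => h /=; rewrite !mxE ord1 eqxx.
  by split; rewrite /derivable /derive E.
split.
  move=> u _; apply: (@continuous_comp _ _ _ (fun u : 'rV[R]_1 => u 0 0) (exp_flat n)).
    exact: coord_continuous.
  apply/differentiable_continuous/derivable1_diffP.
  by have [] := is_derive_flat n (u 0 0).
move=> i; split; first by move=> u _; have [] := D u i.
rewrite (_ : 'D_ _ _ = cst (- n%:R) * (fun u : 'rV[R]_1 => exp_flat n.+1 (u 0 0)) +
   (fun u : 'rV[R]_1 => exp_flat n.+2 (u 0 0))); last first.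
  by apply/funext => u; have [_ ->] := D u i.
apply: CrD; [exact: openT| |exact: IH].
by apply: CrM; [exact: openT|exact: Cr_cst|exact: IH].
Qed.

Definition smooth_step (R : realType) (t : R) : R :=
  exp_flat 0 t / (exp_flat 0 t + exp_flat 0 (1 - t)).

Lemma smooth_step_den (R : realType) (t : R) : exp_flat 0 t + exp_flat 0 (1 - t) != 0.
Proof.
rewrite gt_eqF //; have [t0|t0] := ltP 0 t.
  apply: ltr_pwDl; last exact: flat_ge0.
  by rewrite /exp_flat t0 expr0 mul1r expR_gt0.
apply: ltr_pwDr; last exact: flat_ge0.
rewrite /exp_flat ifT ?expr0 ?mul1r ?expR_gt0 //; lra.
Qed.

Lemma smooth_step0 (R : realType) (t : R) : t <= 0 -> smooth_step t = 0.
Proof. by move=> t0; rewrite /smooth_step /exp_flat ltNge t0 mul0r. Qed.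

Lemma smooth_step1 (R : realType) (t : R) : 1 <= t -> smooth_step t = 1.
Proof.
move=> t1; have := smooth_step_den t; rewrite /smooth_step.
have -> : exp_flat 0 (1 - t) = 0 by rewrite /exp_flat ifF //; apply/negbTE; rewrite -leNgt; lra.
by rewrite addr0 => /divff.
Qed.

Lemma rsmooth_at_step (R : realType) (X : chartedSpace R) (x : X) (f : X -> R) :
  is_premanifold X -> rsmooth_at x f -> rsmooth_at x (fun z => smooth_step (f z)).
Proof.
move=> pX sf.
have sflat g : rsmooth_at x g -> rsmooth_at x (fun z => exp_flat 0 (g z)).
  move=> sg; apply: (@rsmooth_at_near _ _ _ (fun z => exp_flat 0 ((\row_(i < 1) g z) 0 0))).
    by apply: filterE => z; rewrite mxE.
  apply: (@rsmooth_at_comp_Cinf _ _ _ _ (fun z => \row_(i < 1) g z) setT (fun u => exp_flat 0 (u 0 0))) => //.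
  - by move=> i; apply: rsmooth_at_near sg; apply: filterE => z; rewrite mxE.
  - exact: openT.
  - exact: Cinf_flat.
apply: rsmooth_atM => //; first exact: sflat.
apply: rsmooth_atV => //; first exact: smooth_step_den.
apply: rsmooth_atD => //; apply: sflat => //.
by apply: rsmooth_atD => //; [exact: rsmooth_at_cst|exact: rsmooth_atN].
Qed.

(** A product of smooth steps in the coordinates of one chart, extended by zero. The extension is
    smooth because the support lies in the image of a closed cube, which is compact, hence closed in
    [M] by the Hausdorff property. The last clause gives zeros on a neighbourhood of each point
    outside [O], so that anything multiplied by [rho] is smooth there. *)
Lemma bump_function (R : realType) (M : manifold R) (O : set M) (x : M) :
  open O -> O x -> exists rho : M -> R,
    [/\ forall z, rsmooth_at z rho, \forall z \near x, rho z = 1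
      & forall z, ~ O z -> \forall y \near z, rho y = 0].
Proof.
move=> oO Ox; have pM := manifold_premanifold (mfd_axioms M).
have [a Aa ax] := pmf_cover pM x.
pose O' := O `&` chart_dom a.
have oO' : open O' by apply: openI => //; exact: (pmf_open_dom pM).
have oaO : open (a @` O') by apply: (pmf_chart_open pM) => // z [].
have aOx : (a @` O') (a x) by exists x.
have [e /= e0 eO] : exists2 e : R, 0 < e & ball (a x) e `<=` a @` O'.
  by apply/nbhs_ballP; exact: open_nbhs_nbhs.
(* The closed cube of half-width [2 * d = e / 2] lies in the open ball of radius [e]. The argument
   [2 - w ^+ 2] of the steps is at least 1 when the absolute value of [w] is at most 1, and negative
   when it is at least 2. *)
pose d := e / 4; have d0 : 0 < d by rewrite divr_gt0.
pose Q := [set u : 'rV[R]_(mdim M) | forall i, `[a x 0 i - 2 * d, a x 0 i + 2 * d]%classic (u ord0 i)].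
have QE u : Q u -> ball (a x) e u.
  move=> Qu; apply/ball_rVP => // i; have := Qu i; rewrite /= in_itv /= => /andP[H1 H2].
  rewrite ltr_norml; apply/andP; split; rewrite /d in H1 H2; lra.
have cQ : compact Q by apply: (@rV_compact _ _ (fun i => `[a x 0 i - 2 * d, a x 0 i + 2 * d]%classic)) => i; exact: segment_compact.
have inj z w : O' z -> O' w -> a z = a w -> z = w.
  by move=> [_ za] [_ wa]; exact: (pmf_chart_inj pM Aa).
pose g (u : 'rV[R]_(mdim M)) : M :=
  match pselect (exists2 z, O' z & a z = u) with
  | left E => s2val (cid2 E) | right _ => x end.
have gE z : O' z -> g (a z) = z.
  move=> Oz; rewrite /g; case: pselect => [E|]; last by case; exists z.
  by case: cid2 => /= w Ow aw; exact: inj.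
have cg u : (a @` O') u -> {for u, continuous g}.
  move=> [z Oz <-] B; rewrite gE // nbhs_simpl /= => Bz.
  have : nbhs z (B `&` O') by apply: filterI => //; exact: open_nbhs_nbhs.
  rewrite nbhsE => -[V [oV Vz] VB].
  have oaV : open (a @` V) by apply: (pmf_chart_open pM) => // w /VB [_ []].
  have aVz : (a @` V) (a z) by exists z.
  apply: filterS (open_nbhs_nbhs (conj oaV aVz)) => _ [w Vw <-] /=.
  by have [Bw Ow] := VB _ Vw; rewrite gE.
pose K := g @` Q.
have clK : closed K.
  apply: compact_closed; first exact: mfd_hausdorff (mfd_axioms M).
  apply: continuous_compact cQ; apply: continuous_in_subspaceT => u.
  by rewrite inE => /QE /eO; exact: cg.
have KO z : K z -> O' z.
  by move=> [u /QE /eO [w Ow <-] <-]; rewrite gE.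
pose B (z : M) := \prod_i smooth_step (2 - ((a z 0 i - a x 0 i) / d) ^+ 2).
pose rho (z : M) := if `[< O' z >] then B z else 0.
have rhoK z : ~ K z -> rho z = 0.
  move=> Kz; rewrite /rho; case: asboolP => // Oz.
  have [i Hi] : exists i, ~ `[a x 0 i - 2 * d, a x 0 i + 2 * d]%classic (a z ord0 i).
    by apply/existsNP => H; apply: Kz; exists (a z); rewrite ?gE.
  rewrite /B (bigD1 i) //= smooth_step0 ?mul0r //.
  move: Hi; rewrite /= in_itv /= => /negP; rewrite negb_and -!ltNge => Hi.
  rewrite subr_le0; set w := _ / d.
  have : 2 <= `|w|.
    rewrite /w normrM normfV (gtr0_norm d0) ler_pdivlMr //.
    have := ler_norm (a z 0 i - a x 0 i); have := ler_norm (- (a z 0 i - a x 0 i)).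
    rewrite normrN; move: Hi; set aa := `|_|; case/orP => Hi; lra.
  rewrite -[w ^+ 2]real_normK ?num_real //; nra.
have near0 z : ~ K z -> \forall y \near z, rho y = 0.
  move=> Kz; have : open (~` K) by apply/closed_openC.
  by move=> oK; apply: filterS (open_nbhs_nbhs (conj oK Kz)) => y; exact: rhoK.
exists rho; split.
- move=> z; have [Kz|Kz] := pselect (K z); last first.
    apply: (@rsmooth_at_near _ _ _ (fun=> 0)); last exact: rsmooth_at_cst.
    by apply: filterS (near0 _ Kz) => y ->.
  have Oz := KO _ Kz; apply: (@rsmooth_at_near _ _ _ B).
    apply: filterS (open_nbhs_nbhs (conj oO' Oz)) => y Oy.
    by rewrite /rho asboolT.
  apply: rsmooth_at_prod => // i _; apply: rsmooth_at_step => //.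
  apply: rsmooth_atD => //; first exact: rsmooth_at_cst.
  apply: rsmooth_atN => //; apply: rsmooth_atX => //.
  apply: rsmooth_atM => //; last exact: rsmooth_at_cst.
  apply: rsmooth_atD => //; last exact: rsmooth_at_cst.
  by apply: rsmooth_at_chartE => //; case: Oz.
- near=> z; have Oz : O' z by near: z; exact: open_nbhs_nbhs.
  rewrite /rho asboolT // /B big1 // => i _; rewrite smooth_step1 //.
  have : ball (a x) d (a z).
    near: z; have := pmf_chart_continuous pM Aa ax.
    by apply; exact: nbhsx_ballx.
  move=> /(ball_rVP _ _ d0) /(_ i) H.
  have : `|(a z 0 i - a x 0 i) / d| <= 1.
    by rewrite normrM normfV (gtr0_norm d0) ler_pdivrMr // mul1r distrC ltW.
  set w := _ / d; rewrite -[w ^+ 2]real_normK ?num_real // => Hw.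
  have := normr_ge0 w; nra.
- by move=> z Oz; apply: near0 => /KO [].
Unshelve. all: by end_near.
Qed.

(** * Homogeneous functions *)

(** A form of [weighted_scaling] with one weight for each coordinate instead of blocks;
    [weighted_scalingE] relates the two. *)
Definition wscale (R : realType) n (wgt : 'I_n -> nat) (t : R) (y : 'rV[R]_n) : 'rV[R]_n :=
  \row_a (t ^+ wgt a * y 0 a).

Definition mono (R : realType) n (e : 'I_n -> nat) (y : 'rV[R]_n) : R :=
  \prod_a y 0 a ^+ e a.

Definition mweight n (wgt e : 'I_n -> nat) : nat := \sum_a wgt a * e a.

Lemma mono_wscale (R : realType) n (wgt e : 'I_n -> nat) (t : R) (y : 'rV[R]_n) :
  mono e (wscale wgt t y) = t ^+ mweight wgt e * mono e y.
Proof.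
rewrite /mono /mweight -prodrXr -big_split /=; apply: eq_bigr => a _.
by rewrite mxE exprMn exprM.
Qed.

Lemma is_derive_affine (R : realType) (a b t : R) :
  is_derive t 1 (fun s : R => a + s * b) b.
Proof.
rewrite (_ : (fun _ => _) = cst a + b \*: (fun s : R => s)); last first.
  by apply/funext => s; rewrite /= mulrC.
apply: is_derive_eq.
by rewrite add0r /GRing.scale /= mulr1.
Qed.

Lemma is_derive_power (R : realType) (c t : R) n :
  is_derive t 1 (fun s : R => s ^+ n * c) (n%:R * t ^+ n.-1 * c).
Proof.
rewrite (_ : (fun _ => _) = (fun s : R => s) ^+ n * cst c); last first.
  apply/funext => s; rewrite /GRing.mul /= /cst; congr (_ * _).
  by elim: n => // n IH; rewrite !exprS IH.
apply: is_derive_eq.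
by rewrite scaler0 add0r /GRing.scale /= mulr1 mulrC.
Qed.

Section HomogeneousEuclidean.
Variables (R : realType) (m n : nat) (W : set 'rV[R]_m) (wgt : 'I_n -> nat).
Hypotheses (oW : open W) (wgt_gt0 : forall a, (0 < wgt a)%N).

Let S := [set v : 'rV[R]_(m + n) | W (lsubmx v)].

Let oS : open S.
Proof.
rewrite (_ : S = [set v | W (lsubmx v) /\ [set: 'rV[R]_n] (rsubmx v)]).
  by apply: open_row_mx => //; exact: openT.
by apply/seteqP; split => v //= [].
Qed.

Let row_S u y : W u -> S (row_mx u y).
Proof. by move=> Wu; rewrite /S /= row_mxKl. Qed.

Lemma is_derive_curve (G : 'rV[R]_(m + n) -> R) (g : R -> 'rV[R]_(m + n)) dg (t : R) :
  Cinf S G -> S (g t) -> (forall i, is_derive t 1 (fun s => g s 0 i) (dg i)) ->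
  is_derive t 1 (G \o g) (\sum_i dg i * 'D_(delta_mx 0 i) G (g t)).
Proof.
move=> CG Sg dg'; apply: (is_derive_comp_rV oS Sg (CG 1%N)) => //.
apply: (@cvg_rV _ _ (nbhs t)) => i; have [d _] := dg' i.
exact: (differentiable_continuous ((derivable1_diffP _ _).1 d)).
Qed.

(** Restricting to [t != 0] makes the notion pass to partial derivatives, where a power of [t] has
    to be cancelled; [t = 0] is recovered by continuity in [whomogeneous_lim]. *)
Definition whomogeneous (w : nat) (G : 'rV[R]_(m + n) -> R) :=
  forall (t : R) u y, t != 0 -> W u ->
    G (row_mx u (wscale wgt t y)) = t ^+ w * G (row_mx u y).

(** Both sides are derivatives at [s = 0] of the homogeneity identity at the points
    [y + s *: delta_mx 0 j]. *)
Lemma whomogeneous_derive w G j : Cinf S G -> whomogeneous w G ->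
  forall (t : R) u y, W u -> t != 0 ->
  t ^+ wgt j * 'D_(delta_mx 0 (rshift m j)) G (row_mx u (wscale wgt t y)) =
  t ^+ w * 'D_(delta_mx 0 (rshift m j)) G (row_mx u y).
Proof.
move=> CG hG t u y Wu t0.
have D (c : R) : is_derive (0 : R) (1 : R)
   (fun s : R => G (row_mx u (wscale wgt c (y + s *: delta_mx 0 j))))
   (c ^+ wgt j * 'D_(delta_mx 0 (rshift m j)) G (row_mx u (wscale wgt c y))).
  pose g (s : R) := row_mx u (wscale wgt c (y + s *: delta_mx 0 j)).
  have dg (i : 'I_(m + n)) : is_derive (0 : R) (1 : R) (fun s => g s 0 i)
      (if i == rshift m j then c ^+ wgt j else 0).
    case: (split_ordP i) => l ->.
      rewrite eq_lrshift (_ : (fun s => _) = cst (u 0 l)); first exact: is_derive_cst.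
      by apply/funext => s; rewrite /g row_mxEl.
    rewrite eq_rshift (_ : (fun s => _) =
        (fun s : R => c ^+ wgt l * y 0 l + s * (if l == j then c ^+ wgt j else 0))).
      exact: is_derive_affine.
    apply/funext => s; rewrite /g row_mxEr !mxE eqxx /= mulrDr; congr (_ + _).
    by case: eqVneq => [->|_]; rewrite ?mulr1 ?mulr0 // mulrC.
  have Sg : S (g 0) by exact: row_S.
  apply: is_derive_eq (is_derive_curve CG Sg dg) _.
  rewrite (bigD1 (rshift m j)) //= eqxx big1 ?addr0.
    by rewrite /g scale0r addr0.
  by move=> i /negbTE ->; rewrite mul0r.
have [_ <-] := D t; have [_] := D 1; rewrite expr1n mul1r.
have w1 (z : 'rV[R]_n) : wscale wgt 1 z = z by apply/rowP => a; rewrite mxE expr1n mul1r.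
rewrite w1 => <-.
under eq_fun do rewrite hG //.
rewrite (_ : (fun _ => _) = (t ^+ w) *: (fun s : R => G (row_mx u (wscale wgt 1 (y + s *: delta_mx 0 j))))).
  by rewrite deriveZ //; have [+ _] := D 1.
by apply/funext => s; rewrite [RHS]/GRing.scale /= w1.
Qed.

(** Let [t] tend to 0: as all weights are positive, the scaled point tends to the origin of the
    fibre. For [p = 0] the function is constant along the fibres; for [p > 0], which is the case of
    a negative weight, it vanishes. *)
Lemma whomogeneous_lim p F : Cinf S F ->
  (forall (t : R) u y, t != 0 -> W u ->
    F (row_mx u y) = t ^+ p * F (row_mx u (wscale wgt t y))) ->
  forall u y, W u -> F (row_mx u y) = 0 ^+ p * F (row_mx u 0).
Proof.
move=> CF H u y Wu.
have cg : row_mx u (wscale wgt t y) @[t --> (0 : R)] --> row_mx u 0.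
  apply: (@cvg_rV _ _ (nbhs (0 : R))) => i; case: (split_ordP i) => l ->.
    by under eq_fun do rewrite row_mxEl; rewrite row_mxEl; exact: cvg_cst.
  under eq_fun do rewrite row_mxEr mxE; rewrite row_mxEr.
  have -> : (0 : 'rV[R]_n) 0 l = 0 ^+ wgt l * y 0 l.
    by rewrite mxE expr0n eqn0Ngt wgt_gt0 mul0r.
  by apply: cvgM; [exact: exprn_continuous|exact: cvg_cst].
have L : t ^+ p * F (row_mx u (wscale wgt t y)) @[t --> (0 : R)^'] --> 0 ^+ p * F (row_mx u 0).
  apply: cvg_within_filter; apply: cvgM; first exact: exprn_continuous.
  by apply: (cvg_comp _ _ cg); apply: Cr_continuous (CF 0%N) _ _; exact: row_S.
apply: (@cvg_unique _ _ (F (row_mx u y) @[t --> (0 : R)^'])) => //.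
- exact: cvg_cst.
- apply: cvg_trans L; apply: near_eq_cvg; rewrite near_withinE; near=> t => t0.
  exact/esym/H.
Unshelve. all: by end_near.
Qed.

(** Euler's identity, obtained by differentiating the homogeneity identity with respect to [t] at
    [t = 1]. *)
Lemma whomogeneous_euler w G u y : Cinf S G -> whomogeneous w G -> W u ->
  w%:R * G (row_mx u y) =
  \sum_j (wgt j)%:R * y 0 j * 'D_(delta_mx 0 (rshift m j)) G (row_mx u y).
Proof.
move=> CG hG Wu.
pose g (t : R) := row_mx u (wscale wgt t y).
have g1 : g 1 = row_mx u y.
  by congr row_mx; apply/rowP => a; rewrite mxE expr1n mul1r.
have dg (i : 'I_(m + n)) : is_derive (1 : R) (1 : R) (fun s => g s 0 i)
    (match fintype.split i with inl _ => 0 | inr j => (wgt j)%:R * y 0 j end).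
  case: (split_ordP i) => l ->.
    rewrite (_ : (fun s => _) = cst (u 0 l)).
      exact: is_derive_cst.
    by apply/funext => s; rewrite /g row_mxEl.
  rewrite (_ : (fun s => _) = (fun s => s ^+ wgt l * y 0 l)); last first.
    by apply/funext => s; rewrite /g row_mxEr mxE.
  by apply: is_derive_eq (is_derive_power _ _ _) _; rewrite expr1n mulr1.
have Sg : S (g 1) by exact: row_S.
have D1 := is_derive_curve CG Sg dg.
have D2 : is_derive (1 : R) (1 : R) (G \o g) (w%:R * G (row_mx u y)).
  apply: (@near_eq_is_derive _ _ _ (fun t : R => t ^+ w * G (row_mx u y))).
    near=> t; rewrite /g /= hG //; near: t.
    by apply: open_nbhs_nbhs; split; [exact: open_neq|exact: oner_neq0].
  by apply: is_derive_eq (is_derive_power _ _ _) _; rewrite expr1n mulr1.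
have [_ <-] := D2; have [_ ->] := D1.
rewrite big_split_ord /= big1 ?add0r; last first.
  by move=> i _; rewrite (unsplitK (inl i)) mul0r.
by apply: eq_bigr => j _; rewrite (unsplitK (inr j)) g1.
Unshelve. all: by end_near.
Qed.

(* Induction on [w]: Euler's identity expresses [w%:R * G] by the partial
   derivatives of [G] along the fibre, the j-th one having weight [w - wgt j]. *)
Lemma whomogeneous_polynomial w G : Cinf S G -> whomogeneous w G ->
  exists s : seq (('rV[R]_m -> R) * ('I_n -> nat)),
   List.Forall (fun c => Cinf W c.1 /\ mweight wgt c.2 = w) s /\
   forall u y, W u -> G (row_mx u y) = \sum_(c <- s) c.1 u * mono c.2 y.
Proof.
elim/ltn_ind: w G => w IH G CG hG.
case: w IH hG => [|w] IH hG.
  exists [:: ((fun u => G (row_mx u 0)), fun=> 0%N)]; split.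
    constructor => //=; split; last by rewrite /mweight big1 // => a _; rewrite muln0.
    move=> r; apply: (Cr_comp (W := S)) => //.
    - by move=> u Wu; exact: row_S.
    - move=> i; case: (split_ordP i) => l ->.
        by under eq_fun do rewrite row_mxEl; exact: Cr_coord.
      by under eq_fun do rewrite row_mxEr mxE; exact: Cr_cst.
  move=> u y Wu; rewrite big_seq1 /mono big1 ?mulr1 => [|a _]; last by rewrite expr0.
  rewrite (@whomogeneous_lim 0 G) ?expr0 ?mul1r // => t u' y' t0 Wu'.
  by rewrite hG // !expr0 !mul1r.
pose DG j := 'D_(delta_mx 0 (rshift m j)) G.
have CD j : Cinf S (DG j) by move=> r; have [_ /(_ (rshift m j)) []] := CG r.+1.
have /boolp.choice [s Hs] : forall j, exists s : seq (('rV[R]_m -> R) * ('I_n -> nat)),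
   List.Forall (fun c => Cinf W c.1 /\ (mweight wgt c.2 + wgt j)%N = w.+1) s /\
   forall u y, W u -> DG j (row_mx u y) = \sum_(c <- s) c.1 u * mono c.2 y.
  move=> j; have hD := whomogeneous_derive j CG hG.
  have [jw|wj] := leqP (wgt j) w.+1.
    have [|||s [s1 s2]] := IH (w.+1 - wgt j)%N _ (DG j) => //.
    - by rewrite ltn_subrL wgt_gt0.
    - move=> t u y t0 Wu; have := hD t u y Wu t0.
      have -> : t ^+ w.+1 = t ^+ wgt j * t ^+ (w.+1 - wgt j) by rewrite -exprD subnKC.
      by rewrite -mulrA => /mulfI; apply; rewrite expf_neq0.
    exists s; split => //; apply: List.Forall_impl s1 => c [? ->].
    by rewrite subnK.
  (* A partial derivative of negative weight vanishes and contributes no term. *)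
  exists [::]; split => // u y Wu; rewrite big_nil.
  rewrite (@whomogeneous_lim (wgt j - w.+1) (DG j)) // => [|t u' y' t0 Wu'].
    by rewrite expr0n subn_eq0 leqNgt wj mul0r.
  have := hD t u' y' Wu' t0; have -> : t ^+ wgt j = t ^+ w.+1 * t ^+ (wgt j - w.+1).
    by rewrite -exprD subnKC // ltnW.
  by rewrite -mulrA => /mulfI H; rewrite /DG H // expf_neq0.
pose incr (j a : 'I_n) : nat := (a == j).
(* One term of Euler's identity divided by [w.+1]: the monomial gains a factor of index [j] and the
   coefficient the factor [wgt j]. *)
pose lift j (c : ('rV[R]_m -> R) * ('I_n -> nat)) : ('rV[R]_m -> R) * ('I_n -> nat) :=
  ((fun u => (w.+1%:R)^-1 * (wgt j)%:R * c.1 u), (fun a => (c.2 a + incr j a)%N)).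
exists (flatten [seq [seq lift j c | c <- s j] | j <- enum 'I_n]); split.
  elim: (enum _) => [|j e IHe] //=; apply/List.Forall_app; split => //.
  have [Hj _] := Hs j; elim: (s j) Hj => [|c l IHl] Hl //=.
  inversion Hl as [|c' l' [C1 C2] Hl' E]; subst; constructor; last exact: IHl.
  split => /=; first by move=> r; apply: CrM => //; exact: Cr_cst.
  rewrite -C2 /mweight; under eq_bigr do rewrite mulnDr.
  rewrite big_split /=; congr addn; rewrite (bigD1 j) //= /incr eqxx muln1 big1 ?addn0 //.
  by move=> a /negbTE ->; rewrite muln0.
move=> u y Wu; have w0 : w.+1%:R != 0 :> R by rewrite pnatr_eq0.
apply: (mulfI w0); rewrite (whomogeneous_euler _ CG hG Wu).
rewrite big_flatten /= big_map big_enum /= mulr_sumr; apply: eq_bigr => j _.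
have [_ HD] := Hs j; rewrite -[X in _ * X]/(DG j (row_mx u y)) HD // big_map !mulr_sumr; apply: eq_bigr => c _ /=.
rewrite !mulrA mulfV // mul1r.
have -> : mono (fun a => c.2 a + incr j a)%N y = y 0 j * mono c.2 y.
  rewrite /mono; under eq_bigr do rewrite exprD.
  rewrite big_split /= mulrC; congr (_ * _).
  rewrite (bigD1 j) //= /incr eqxx expr1 big1 ?mulr1 //.
  by move=> a /negbTE ->; rewrite expr0.
ring.
Qed.

End HomogeneousEuclidean.

(** The Euclidean result read in a chart of [M] around [x]. The expansion is local in the base but
    holds along entire fibres. *)
Lemma homogeneous_polynomial (R : realType) (M : chartedSpace R) (n : nat)
    (wgt : 'I_n -> nat) (U : set M) (x : M) (w : nat) (G : M * 'rV[R]_n -> R) :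
  is_premanifold M -> (forall a, (0 < wgt a)%N) -> open U -> U x ->
  (forall z y, U z -> @rsmooth_at R (prod_space M (euclidean R n)) (z, y) G) ->
  (forall t z y, U z -> G (z, wscale wgt t y) = t ^+ w * G (z, y)) ->
  exists s : seq ((M -> R) * ('I_n -> nat)),
    List.Forall (fun c => rsmooth_at x c.1 /\ mweight wgt c.2 = w) s /\
    \forall z \near x, forall y, G (z, y) = \sum_(c <- s) c.1 z * mono c.2 y.
Proof.
move=> pM wgt_gt0 oU Ux sG hG; have [a Aa ax] := pmf_cover pM x.
have pE := @euclidean_premanifold R n.
have pP := prod_premanifold pM pE.
pose V := U `&` chart_dom a.
have oV : open V by apply: openI => //; exact: (pmf_open_dom pM).
pose W := a @` V.
have oW : open W by apply: (pmf_chart_open pM) => // z [].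
pose g (u : 'rV[R]_(mdim M)) : M :=
  match pselect (exists2 z, V z & a z = u) with
  | left E => s2val (cid2 E) | right _ => x end.
have gE z : V z -> g (a z) = z.
  move=> Vz; rewrite /g; case: pselect => [E|]; last by case; exists z.
  case: cid2 => /= y Vy ay; apply: (pmf_chart_inj pM Aa) => //; [by case: Vy|by case: Vz].
pose G' (v : 'rV[R]_(mdim M + n)) := G (g (lsubmx v), rsubmx v).
pose S := [set v : 'rV[R]_(mdim M + n) | W (lsubmx v)].
pose b : chart R (euclidean R n) n := Chart setT id.
have Ab : atlas (prod_space M (euclidean R n)) (prod_chart a b) by exists a, b.
have CG : Cinf S G'.
  move=> r; apply: Cr_local => v [z Vz az].
  have [Uz azd] := Vz.
  have dz : chart_dom (prod_chart a b) (z, rsubmx v) by [].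
  have [Wt [t [oWt Wtz Ct nt]]] :=
    rsmooth_at_chart pP (sG z (rsubmx v) Uz) Ab dz.
  have : nbhs ((z, rsubmx v) : prod_space M (euclidean R n))
     [set q | (V q.1) /\ G q = t (prod_chart a b q)].
    apply: filterI => //; have := @smooth_at_fst R M (euclidean R n) (z, rsubmx v) pE.
    by move=> [+ _]; apply; exact: open_nbhs_nbhs.
  rewrite nbhsE => -[B [oB Bz] BH].
  have oB' : open (prod_chart a b @` B).
    by apply: (pmf_chart_open pP Ab) => // q /BH [[_ ?] _].
  have vE : prod_chart a b (z, rsubmx v) = v by rewrite /= az hsubmxK.
  exists (prod_chart a b @` B `&` Wt).
    by split; [exists (z, rsubmx v)|rewrite -vE].
  apply: (@eq_Cr _ _ _ _ t); first exact: openI.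
    move=> _ [[q /BH [Vq Gq] <-] _]; rewrite -Gq /G' /= row_mxKl row_mxKr gE //.
    by case: (q).
  by apply: Cr_sub (Ct r) => ? [].
have hG' : whomogeneous W wgt w G'.
  move=> t u y t0 [z Vz az]; rewrite /G' !row_mxKl !row_mxKr -az gE //.
  by apply: hG; case: Vz.
have [s [s1 s2]] := whomogeneous_polynomial oW wgt_gt0 CG hG'.
exists [seq ((fun z => c.1 (a z)), c.2) | c <- s]; split.
  elim: s s1 {s2} => [|c s IH] Hs //=.
  inversion Hs as [|c' s' [C1 C2] Hs' E]; subst; constructor; last exact: IH.
  split => //=; exists a, W, c.1; split => //; first by split => //; exists x.
  exact: filterE.
have Vx : V x by [].
apply: filterS (open_nbhs_nbhs (conj oV Vx)) => z Vz y.
have /s2 -/(_ y) : W (a z) by exists z.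
by rewrite /G' row_mxKl row_mxKr gE // big_map.
Qed.

(** * Graded algebras and their monomials *)

(** The fibres of [E_0] are of this kind: they have no component of weight 0, hence no unit. *)
Record nalg (R : realType) := Nalg {
  nalg_sort :> vectType R;
  nalg_mul : 'Hom(nalg_sort, 'End(nalg_sort));
  nalg_mulC : forall a b, nalg_mul a b = nalg_mul b a;
  nalg_mulA : forall a b c, nalg_mul (nalg_mul a b) c = nalg_mul a (nalg_mul b c) }.

(* The unital algebra R (+) A, in which the products of [A] are those of a ring. *)
Definition unitz (R : realType) (A : nalg R) : Type := (R * A)%type.

HB.instance Definition _ (R : realType) (A : nalg R) :=
  GRing.Zmodule.copy (unitz A) (R * A)%type.

Section Unitalization.
Variables (R : realType) (A : nalg R).
Local Notation mu := (@nalg_mul R A).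
Implicit Types x y z : unitz A.

Definition unitz_one : unitz A := (1, 0).
Definition unitz_mul x y : unitz A :=
  (x.1 * y.1, x.1 *: y.2 + y.1 *: x.2 + mu x.2 y.2).

Lemma nalg_mulDl (u v w : A) : mu (u + v) w = mu u w + mu v w.
Proof. by rewrite linearD add_lfunE. Qed.

Lemma nalg_mulDr (u v w : A) : mu u (v + w) = mu u v + mu u w.
Proof. by rewrite linearD. Qed.

Lemma nalg_mulZl c (u v : A) : mu (c *: u) v = c *: mu u v.
Proof. by rewrite linearZ scale_lfunE. Qed.

Lemma nalg_mulZr c (u v : A) : mu u (c *: v) = c *: mu u v.
Proof. by rewrite linearZ. Qed.

Lemma nalg_mul_suml (I : Type) (s : seq I) (P : pred I) (F : I -> A) v :
  mu (\sum_(i <- s | P i) F i) v = \sum_(i <- s | P i) mu (F i) v.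
Proof.
apply: (big_morph (fun u => mu u v)) => [u w|]; first exact: nalg_mulDl.
by rewrite linear0 zero_lfunE.
Qed.

Lemma nalg_mul_sumr (I : Type) (s : seq I) (P : pred I) (F : I -> A) v :
  mu v (\sum_(i <- s | P i) F i) = \sum_(i <- s | P i) mu v (F i).
Proof. by rewrite linear_sum. Qed.

Lemma unitz_mulA : associative unitz_mul.
Proof.
move=> [a u] [b v] [c w]; congr pair; rewrite /= ?mulrA //.
rewrite !(nalg_mulDl, nalg_mulDr, nalg_mulZl, nalg_mulZr) nalg_mulA.
rewrite !scalerDr !scalerA !addrA [RHS](ACl (1*2*5*3*6*4*7)) /=.
by rewrite (mulrC c a) (mulrC c b).
Qed.

Lemma unitz_mulC : commutative unitz_mul.
Proof.
move=> [a u] [b v]; congr pair; rewrite /=; first by rewrite mulrC.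
by rewrite nalg_mulC; congr (_ + _); rewrite addrC.
Qed.

Lemma unitz_mul1 : left_id unitz_one unitz_mul.
Proof. by move=> [a u]; rewrite /unitz_mul /= mul1r scale1r scaler0 linear0 lfunE /= !addr0. Qed.

Lemma unitz_mulDl : left_distributive unitz_mul +%R.
Proof.
move=> [a u] [b v] [c w]; congr pair; rewrite /= ?mulrDl //.
by rewrite scalerDl scalerDr linearD add_lfunE /= !addrA [RHS](ACl (1*4*2*5*3*6)).
Qed.

Lemma unitz_oneN0 : unitz_one != 0.
Proof. by apply/eqP => -[/eqP]; rewrite oner_eq0. Qed.

End Unitalization.

HB.instance Definition _ (R : realType) (A : nalg R) :=
  GRing.Zmodule_isComNzRing.Build (unitz A) (@unitz_mulA R A) (@unitz_mulC R A)
    (@unitz_mul1 R A) (@unitz_mulDl R A) (@unitz_oneN0 R A).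

Section UnitizTheory.
Variables (R : realType) (A : nalg R).
Local Notation mu := (@nalg_mul R A).

Definition uin (v : A) : unitz A := (0, v).
Definition usc (c : R) : unitz A := (c, 0).

Lemma uin_inj : injective uin. Proof. by move=> u v []. Qed.

Lemma uinM u v : uin u * uin v = uin (mu u v).
Proof. by congr pair; rewrite /= ?mul0r // !scale0r !add0r. Qed.

Lemma uinD u v : uin (u + v) = uin u + uin v.
Proof. by congr pair; rewrite /= addr0. Qed.

Lemma uinZ c v : uin (c *: v) = usc c * uin v.
Proof. by congr pair; rewrite /= ?mulr0 // scaler0 linear0 lfunE /= !addr0. Qed.

Lemma uin_iter_prod (s : seq A) : (0 < size s)%N ->
  uin (iter_prod mu s) = \prod_(v <- s) uin v.
Proof.
case: s => // a s _; rewrite big_cons /=.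
elim: s a => [|b s IH] a; first by rewrite big_nil mulr1.
by rewrite /= IH big_cons mulrA uinM.
Qed.

Lemma iter_prod_codom j (a : {ffun 'I_j -> A}) : (0 < j)%N ->
  uin (iter_prod mu (codom a)) = \prod_i uin (a i).
Proof.
move=> j0; rewrite uin_iter_prod ?size_codom ?card_ord //.
by rewrite codomE big_map big_enum.
Qed.

(* Products of at least [j] factors, regrouped into [j] factors. *)
Lemma power_spanP j (s : seq A) (v : A) : (0 < j <= size s)%N ->
  uin v = \prod_(u <- s) uin u -> power_span mu j v.
Proof.
move=> /andP[j0 js] E.
pose b := iter_prod mu (drop j.-1 s).
pose a := [ffun i : 'I_j => if (i < j.-1)%N then nth 0 s i else b].
exists 1%N, (fun=> 1), (fun=> iter_prod mu (codom a)); split.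
  by move=> _; exists a.
rewrite big_ord1 scale1r; apply: uin_inj; rewrite E iter_prod_codom //.
rewrite -[s in LHS](cat_take_drop j.-1) big_cat /=.
rewrite -(@uin_iter_prod (drop j.-1 s)); last by rewrite size_drop subn_gt0 prednK.
case: j j0 js @b @a {E} => // j _ js b a.
rewrite big_ord_recr /= [a ord_max]ffunE /= ltnn; congr (_ * _).
rewrite (big_nth 0) size_take js big_mkord; apply: eq_bigr => i _.
by rewrite ffunE /= ltn_ord nth_take.
Qed.

Lemma lspan0 (V : lmodType R) (B : set V) : lspan B 0.
Proof. by exists 0%N, (fun=> 0), (fun=> 0); split; [case|rewrite big_ord0]. Qed.

Lemma lspanP (V : lmodType R) (B : set V) c u v :
  lspan B u -> lspan B v -> lspan B (c *: u + v).
Proof.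
move=> [n [cu [au [Hu ->]]]] [m [cv [av [Hv ->]]]].
exists (n + m)%N, (fun i => match fintype.split i with inl i => c * cu i | inr i => cv i end),
  (fun i => match fintype.split i with inl i => au i | inr i => av i end); split.
  by move=> i; case: (fintype.split i).
rewrite big_split_ord /= scaler_sumr; congr (_ + _); apply: eq_bigr => i _.
  by rewrite (unsplitK (inl i)) scalerA.
by rewrite (unsplitK (inr i)).
Qed.

Lemma lspan_sum (V : lmodType R) (B : set V) (I : Type) (s : seq I) (P : pred I)
    (c : I -> R) (F : I -> V) : (forall i, P i -> lspan B (F i)) ->
  lspan B (\sum_(i <- s | P i) c i *: F i).
Proof.
move=> H; elim/big_rec : _ => [|i v Pi Hv]; first exact: lspan0.
by apply: lspanP => //; exact: H.
Qed.

Lemma lspan_in (V : lmodType R) (B : set V) v : B v -> lspan B v.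
Proof.
move=> Bv; exists 1%N, (fun=> 1), (fun=> v); split => //.
by rewrite big_ord1 scale1r.
Qed.

Lemma lspan_sub (V : lmodType R) (B : set V) (Q : V -> Prop) :
  Q 0 -> (forall c u v, Q u -> Q v -> Q (c *: u + v)) -> (forall v, B v -> Q v) ->
  forall v, lspan B v -> Q v.
Proof.
move=> Q0 QL QB _ [n [c [a [Ha ->]]]]; elim/big_rec : _ => // i v _ Qv.
by apply: QL => //; exact: QB.
Qed.

End UnitizTheory.

(** * Linear and multilinear maps *)

(** The alias carries the proof of linearity, so that a linear structure can be attached to a
    function whose linearity is only established inside a proof. *)
Definition linmap (R : realType) (V W : vectType R) (f : V -> W) (lf : linear f) := f.

HB.instance Definition _ (R : realType) (V W : vectType R) (f : V -> W) (lf : linear f) :=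
  GRing.isLinear.Build R V W *:%R (linmap lf) lf.

Definition lfun_of (R : realType) (V W : vectType R) (f : V -> W) (lf : linear f) :
  'Hom(V, W) := linfun (linmap lf).

Lemma lfun_ofE (R : realType) (V W : vectType R) (f : V -> W) (lf : linear f) v :
  lfun_of lf v = f v.
Proof. by rewrite lfunE. Qed.

Section Multilinear.
Variables (R : realType) (V : vectType R).

Lemma ffupdE j (a : {ffun 'I_j -> V}) i u l : ffupd a i u l = if l == i then u else a l.
Proof. by rewrite ffunE. Qed.

Lemma ffupd_id j (a : {ffun 'I_j -> V}) i : ffupd a i (a i) = a.
Proof. by apply/ffunP => l; rewrite ffupdE; case: eqVneq => // ->. Qed.

Definition multilinear j (W : lmodType R) (f : {ffun 'I_j -> V} -> W) :=
  forall a i c u v, f (ffupd a i (c *: u + v)) = c *: f (ffupd a i u) + f (ffupd a i v).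

Lemma multilinear0 j (W : lmodType R) (f : {ffun 'I_j -> V} -> W)
    (a : {ffun 'I_j -> V}) i :
  multilinear f -> a i = 0 -> f a = 0.
Proof.
move=> mf ai; have := mf a i 1 0 0; rewrite scaler0 addr0 scale1r.
by rewrite -ai ffupd_id => /eqP; rewrite -subr_eq0 opprD addrA subrr sub0r oppr_eq0 => /eqP.
Qed.

Lemma multilinear_sum j (W : lmodType R) (f : {ffun 'I_j -> V} -> W)
    (a : {ffun 'I_j -> V}) i (T : finType) (c : T -> R) (b : T -> V) :
  multilinear f ->
  f (ffupd a i (\sum_t c t *: b t)) = \sum_t c t *: f (ffupd a i (b t)).
Proof.
move=> mf; elim/big_ind2 : _ => [|x1 w1 x2 w2 H1 H2|t _].
- by apply: (@multilinear0 _ _ _ _ i) => //; rewrite ffupdE eqxx.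
- by rewrite -[w1]scale1r mf scale1r H1 H2.
- have := mf a i (c t) (b t) 0; rewrite addr0 => ->.
  by rewrite (@multilinear0 _ _ _ (ffupd a i 0) i) ?addr0 // ffupdE eqxx.
Qed.

(** The arguments are expanded one at a time; those of index at least [m] already belong to the
    spanning family. *)
Lemma eq_multilinear j (W : lmodType R) (f g : {ffun 'I_j -> V} -> W)
    (T : finType) (b : T -> V) :
  (forall v, exists c : T -> R, v = \sum_t c t *: b t) ->
  multilinear f -> multilinear g ->
  (forall h : 'I_j -> T, f [ffun i => b (h i)] = g [ffun i => b (h i)]) ->
  forall a, f a = g a.
Proof.
move=> sb mf mg H a.
suff : forall m (a : {ffun 'I_j -> V}), (m <= j)%N ->
    (forall i : 'I_j, (m <= i)%N -> exists t, a i = b t) -> f a = g a.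
  by move=> /(_ j a (leqnn j)); apply => i; rewrite leqNgt ltn_ord.
elim=> [|m IH] {}a mj Ha.
  have /boolp.choice [h Hh] : forall i, exists t, a i = b t by move=> i; exact: Ha.
  have -> : a = [ffun i => b (h i)] by apply/ffunP => i; rewrite ffunE.
  exact: H.
pose i0 := Ordinal mj; rewrite -(ffupd_id a i0).
have [c ->] := sb (a i0); rewrite !multilinear_sum //.
apply: eq_bigr => t _; congr (_ *: _); apply: IH; first exact: ltnW.
move=> i mi; rewrite ffupdE; case: eqVneq => [_|ni]; first by exists t.
by apply: Ha; rewrite ltn_neqAle mi andbT eq_sym; exact: ni.
Qed.

End Multilinear.

(** Coordinates for a basis indexed by any finite type, such as the type of monomials, which spares
    numbering its elements. *)
Lemma coordinates_exist (R : realType) (V : vectType R) (T : finType) (b : T -> V) :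
  (forall v, exists c : T -> R, v = \sum_t c t *: b t) ->
  (forall c : T -> R, \sum_t c t *: b t = 0 -> forall t, c t = 0) ->
  exists X : V -> T -> R,
    [/\ forall v, v = \sum_t X v t *: b t,
        forall c t, X (\sum_t c t *: b t) t = c t
      & forall a u v t, X (a *: u + v) t = a * X u t + X v t].
Proof.
move=> sb ib; have [X HX] := boolp.choice sb.
have inj (c c' : T -> R) : \sum_t c t *: b t = \sum_t c' t *: b t -> forall t, c t = c' t.
  move=> E t; apply/eqP; rewrite -subr_eq0; apply/eqP.
  apply: (ib (fun t => c t - c' t)).
  by under eq_bigr do rewrite scalerBl; rewrite sumrB E subrr.
exists X; split => //; first by move=> c t; apply: inj; rewrite -HX.
move=> a u v t; apply: (inj _ (fun t => a * X u t + X v t)); rewrite -HX.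
under eq_bigr do rewrite scalerDl -scalerA.
by rewrite big_split /= -scaler_sumr -!HX.
Qed.

(** * Exponents, weights, degrees and words *)

Section Monomials.
Variables (k n : nat) (wgt : 'I_n -> nat).

(** The bound [k] on the exponents makes the type finite and loses nothing when all weights are
    positive. The constant monomial is excluded, as the algebras have no unit. *)
Definition monomial : finType :=
  {e : {ffun 'I_n -> 'I_k.+1} | (0 < mweight wgt (fun a => e a) <= k)%N}.

Definition mexpo (al : monomial) : 'I_n -> nat := fun a => val al a.

Definition mdeg (e : 'I_n -> nat) : nat := \sum_a e a.

Definition msingle (a : 'I_n) : 'I_n -> nat := fun b => b == a.

(** The exponents of the product of the letters of the word [h]: words of length [j] are the ordered
    form of monomials of degree [j]. *)
Definition mcount j (h : 'I_j -> 'I_n) : 'I_n -> nat := fun a => (\sum_i (h i == a))%N.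

Lemma mexpo_weight al : (0 < mweight wgt (mexpo al) <= k)%N.
Proof. by case: al. Qed.

Lemma mexpo_inj al be : mexpo al =1 mexpo be -> al = be.
Proof.
move=> H; apply/val_inj/ffunP => a; apply/val_inj; exact: H.
Qed.

Lemma mweightD e f : mweight wgt (fun a => e a + f a)%N = (mweight wgt e + mweight wgt f)%N.
Proof. by rewrite /mweight -big_split; apply: eq_bigr => a _; rewrite mulnDr. Qed.

Lemma eq_mweight e f : e =1 f -> mweight wgt e = mweight wgt f.
Proof. by move=> ef; apply: eq_bigr => a _; rewrite ef. Qed.

Lemma mdegD e f : mdeg (fun a => e a + f a)%N = (mdeg e + mdeg f)%N.
Proof. by rewrite /mdeg big_split. Qed.

Lemma eq_mdeg e f : e =1 f -> mdeg e = mdeg f.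
Proof. by move=> ef; apply: eq_bigr => a _; rewrite ef. Qed.

Lemma mweight_single a : mweight wgt (msingle a) = wgt a.
Proof.
rewrite /mweight (bigD1 a) //= /msingle eqxx muln1 big1 ?addn0 //.
by move=> b /negbTE ->; rewrite muln0.
Qed.

Lemma mdeg_single a : mdeg (msingle a) = 1%N.
Proof.
rewrite /mdeg (bigD1 a) //= /msingle eqxx big1 //.
by move=> b /negbTE ->.
Qed.

Lemma mdeg_eq1 e : mdeg e = 1%N -> exists a, e =1 msingle a.
Proof.
move=> H; have [a Ha] : exists a, (0 < e a)%N.
  apply/existsP; apply: contraT; rewrite negb_exists => /forallP H'.
  move: H; rewrite /mdeg big1 // => a _; apply/eqP.
  by rewrite -leqn0 leqNgt; exact: H'.
exists a => b; move: H; rewrite /mdeg (bigD1 a) //= => H.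
rewrite /msingle; have [->|ba] := eqVneq b a; first by case: (e a) Ha H => [|[]].
by move: H; rewrite (bigD1 b) //=; lia.
Qed.

Lemma mweight_count j (h : 'I_j -> 'I_n) :
  mweight wgt (mcount h) = (\sum_i wgt (h i))%N.
Proof.
rewrite /mweight /mcount; under eq_bigr do rewrite big_distrr /=.
rewrite exchange_big; apply: eq_bigr => i _.
rewrite (bigD1 (h i)) //= eqxx muln1 big1 ?addn0 //.
by move=> a /negbTE ah; rewrite eq_sym ah muln0.
Qed.

Lemma mdeg_count j (h : 'I_j -> 'I_n) : mdeg (mcount h) = j.
Proof.
rewrite /mdeg /mcount exchange_big /= -[RHS]card_ord -sum1_card; apply: eq_bigr => i _.
rewrite (bigD1 (h i)) //= eqxx big1 //.
by move=> a /negbTE ah; rewrite eq_sym ah.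
Qed.

Lemma prod_count j (h : 'I_j -> 'I_n) (S : comNzRingType) (F : 'I_n -> S) :
  \prod_i F (h i) = \prod_a F a ^+ mcount h a.
Proof.
rewrite (partition_big h xpredT) //=; apply: eq_bigr => a _.
rewrite (eq_bigr (fun=> F a)); last by move=> i /eqP ->.
by rewrite prodr_const /mcount -sum1_card big_mkcond /=; congr (_ ^+ _).
Qed.

Lemma mcount_surj e : exists h : 'I_(mdeg e) -> 'I_n, mcount h =1 e.
Proof.
pose s := flatten [seq nseq (e a) a | a <- enum 'I_n].
have ss : size s = mdeg e.
  rewrite size_flatten /shape -map_comp sumnE big_map big_enum /=.
  by apply: eq_bigr => a _; rewrite size_nseq.
have cs a : count_mem a s = e a.
  rewrite count_flatten -map_comp sumnE big_map big_enum /= (bigD1 a) //=.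
  rewrite count_nseq /= eqxx mul1n big1 ?addn0 // => b ba.
  by rewrite count_nseq /= (negbTE ba).
(* In degree 0 there may be no letter at all to serve as a default for [nth]. *)
case: (posnP (mdeg e)) => [e0|e0].
  have h0 : 'I_(mdeg e) -> 'I_n by rewrite e0 => -[].
  exists h0 => a; rewrite /mcount big1; last by move=> i; have := ltn_ord i; rewrite {2}e0.
  by apply/esym/eqP; rewrite -leqn0 -e0 /mdeg (bigD1 a) //= leq_addr.
have a0 : 'I_n by case: s ss e0 {cs} => [<-|a] //.
exists (fun i => nth a0 s i) => a; rewrite -cs /mcount -sum1_count.
by rewrite (big_nth a0) big_mkord [RHS]big_mkcond ss; apply: eq_bigr => i _ /=; case: eqP.
Qed.

Hypothesis wgt_gt0 : forall a, (0 < wgt a)%N.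

Lemma leq_mweight e a : (e a <= mweight wgt e)%N.
Proof.
rewrite /mweight (bigD1 a) //=; apply: leq_trans (leq_addr _ _).
by rewrite leq_pmull.
Qed.

Lemma mdeg_le_mweight e : (mdeg e <= mweight wgt e)%N.
Proof. by apply: leq_sum => a _; rewrite leq_pmull. Qed.

Lemma mweight_gt0 e : (0 < mdeg e)%N -> (0 < mweight wgt e)%N.
Proof. by move=> /leq_trans; apply; exact: mdeg_le_mweight. Qed.

Lemma mdeg_gt0 e : (0 < mweight wgt e)%N -> (0 < mdeg e)%N.
Proof.
apply: contraTT; rewrite -!eqn0Ngt /mdeg /mweight => /eqP H.
rewrite big1 // => a _; move: H; rewrite (bigD1 a) //= => /eqP.
by rewrite addn_eq0 => /andP[/eqP -> _]; rewrite muln0.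
Qed.

Lemma monomialP e : (0 < mweight wgt e <= k)%N -> exists al, mexpo al =1 e.
Proof.
move=> /andP[e0 ek].
have H a : (e a < k.+1)%N by rewrite ltnS (leq_trans (leq_mweight e a)).
have He : (0 < mweight wgt (fun a => [ffun a => Ordinal (H a)] a) <= k)%N.
  by rewrite (@eq_mweight _ e) ?e0 // => a; rewrite ffunE.
by exists (exist _ [ffun a => Ordinal (H a)] He) => a; rewrite /mexpo /= ffunE.
Qed.

End Monomials.

(** The direct sum decomposition is given by its projections; the last field confines the weights to
    the range from 1 to [k]. *)
Record is_graded_alg (R : realType) (k : nat) (A : nalg R) (G : nat -> {vspace A})
    (pr : nat -> A -> A) : Prop := IsGradedAlg {
  gr_mul : forall i j u v, u \in G i -> v \in G j -> nalg_mul A u v \in G (i + j)%N;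
  gr_pr_lin : forall w, linear (pr w);
  gr_pr_in : forall w v, pr w v \in G w;
  gr_pr_id : forall w v, v \in G w -> pr w v = v;
  gr_pr_out : forall w w' v, v \in G w -> w' != w -> pr w' v = 0;
  gr_pr_sum : forall v, v = \sum_(i < k) pr i.+1 v }.

Section GradedAlg.
Variables (R : realType) (k : nat) (A : nalg R) (G : nat -> {vspace A}).
Variable pr : nat -> A -> A.
Hypothesis gA : is_graded_alg k G pr.
Local Notation mu := (@nalg_mul R A).

Lemma gr_out w v : v \in G w -> (w == 0)%N || (k < w)%N -> v = 0.
Proof.
move=> vG wk; rewrite (gr_pr_sum gA v) big1 // => i _.
apply: (gr_pr_out gA vG); apply: contraTneq wk => <-.
by rewrite negb_or -leqNgt ltn_ord.
Qed.

(* Homogeneous elements of the unitalization; the scalars have weight 0. *)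
Definition uhom (w : nat) (x : unitz A) : Prop :=
  if w is 0 then x.2 = 0 else x.1 = 0 /\ x.2 \in G w.

Lemma uhomM w w' x y : uhom w x -> uhom w' y -> uhom (w + w') (x * y).
Proof.
case: x y => [a u] [b v]; case: w w' => [|w] [|w'] /=.
- by move=> -> ->; rewrite !scaler0 linear0 !addr0.
- move=> -> [-> vG]; rewrite mulr0 scaler0 addr0 linear0 zero_lfunE addr0.
  by split => //; exact: memvZ.
- move=> [-> uG] ->; rewrite mul0r scaler0 add0r linear0 addr0 addn0.
  by split => //; exact: memvZ.
- move=> [-> uG] [-> vG]; rewrite mul0r !scale0r !add0r.
  by split => //; exact: (gr_mul gA).
Qed.

Lemma uhomX w x n : uhom w x -> uhom (w * n)%N (x ^+ n).
Proof.
move=> hx; elim: n => [|n IH]; first by rewrite muln0 expr0.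
by rewrite mulnS exprS; exact: uhomM.
Qed.

Lemma uhom_prod (I : Type) (s : seq I) (f : I -> nat) (F : I -> unitz A) :
  (forall i, uhom (f i) (F i)) -> uhom (\sum_(i <- s) f i)%N (\prod_(i <- s) F i).
Proof.
move=> H; elim: s => [|i s IH]; first by rewrite !big_nil.
by rewrite !big_cons; exact: uhomM.
Qed.

Lemma uhom_uin w v : (0 < w)%N -> v \in G w -> uhom w (uin v).
Proof. by case: w. Qed.

Lemma uhom_uinK w x : (0 < w)%N -> uhom w x -> uin x.2 = x /\ x.2 \in G w.
Proof. by case: w x => // w [a v] _ /= [-> vG]. Qed.

Variables (n : nat) (wgt : 'I_n -> nat) (e : 'I_n -> A).
Hypotheses (wgt_gt0 : forall a, (0 < wgt a)%N) (eG : forall a, e a \in G (wgt a)).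

(** Monomials are computed in the unitalization, where zero exponents make sense; [emono] drops the
    scalar component, which is zero as soon as the weight is positive. *)
Definition emonoU (b : 'I_n -> nat) : unitz A := \prod_a uin (e a) ^+ b a.
Definition emono (b : 'I_n -> nat) : A := (emonoU b).2.

Lemma eq_emonoU b c : b =1 c -> emonoU b = emonoU c.
Proof. by move=> bc; apply: eq_bigr => a _; rewrite bc. Qed.

Lemma eq_emono b c : b =1 c -> emono b = emono c.
Proof. by move=> bc; rewrite /emono (eq_emonoU bc). Qed.

Lemma emonoUD b c : emonoU (fun a => b a + c a)%N = emonoU b * emonoU c.
Proof. by rewrite /emonoU -big_split; apply: eq_bigr => a _; rewrite exprD. Qed.

Lemma emonoU_hom b : uhom (mweight wgt b) (emonoU b).
Proof. by apply: uhom_prod => a; apply: uhomX; exact: uhom_uin. Qed.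

Lemma uin_emono b : (0 < mweight wgt b)%N -> uin (emono b) = emonoU b.
Proof. by move=> b0; have [] := uhom_uinK b0 (emonoU_hom b). Qed.

Lemma emono_in b : (0 < mweight wgt b)%N -> emono b \in G (mweight wgt b).
Proof. by move=> b0; have [] := uhom_uinK b0 (emonoU_hom b). Qed.

Lemma emono_out b : (k < mweight wgt b)%N -> emono b = 0.
Proof.
move=> kb; apply: (gr_out (emono_in (leq_ltn_trans (leq0n _) kb))).
by rewrite kb orbT.
Qed.

Lemma emonoM b c : (0 < mweight wgt b)%N -> (0 < mweight wgt c)%N ->
  mu (emono b) (emono c) = emono (fun a => b a + c a)%N.
Proof.
move=> b0 c0; apply: uin_inj; rewrite -uinM !uin_emono //; first by rewrite emonoUD.
by rewrite mweightD addn_gt0 b0.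
Qed.

Lemma emonoU_single a : emonoU (msingle a) = uin (e a).
Proof.
rewrite /emonoU (bigD1 a) //= /msingle eqxx expr1 big1 ?mulr1 //.
by move=> b /negbTE ->.
Qed.

Lemma emono_single a : emono (msingle a) = e a.
Proof. by rewrite /emono emonoU_single. Qed.

Lemma emonoU_count j (h : 'I_j -> 'I_n) : emonoU (mcount h) = \prod_i uin (e (h i)).
Proof. by rewrite (prod_count h (fun a => uin (e a))). Qed.

Lemma emono_power_span j b : (0 < j <= mdeg b)%N -> power_span mu j (emono b).
Proof.
move=> /andP[j0 jb]; have [h hb] := mcount_surj b.
apply: (@power_spanP _ _ j [seq e (h i) | i <- enum 'I_(mdeg b)]).
  by rewrite j0 size_map size_enum_ord.
rewrite uin_emono; last by apply: mweight_gt0 => //; exact: leq_trans jb.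
by rewrite big_map big_enum -emonoU_count; exact/esym/eq_emonoU.
Qed.

Record free_gens : Prop := FreeGens {
  fg_span : forall v, exists c : monomial k wgt -> R,
    v = \sum_al c al *: emono (mexpo al);
  fg_indep : forall c : monomial k wgt -> R,
    \sum_al c al *: emono (mexpo al) = 0 -> forall al, c al = 0 }.

End GradedAlg.

(** * A model of the symmetric powers of R^n *)

Section SymmetricPower.
Variables (R : realType) (j n : nat).

Lemma leq_mcount (h : 'I_j -> 'I_n) a : (mcount h a <= j)%N.
Proof. by rewrite -[leqRHS](mdeg_count h) /mdeg (bigD1 a) //= leq_addr. Qed.

Definition word_type (h : {ffun 'I_j -> 'I_n}) : {ffun 'I_n -> 'I_j.+1} :=
  [ffun a => inord (mcount h a)].

Lemma word_typeE h a : word_type h a = mcount h a :> nat.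
Proof. by rewrite ffunE inordK // ltnS leq_mcount. Qed.

Lemma eq_word_type h h' : word_type h = word_type h' <-> mcount h =1 mcount h'.
Proof.
split=> [E a|E]; first by rewrite -!word_typeE E.
by apply/ffunP => a; apply/val_inj; rewrite /= !word_typeE E.
Qed.

Lemma word_type_perm h h' : word_type h = word_type h' ->
  exists s : 'S_j, forall i, h i = h' (s i).
Proof.
move=> /eq_word_type E.
have cE (g : {ffun 'I_j -> 'I_n}) a : count_mem a [tuple g i | i < j] = mcount g a.
  rewrite /= count_map -sum1_count big_enum_cond /= big_mkcond /mcount.
  by apply: eq_bigr => i _ /=; case: eqP.
have : perm_eq [tuple h i | i < j] [tuple h' i | i < j].
  by apply/allP => a _ /=; rewrite !cE E.
move/tuple_permP => [s Es]; exists s => i.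
have /val_inj /(congr1 (fun t => tnth t i)) := Es.
by rewrite !tnth_mktuple.
Qed.

(** Multisets of [j] letters, encoded as the multiplicity functions realized by some word; they
    index the monomial basis of the symmetric power. *)
Definition multiset : finType := {g : {ffun 'I_n -> 'I_j.+1} | g \in codom word_type}.

Definition msword (t : multiset) : {ffun 'I_j -> 'I_n} := iinv (valP t).

Lemma mswordK t : word_type (msword t) = val t.
Proof. exact: (f_iinv (valP t)). Qed.

Definition msof (h : {ffun 'I_j -> 'I_n}) : multiset :=
  exist (fun g => g \in codom word_type) (word_type h) (codom_f word_type h).

Lemma msof_word h t : (word_type h == val t) = (t == msof h).
Proof. by rewrite -val_eqE eq_sym. Qed.

Definition sympow : vectType R := {ffun multiset -> R^o}.

(** Rows are seen as linear forms and the symmetric power as homogeneous polynomials: the entry at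
    [t] is the coefficient of the monomial [t] in the expanded product of the forms [x i]. *)
Definition symprod (x : {ffun 'I_j -> 'rV[R]_n}) : sympow :=
  [ffun t : multiset => \sum_(h : {ffun 'I_j -> 'I_n} | word_type h == val t)
     \prod_i x i 0 (h i) : R^o].

Definition basis_word (h : 'I_j -> 'I_n) : {ffun 'I_j -> 'rV[R]_n} :=
  [ffun i => delta_mx 0 (h i)].

Lemma symprod_basis (h : {ffun 'I_j -> 'I_n}) t :
  symprod (basis_word h) t = (t == msof h)%:R.
Proof.
rewrite ffunE -msof_word.
have H (h' : {ffun 'I_j -> 'I_n}) : \prod_i basis_word h i 0 (h' i) = (h' == h)%:R.
  have [->|hh] := eqVneq h' h.
    by rewrite big1 // => i _; rewrite ffunE mxE !eqxx.
  have [i hi] : exists i, h' i != h i.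
    apply/existsP; apply: contraR hh; rewrite negb_exists => /forallP H.
    by apply/eqP/ffunP => i; apply/eqP; have := H i; rewrite negbK.
  by rewrite (bigD1 i) //= ffunE mxE eqxx (negbTE hi) mul0r.
under eq_bigr do rewrite H.
case: (boolP (word_type h == val t)) => E.
  rewrite (bigD1 h) //= eqxx big1 ?addr0 // => h' /andP[_ /negbTE ->] //.
rewrite big1 // => h' E'; case: eqVneq => // hh; by rewrite hh (negbTE E) in E'.
Qed.

Lemma symprod_multilinear : multilinear symprod.
Proof.
move=> a i c u v; apply/ffunP => t; rewrite !ffunE scaler_sumr -big_split /=.
apply: eq_bigr => h _; rewrite !(bigD1 i (P := xpredT)) //= !ffupdE eqxx.
have E w : \prod_(l | l != i) ffupd a i w l 0 (h l) = \prod_(l | l != i) a l 0 (h l).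
  by apply: eq_bigr => l /negbTE li; rewrite ffupdE li.
by rewrite !E !mxE mulrDl -mulrA.
Qed.

Lemma symprod_sym (a : {ffun 'I_j -> 'rV[R]_n}) (s : 'S_j) :
  symprod [ffun i => a (s i)] = symprod a.
Proof.
apply/ffunP => t; rewrite !ffunE.
rewrite (reindex_inj (h := fun h : {ffun 'I_j -> 'I_n} => [ffun i => h (s i)])) /=; last first.
  move=> h h' /ffunP E; apply/ffunP => i; have := E (s^-1%g i).
  by rewrite !ffunE permKV.
apply: eq_big => h.
  congr (_ == _); apply/eq_word_type => b; rewrite /mcount.
  rewrite [RHS](reindex_inj (@perm_inj _ s)) /=.
  by apply: eq_bigr => i _; rewrite ffunE.
move=> _; rewrite [RHS](reindex_inj (@perm_inj _ s)) /=.
by apply: eq_bigr => i _; rewrite !ffunE.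
Qed.

(** The products of basis vectors along one word per multiset form a basis, and a symmetric [f]
    takes the same value on all words of a multiset. *)
Lemma symprod_is_sympower : is_sympower symprod.
Proof.
split; first by split; [exact: symprod_multilinear|exact: symprod_sym].
move=> W f [mf sf].
pose g0 (z : sympow) : W := \sum_t z t *: f (basis_word (msword t)).
have lg0 : linear g0.
  move=> c u v; rewrite /g0 scaler_sumr -big_split /=; apply: eq_bigr => t _.
  by rewrite !ffunE scalerDl scalerA.
have fb (h : {ffun 'I_j -> 'I_n}) : f (basis_word h) = f (basis_word (msword (msof h))).
  have [s Hs] := @word_type_perm h (msword (msof h)) (esym (mswordK (msof h))).
  rewrite -(sf (basis_word (msword (msof h))) s); congr f.
  by apply/ffunP => i; rewrite !ffunE Hs.
have Hg a : g0 (symprod a) = f a.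
  apply: (@eq_multilinear R _ j W (g0 \o symprod) f _ (fun l : 'I_n => delta_mx 0 l)) => //.
  - by move=> v; exists (fun l => v 0 l); exact: row_sum_delta.
  - by move=> b i c u v /=; rewrite symprod_multilinear lg0.
  - move=> h; have -> : [ffun i => delta_mx 0 (h i)] = basis_word (finfun h).
      by apply/ffunP => i; rewrite !ffunE.
    rewrite /= /g0 (bigD1 (msof (finfun h))) //= symprod_basis eqxx scale1r big1 ?addr0.
      by rewrite -fb.
    by move=> t /negbTE tn; rewrite symprod_basis tn scale0r.
exists (lfun_of lg0); split => [a|g' Hg']; first by rewrite lfun_ofE.
apply/lfunP => z; rewrite lfun_ofE /g0.
have zE : z = \sum_t z t *: symprod (basis_word (msword t)).
  apply/ffunP => t; rewrite sum_ffunE (bigD1 t) //= ffunE symprod_basis.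
  have -> : msof (msword t) = t by apply/val_inj; exact: mswordK.
  rewrite eqxx big1 ?addr0; first by rewrite /GRing.scale /= mulr1.
  move=> t' /negbTE tt; rewrite ffunE symprod_basis.
  have -> : msof (msword t') = t' by apply/val_inj; exact: mswordK.
  by rewrite eq_sym tt scaler0.
rewrite [in RHS]zE linear_sum; apply: eq_bigr => t _.
by rewrite -Hg'; exact/esym/linearZ.
Qed.

End SymmetricPower.

(** * Injectivity of m^j for free algebras *)

Section FreeInjective.
Variables (R : realType) (k : nat) (A : nalg R) (G : nat -> {vspace A}).
Variable pr : nat -> A -> A.
Hypothesis gA : is_graded_alg k G pr.
Variables (n : nat) (wgt : 'I_n -> nat) (e : 'I_n -> A).
Hypotheses (wgt_gt0 : forall a, (0 < wgt a)%N) (wgt_le : forall a, (wgt a <= k)%N).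
Hypothesis eG : forall a, e a \in G (wgt a).
Hypothesis fg : free_gens k wgt e.
Local Notation mu := (@nalg_mul R A).
Local Notation mon := (monomial k wgt).
Local Notation em := (fun al : mon => emono e (mexpo al)).

Lemma mexpo_gt0 (al : mon) : (0 < mweight wgt (mexpo al))%N.
Proof. by have /andP[] := mexpo_weight al. Qed.

Lemma monomial_in (al : mon) : em al \in G (mweight wgt (mexpo al)).
Proof. by apply: (emono_in gA wgt_gt0 eG) => //; exact: mexpo_gt0. Qed.

Lemma iter_prod_multilinear j : (0 < j)%N ->
  multilinear (fun a : {ffun 'I_j -> A} => iter_prod mu (codom a)).
Proof.
move=> j0 a i c u v; apply: uin_inj; rewrite uinD uinZ !iter_prod_codom //.
rewrite !(bigD1 i (P := xpredT)) //= !ffupdE eqxx.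
have E w : \prod_(l | l != i) uin (ffupd a i w l) = \prod_(l | l != i) uin (a l).
  by apply: eq_bigr => l /negbTE li; rewrite ffupdE li.
by rewrite !E uinD uinZ mulrDl mulrA.
Qed.

Variable X : A -> mon -> R.
Hypothesis XE : forall v, v = \sum_al X v al *: em al.
Hypothesis XK : forall c al, X (\sum_al c al *: em al) al = c al.
Hypothesis XL : forall a u v al, X (a *: u + v) al = a * X u al + X v al.

Lemma mcoef0 al : X 0 al = 0.
Proof.
have := XK (fun=> 0) al; rewrite big1 // => be _; exact: scale0r.
Qed.

Lemma coef_em al be : X (em al) be = (be == al)%:R.
Proof.
rewrite -[RHS](XK (fun be => (be == al)%:R) be); congr (X _ be).
rewrite (bigD1 al) //= eqxx scale1r big1 ?addr0 // => ga /negbTE ->.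
exact: scale0r.
Qed.

(** The projection onto weight [w] fixes [v] and erases the monomials of other weights from its
    expansion; the expansion being unique, they were absent. *)
Lemma coef_homogeneous w v al : v \in G w -> mweight wgt (mexpo al) != w -> X v al = 0.
Proof.
move=> vG wal.
have E : v = \sum_be (if mweight wgt (mexpo be) == w then X v be else 0) *: em be.
  rewrite -[LHS](gr_pr_id gA vG) [in LHS](XE v).
  pose f := lfun_of (gr_pr_lin gA w).
  have fE u : pr w u = f u by rewrite lfun_ofE.
  rewrite fE linear_sum; apply: eq_bigr => be _; rewrite linearZ /= -fE.
  case: eqP => [<-|/eqP H]; first by rewrite (gr_pr_id gA (monomial_in be)).
  by rewrite (gr_pr_out gA (monomial_in be)) ?scaler0 ?scale0r // eq_sym.
by rewrite E XK (negbTE wal).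
Qed.

(** The order of [v] as a polynomial in the generators; [power_span_degfilt] identifies the elements
    of order at least [j] with the span of the [j]-fold products. *)
Definition degfilt j v := forall al : mon, (mdeg (mexpo al) < j)%N -> X v al = 0.

Lemma degfilt0 j : degfilt j 0. Proof. by move=> al _; exact: mcoef0. Qed.

Lemma degfiltL j c u v : degfilt j u -> degfilt j v -> degfilt j (c *: u + v).
Proof. by move=> Hu Hv al aj; rewrite XL Hu // Hv // mulr0 addr0. Qed.

Lemma degfilt_sum j (I : Type) (s : seq I) (P : pred I) (c : I -> R) (F : I -> A) :
  (forall i, P i -> c i != 0 -> degfilt j (F i)) ->
  degfilt j (\sum_(i <- s | P i) c i *: F i).
Proof.
move=> H; elim/big_rec : _ => [|i v Pi Hv]; first exact: degfilt0.
have [->|ci] := eqVneq (c i) 0; first by rewrite scale0r add0r.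
by apply: degfiltL => //; exact: H.
Qed.

Lemma degfilt_emono j b : (0 < j <= mdeg b)%N -> degfilt j (emono e b).
Proof.
move=> /andP[j0 jb] al aj; have b0 := mweight_gt0 wgt_gt0 (leq_trans j0 jb).
have [bk|kb] := leqP (mweight wgt b) k; last by rewrite (emono_out gA wgt_gt0 eG) ?mcoef0.
have [be Hbe] : exists be : mon, mexpo be =1 b by apply: monomialP; rewrite ?b0.
rewrite -(eq_emono e Hbe) coef_em; case: eqVneq => // E.
by move: aj; rewrite E (eq_mdeg Hbe) ltnNge jb.
Qed.

Lemma degfiltM i j u v : (0 < i)%N -> (0 < j)%N ->
  degfilt i u -> degfilt j v -> degfilt (i + j) (mu u v).
Proof.
move=> i0 j0 Hu Hv; rewrite (XE u) (XE v).
have -> : mu (\sum_al X u al *: em al) (\sum_al X v al *: em al) =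
    \sum_al X u al *: \sum_be X v be *: mu (em al) (em be).
  rewrite nalg_mul_suml; apply: eq_bigr => al _.
  rewrite nalg_mulZl nalg_mul_sumr; congr (_ *: _).
  by apply: eq_bigr => be _; rewrite nalg_mulZr.
apply: degfilt_sum => al _ ual; apply: degfilt_sum => be _ vbe.
rewrite (emonoM gA wgt_gt0 eG) ?mexpo_gt0 //; apply: degfilt_emono.
rewrite addn_gt0 i0 /= mdegD leq_add //.
  by rewrite leqNgt; apply: contraNN ual => /Hu ->.
by rewrite leqNgt; apply: contraNN vbe => /Hv ->.
Qed.

Lemma degfilt1 v : degfilt 1 v.
Proof.
by move=> al; rewrite ltnNge (mdeg_gt0 (mexpo_gt0 al)).
Qed.

Lemma power_span_degfilt j v : (0 < j)%N -> power_span mu j v <-> degfilt j v.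
Proof.
move=> j0; split.
  apply: lspan_sub => [|c u w|_ [a ->]]; [exact: degfilt0|exact: degfiltL|].
  have : size (codom a) = j by rewrite size_codom card_ord.
  case: (codom a) => [|b s] /=; first by move=> E; rewrite -E in j0.
  move=> <-; rewrite -add1n.
  suff H i : (0 < i)%N -> degfilt i b ->
      degfilt (i + size s) (foldl (fun u v => mu u v) b s) by apply: H => //; exact: degfilt1.
  elim: s b i => [|c s IH] b i i0 bi /=; first by rewrite addn0.
  rewrite addnS -addSn; apply: IH => //; rewrite -addn1.
  by apply: degfiltM => //; exact: degfilt1.
move=> Hv; rewrite (XE v) (bigID (fun al : mon => (j <= mdeg (mexpo al))%N)) /=.
rewrite [X in _ + X]big1 ?addr0; last first.
  by move=> al; rewrite -ltnNge => /Hv ->; rewrite scale0r.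
apply: lspan_sum => al jal; apply: (emono_power_span gA wgt_gt0 eG) => //.
by rewrite j0.
Qed.

Definition mgen (a : 'I_n) : mon :=
  sval (cid (@monomialP k n wgt wgt_gt0 (msingle a)
    (etrans (congr1 (fun w => 0 < w <= k)%N (mweight_single wgt a))
       (introT andP (conj (wgt_gt0 a) (wgt_le a)))))).

Lemma mgenE a : mexpo (mgen a) =1 msingle a.
Proof. by rewrite /mgen; case: cid. Qed.

Lemma em_mgen a : em (mgen a) = e a.
Proof. by rewrite /= (eq_emono e (mgenE a)) emono_single. Qed.

Lemma mgen_inj : injective mgen.
Proof.
move=> a b E; have := mgenE a b; rewrite E mgenE /msingle eqxx.
by case: eqVneq.
Qed.

Lemma mdeg1_mgen (al : mon) : mdeg (mexpo al) = 1%N -> exists a, al = mgen a.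
Proof.
move=> /mdeg_eq1 [a Ha]; exists a; apply: mexpo_inj => b.
by rewrite Ha mgenE.
Qed.

(** A model of the quotient map onto [Ehat]: the linear part of a polynomial. *)
Definition linpart (v : A) : 'rV[R]_n := \row_a X v (mgen a).

Lemma linpart_linear : linear linpart.
Proof. by move=> c u v; apply/rowP => a; rewrite !mxE XL. Qed.

Lemma linpart_e a : linpart (e a) = delta_mx 0 a.
Proof.
apply/rowP => b; rewrite !mxE eqxx /= -em_mgen coef_em (inj_eq mgen_inj).
by [].
Qed.

Lemma linpart_eq0 v : linpart v = 0 <-> power_span mu 2 v.
Proof.
rewrite power_span_degfilt //; split.
  move=> /rowP H al; rewrite ltnS leq_eqVlt ltnS leqn0.
  case/orP => [/eqP/mdeg1_mgen [a ->]|/eqP a0]; first by have := H a; rewrite !mxE.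
  by have := mdeg_gt0 (mexpo_gt0 al); rewrite a0.
move=> H; apply/rowP => a; rewrite !mxE; apply: H.
by rewrite (eq_mdeg (mgenE a)) mdeg_single.
Qed.

(* The products of [j] elements span the monomials of degree at least [j]. *)
Lemma free_induced_injective j : (0 < j)%N -> induced_injective k G mu j.
Proof.
move=> j0.
(* The monomials of degree at most [j] give coordinates on the quotient by the [j.+1]-fold
   products. *)
pose T : finType := {al : mon | (mdeg (mexpo al) <= j)%N}.
pose Q : vectType R := {ffun T -> R^o}.
pose q0 (v : A) : Q := [ffun t : T => X v (val t) : R^o].
have lq0 : linear q0 by move=> c u v; apply/ffunP => t; rewrite !ffunE XL.
pose q := lfun_of lq0; pose p := lfun_of linpart_linear.
have qE v : q v = q0 v by exact: lfun_ofE.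
have pE v : p v = linpart v by exact: lfun_ofE.
have q0P v : q v = 0 <-> power_span mu j.+1 v.
  rewrite qE power_span_degfilt //; split.
    move=> /ffunP H al aj; have aj' : (mdeg (mexpo al) <= j)%N by [].
    by have := H (exist _ al aj'); rewrite !ffunE.
  by move=> H; apply/ffunP => t; rewrite !ffunE; apply: H; rewrite ltnS (valP t).
pose P (h : 'I_j -> 'I_n) : A := emono e (mcount h).
have PE (h : 'I_j -> 'I_n) : uin (P h) = \prod_i uin (e (h i)).
  rewrite /P (uin_emono gA wgt_gt0 eG) //; first exact: emonoU_count.
  by apply: mweight_gt0 => //; rewrite mdeg_count.
(* In these models the induced morphism sends a multiset of generators to the class of the
   corresponding monomial. *)
pose m0 (z : sympow R j n) : Q := \sum_t z t *: q (P (msword t)).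
have lm0 : linear m0.
  move=> c u v; rewrite /m0 scaler_sumr -big_split /=; apply: eq_bigr => t _.
  by rewrite !ffunE scalerDl scalerA.
exists 'rV[R]_n, Q, (sympow R j n), p, q, (@symprod R j n), (lfun_of lm0); split.
- split => [z|v]; last by rewrite pE; exact: linpart_eq0.
  exists (\sum_a z 0 a *: e a); rewrite linear_sum /= [RHS]row_sum_delta.
  by apply: eq_bigr => a _; rewrite linearZ /= pE linpart_e.
- split => // z; exists (\sum_al (if insub al is Some t then z t else 0) *: em al).
  rewrite qE; apply/ffunP => t; rewrite ffunE XK; case: insubP => [t' _ /val_inj -> //|].
  by rewrite (valP t).
- exact: symprod_is_sympower.
- apply: (@eq_multilinear R A j Q
    (fun a => lfun_of lm0 (symprod [ffun i => p (a i)]))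
    (fun a => q (iter_prod mu (codom a))) mon em).
  + by move=> v; exists (X v).
  + move=> a i c u v.
    have E w : [ffun l => p (ffupd a i w l)] = ffupd [ffun l => p (a l)] i (p w).
      by apply/ffunP => l; rewrite !ffunE; case: eqP.
    by rewrite !E linearP symprod_multilinear linearP.
  + by move=> a i c u v; rewrite iter_prod_multilinear // linearP.
  move=> h; rewrite lfun_ofE.
  (* If all factors are generators, both sides are the class of one monomial. Otherwise both vanish:
     some factor is killed by [p], and the product has degree above [j]. *)
  have [H|] := pselect (forall i, mdeg (mexpo (h i)) = 1%N).
    have /boolp.choice [g Hg] : forall i, exists a, h i = mgen a by move=> i; exact: mdeg1_mgen.
    have -> : [ffun i => p ([ffun i => em (h i)] i)] = basis_word R (finfun g).
      by apply/ffunP => i; rewrite !ffunE Hg em_mgen pE linpart_e.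
    rewrite /m0 (bigD1 (msof (finfun g))) //= symprod_basis eqxx scale1r big1 ?addr0; last first.
      by move=> t /negbTE tn; rewrite symprod_basis tn scale0r.
    congr (q _); apply: uin_inj; rewrite PE iter_prod_codom //.
    have <- : \prod_i uin (e (finfun g i)) = \prod_i uin ([ffun i => em (h i)] i).
      by apply: eq_bigr => i _; rewrite !ffunE Hg em_mgen.
    rewrite -!emonoU_count; apply: eq_emonoU; apply/eq_word_type.

    exact: mswordK.
  move=> /existsNP [i0 Hi0].
  have d1 i : (1 <= mdeg (mexpo (h i)))%N by exact: (mdeg_gt0 (mexpo_gt0 _)).
  have d2 : (2 <= mdeg (mexpo (h i0)))%N.
    by move: Hi0 (d1 i0); case: (mdeg _) => [|[]].
  have -> : symprod [ffun i => p ([ffun i => em (h i)] i)] = 0.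
    apply: (multilinear0 (i := i0) (@symprod_multilinear _ _ _)); rewrite !ffunE pE.
    apply/linpart_eq0; rewrite power_span_degfilt //; exact: degfilt_emono.
  rewrite /m0 big1 => [|t _]; last by rewrite ffunE scale0r.
  apply/esym/q0P.
  have E : iter_prod mu (codom [ffun i => em (h i)]) = emono e (fun a => \sum_i mexpo (h i) a)%N.
    have W0 : (0 < mweight wgt (fun a => \sum_i mexpo (h i) a)%N)%N.
      apply: mweight_gt0 => //; rewrite /mdeg exchange_big /= (bigD1 i0) //=.
      by apply: leq_trans (leq_addr _ _); exact: leq_trans d2.
    apply: uin_inj; rewrite iter_prod_codom // (uin_emono gA wgt_gt0 eG) //.
    rewrite /emonoU; under [RHS]eq_bigr do rewrite -prodrXr.
    rewrite exchange_big /=; apply: eq_bigr => i _; rewrite ffunE (uin_emono gA wgt_gt0 eG) ?mexpo_gt0 //.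
  rewrite E; apply: (emono_power_span gA wgt_gt0 eG) => //=.
  apply: (@leq_trans (1 + \sum_(i < j) 1)%N); first by rewrite sum1_card card_ord.
  rewrite /mdeg exchange_big /= (bigD1 i0) //= [leqRHS](bigD1 i0) //= addnA.
  apply: leq_add; first exact: d2.
  by apply: leq_sum => i _; exact: d1.
- move=> z zin; rewrite lfun_ofE => mz.
  (* Multisets of weight above [k] have a zero monomial in [A], so their coefficients cannot be read
     after applying the morphism; they are zero by the restriction on the weight of [z]. *)
  have zk t : (k < mweight wgt (mcount (msword t)))%N -> z t = 0.
    move=> kt; move: z zin {mz}; apply: lspan_sub => [|c u v Hu Hv|_ [a [w [aG wk ->]]]].
    - by rewrite ffunE.
    - by rewrite !ffunE Hu Hv scaler0 addr0.
    - rewrite ffunE big1 // => h /eqP E.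
      have Eh := (eq_word_type h (msword t)).1 (etrans E (esym (mswordK t))).
      have [i Hi] : exists i, w i != wgt (h i).
        apply/existsP; apply: contraLR kt; rewrite negb_exists => /forallP H.
        rewrite -leqNgt -(eq_mweight _ Eh) mweight_count; apply: leq_trans wk.
        by apply: leq_sum => i _; have := H i; rewrite negbK => /eqP ->.
      rewrite (bigD1 i) //= ffunE pE mxE (coef_homogeneous (aG i)) ?mul0r //.
      by rewrite (eq_mweight _ (mgenE _)) mweight_single eq_sym.
  apply/ffunP => t0; rewrite [RHS]ffunE; apply/eqP; apply: contraT => zt0.
  have alP t : z t != 0 -> exists al : mon, mexpo al =1 mcount (msword t).
    move=> zt; apply: monomialP => //; rewrite mweight_gt0 ?mdeg_count //=.
    by rewrite leqNgt; apply: contraNN zt => /zk ->.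
  have [al0 Hal0] := alP t0 zt0.
  have dal0 : (mdeg (mexpo al0) <= j)%N by rewrite (eq_mdeg Hal0) mdeg_count.
  (* Different multisets of weight at most [k] give different monomials, so the coefficient at [al0]
     isolates [z t0]. *)
  have : (\sum_t z t *: q (P (msword t))) (exist _ al0 dal0) = 0.
    by have := mz; rewrite /m0 => ->; rewrite ffunE.
  rewrite sum_ffunE (bigD1 t0) //= big1 ?addr0; last first.
    move=> t tt0; have [->|zt] := eqVneq (z t) 0; first by rewrite scale0r ffunE.
    have [al Hal] := alP t zt; rewrite ffunE qE ffunE /P -(eq_emono e Hal) coef_em.
    case: eqVneq => [/= E|_]; last by rewrite scaler0.
    case/eqP: tt0; apply/val_inj; rewrite -!mswordK; apply/eq_word_type => a.
    by rewrite -Hal -Hal0 E.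
  rewrite ffunE qE ffunE /P -(eq_emono e Hal0) coef_em eqxx /GRing.scale /= mulr1.
  by move=> H; rewrite H eqxx in zt0.
Qed.

End FreeInjective.

(** * Existence of free generators *)

Definition dwt k (d : 'I_k -> nat) (a : 'I_(\sum_i d i)) : nat := (tagnat.sig1 a).+1.

Lemma dwt_gt0 k (d : 'I_k -> nat) a : (0 < dwt (d := d) a)%N.
Proof. by []. Qed.

Lemma dwt_le k (d : 'I_k -> nat) a : (dwt (d := d) a <= k)%N.
Proof. exact: ltn_ord. Qed.

Lemma big_tagnat (T : Type) (idx : T) (op : Monoid.com_law idx) k (d : 'I_k -> nat)
    (F : {i : 'I_k & 'I_(d i)} -> T) :
  \big[op/idx]_(a < \sum_i d i) F (tagnat.sig a) =
  \big[op/idx]_i \big[op/idx]_(j < d i) F (Tagged (fun i => 'I_(d i)) j).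
Proof.
rewrite (sig_big_dep xpredT (fun _ => xpredT) (fun i j => F (Tagged (fun i => 'I_(d i)) j))).
rewrite (reindex (@tagnat.rank k d)) /=; last exact: (onW_bij _ tagnat.rank_bij).
by apply: eq_bigr => p _; rewrite tagnat.rankK; case: p.
Qed.

Section FreeExists.
Variables (R : realType) (k : nat) (A : nalg R) (G : nat -> {vspace A}).
Variable pr : nat -> A -> A.
Hypothesis gA : is_graded_alg k G pr.
Local Notation mu := (@nalg_mul R A).

Definition square : {vspace A} :=
  <<[seq mu u v | u <- vbasis (@fullv R A), v <- vbasis (@fullv R A)]>>%VS.

Lemma mem_square u v : mu u v \in square.
Proof.
rewrite (coord_vbasis (memvf u)) (coord_vbasis (memvf v)) nalg_mul_suml.
apply: memv_suml => i _; rewrite nalg_mulZl nalg_mul_sumr; apply: memvZ.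
apply: memv_suml => j _; rewrite nalg_mulZr; apply: memvZ; apply: memv_span.
by apply/allpairsP; exists ((vbasis (@fullv R A))`_i, (vbasis (@fullv R A))`_j);
  split => //=; apply: mem_nth; rewrite size_tuple.
Qed.

Lemma squareP v : v \in square <-> power_span mu 2 v.
Proof.
split.
  rewrite /square; set X := [seq _ | _ <- _, _ <- _] => vS.
  have -> := coord_span (vS : v \in <<in_tuple X>>%VS); apply: lspan_sum => i _.
  have : X`_i \in X by apply: mem_nth.
  move=> /allpairsP [[a b] /= [_ _ ->]].
  apply: (@power_spanP _ _ 2 [:: a; b]) => //.
  by rewrite big_cons big_seq1 uinM.
apply: (@lspan_sub R A _ (fun v => v \in square)) => [|c u w Hu Hw|_ [a ->]].
  exact: mem0v.
  by apply: memvD => //; exact: memvZ.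
have : size (codom a) = 2%N by rewrite size_codom card_ord.
by case: (codom a) => [|x [|y [|]]] //= _; exact: mem_square.
Qed.

Lemma prZ w c v : pr w (c *: v) = c *: pr w v.
Proof.
by rewrite -!(lfun_ofE (gr_pr_lin gA w)) linearZ.
Qed.

Lemma prD w u v : pr w (u + v) = pr w u + pr w v.
Proof. by rewrite -!(lfun_ofE (gr_pr_lin gA w)) linearD. Qed.

Lemma pr0 w : pr w 0 = 0.
Proof. by rewrite -!(lfun_ofE (gr_pr_lin gA w)) linear0. Qed.

Lemma pr_sum w (I : Type) (s : seq I) (P : pred I) (F : I -> A) :
  pr w (\sum_(i <- s | P i) F i) = \sum_(i <- s | P i) pr w (F i).
Proof. by apply: (big_morph (pr w)) => [u v|]; [exact: prD|exact: pr0]. Qed.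

Lemma pr_mul w u v :
  pr w (mu u v) = \sum_(i < k) \sum_(j < k | (i.+1 + j.+1 == w)%N) mu (pr i.+1 u) (pr j.+1 v).
Proof.
rewrite {1}(gr_pr_sum gA u) {1}(gr_pr_sum gA v) nalg_mul_suml pr_sum.
apply: eq_bigr => i _; rewrite nalg_mul_sumr pr_sum [RHS]big_mkcond /=.
apply: eq_bigr => j _.
have H := gr_mul gA (gr_pr_in gA i.+1 u) (gr_pr_in gA j.+1 v).
case: eqP => [<-|/eqP ne]; first exact: (gr_pr_id gA H).
by apply: (gr_pr_out gA H); rewrite eq_sym.
Qed.

(** The square is a graded subspace, because the homogeneous components of a product are sums of
    products. *)
Lemma pr_square w v : v \in square -> pr w v \in square.
Proof.
move=> /squareP; apply: (@lspan_sub R A _ (fun v => pr w v \in square))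
  => [|c u u' Hu Hu'|_ [a ->]].
- by rewrite pr0 mem0v.
- by rewrite prD prZ memvD // memvZ.
- have : size (codom a) = 2%N by rewrite size_codom card_ord.
  case: (codom a) => [|x [|y [|]]] //= _; rewrite pr_mul.
  by apply: memv_suml => i _; apply: memv_suml => j _; exact: mem_square.
Qed.

(** [G i.+1 :\: square] is a complement of the decomposable elements within weight [i.+1]; its basis
    lifts a basis of the part of weight [i.+1] of [Ehat]. *)
Definition gdim (i : 'I_k) : nat := \dim (G i.+1 :\: square).

Definition gen_elt (p : {i : 'I_k & 'I_(gdim i)}) : A :=
  (vbasis (G (tag p).+1 :\: square)%VS)`_(tagged p).

Definition gen (a : 'I_(\sum_i gdim i)) : A := gen_elt (tagnat.sig a).

Lemma gen_elt_in p : gen_elt p \in (G (tag p).+1 :\: square)%VS.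
Proof. by apply: vbasis_mem; rewrite mem_nth // size_tuple. Qed.

Lemma gen_in a : gen a \in G (dwt a).
Proof. exact: (subvP (diffvSl _ _) _ (gen_elt_in (tagnat.sig a))). Qed.

Lemma gen_decomp (v : A) : exists c : 'I_(\sum_i gdim i) -> R,
  v - \sum_a c a *: gen a \in square.
Proof.
have H (i : 'I_k) : exists c : 'I_(gdim i) -> R,
    pr i.+1 v - \sum_j c j *: gen_elt (Tagged (fun i => 'I_(gdim i)) j) \in square.
  have := gr_pr_in gA i.+1 v; rewrite -{1}(addv_diff_cap (G i.+1) square).
  move=> /memv_addP [u uC [u' u'C ->]].
  exists (fun j => coord (vbasis (G i.+1 :\: square)) j u).
  rewrite {1}(coord_vbasis uC) addrAC subrr add0r.
  by move: u'C; rewrite memv_cap => /andP[].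
have {H} [c Hc] : exists c : forall i, 'I_(gdim i) -> R, forall i : 'I_k,
    pr i.+1 v - \sum_j c i j *: gen_elt (Tagged (fun i => 'I_(gdim i)) j) \in square.
  by exists (fun i => sval (cid (H i))) => i; case: cid.
exists (fun a => c (tag (tagnat.sig a)) (tagged (tagnat.sig a))).
rewrite (big_tagnat _ (fun p => c (tag p) (tagged p) *: gen_elt p)) /=.
rewrite {1}(gr_pr_sum gA v) -sumrB; apply: memv_suml => i _; exact: Hc.
Qed.

Lemma gen_indep (c : 'I_(\sum_i gdim i) -> R) :
  \sum_a c a *: gen a \in square -> forall a, c a = 0.
Proof.
move=> H; pose C (p : {i : 'I_k & 'I_(gdim i)}) := c (tagnat.rank p).
have CE a : c a = C (tagnat.sig a) by rewrite /C tagnat.sigK.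
have {}H : \sum_(i < k) \sum_(j < gdim i) C (Tagged (fun i => 'I_(gdim i)) j) *: gen_elt (Tagged (fun i => 'I_(gdim i)) j) \in square.
  rewrite -(big_tagnat _ (fun p => C p *: gen_elt p)) /=.
  have <- // : \sum_a c a *: gen a = \sum_a C (tagnat.sig a) *: gen_elt (tagnat.sig a).
  by apply: eq_bigr => a _; rewrite CE.
suff K i j : C (Tagged (fun i => 'I_(gdim i)) (j : 'I_(gdim i))) = 0.
  by move=> a; rewrite CE; case: (tagnat.sig a).
(* The component of weight [i.+1] lies both in the square and in the complement chosen in that
   weight. *)
have := pr_square i.+1 H; rewrite pr_sum (bigD1 i) //= [X in _ + X]big1 ?addr0; last first.
  move=> l li; rewrite pr_sum big1 // => m _; rewrite prZ.
  rewrite (gr_pr_out gA (w := l.+1)) ?scaler0 //; last by rewrite eqSS eq_sym.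
  exact: (subvP (diffvSl _ _) _ (gen_elt_in (Tagged (fun i => 'I_(gdim i)) m))).
rewrite pr_sum; set x := \sum_l _ => xS.
have xE : x = \sum_(l < gdim i) C (Tagged (fun i => 'I_(gdim i)) l) *: (vbasis (G i.+1 :\: square)%VS)`_l.
  apply: eq_bigr => l _; rewrite prZ (gr_pr_id gA) //.
  exact: (subvP (diffvSl _ _) _ (gen_elt_in (Tagged (fun i => 'I_(gdim i)) l))).
have xC : x \in (G i.+1 :\: square)%VS.
  rewrite xE; apply: memv_suml => l _; apply: memvZ.
  by apply: vbasis_mem; rewrite mem_nth // size_tuple.
have : x \in ((G i.+1 :\: square) :&: square)%VS by rewrite memv_cap xC.
rewrite capv_diff memv0 xE => /eqP x0.
exact: (freeP (basis_free (vbasisP (G i.+1 :\: square))) _ x0 j).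
Qed.

End FreeExists.

(** * Lifts of a basis of [Ehat] are free generators *)

Section FreeFromGenerators.
Variables (R : realType) (k : nat) (A : nalg R) (G : nat -> {vspace A}).
Variable pr : nat -> A -> A.
Hypothesis gA : is_graded_alg k G pr.
Local Notation mu := (@nalg_mul R A).
Variables (n : nat) (wgt : 'I_n -> nat) (e : 'I_n -> A).
Hypotheses (wgt_gt0 : forall a, (0 < wgt a)%N) (eG : forall a, e a \in G (wgt a)).
Hypothesis e_decomp : forall v : A, exists c : 'I_n -> R,
  v - \sum_a c a *: e a \in square A.
Hypothesis e_indep : forall c : 'I_n -> R,
  \sum_a c a *: e a \in square A -> forall a, c a = 0.

Local Notation mon := (monomial k wgt).
Local Notation em := (fun al : mon => emono e (mexpo al)).

Definition in_monomials (v : A) : Prop := exists c : mon -> R, v = \sum_al c al *: em al.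

Lemma in_monomials0 : in_monomials 0.
Proof. by exists (fun=> 0); rewrite big1 // => al _; rewrite scale0r. Qed.

Lemma in_monomialsL c u v : in_monomials u -> in_monomials v -> in_monomials (c *: u + v).
Proof.
move=> [cu ->] [cv ->]; exists (fun al => c * cu al + cv al).
rewrite scaler_sumr -big_split; apply: eq_bigr => al _ /=.
by rewrite scalerDl scalerA.
Qed.

Lemma in_monomials_sum (I : Type) (s : seq I) (P : pred I) (c : I -> R) (F : I -> A) :
  (forall i, P i -> in_monomials (F i)) -> in_monomials (\sum_(i <- s | P i) c i *: F i).
Proof.
move=> H; elim/big_rec : _ => [|i v Pi Hv]; first exact: in_monomials0.
by apply: in_monomialsL => //; exact: H.
Qed.

Lemma in_monomials_sum1 (I : Type) (s : seq I) (P : pred I) (F : I -> A) :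
  (forall i, P i -> in_monomials (F i)) -> in_monomials (\sum_(i <- s | P i) F i).
Proof.
by move=> H; under eq_bigr do rewrite -[F _]scale1r; exact: in_monomials_sum.
Qed.

Lemma in_monomials_emono b : (0 < mweight wgt b)%N -> in_monomials (emono e b).
Proof.
move=> b0; have [bk|kb] := leqP (mweight wgt b) k; last first.
  rewrite (emono_out gA wgt_gt0 eG) //; exact: in_monomials0.
have [al Hal] := monomialP (k := k) wgt_gt0 (e := b) (introT andP (conj b0 bk)).
exists (fun be => (be == al)%:R); rewrite (bigD1 al) //= eqxx scale1r.
rewrite [X in _ + X]big1 ?addr0; first exact/esym/eq_emono.
by move=> be /negbTE ->; rewrite scale0r.
Qed.

Lemma in_monomialsM u v : in_monomials u -> in_monomials v -> in_monomials (mu u v).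
Proof.
move=> [cu ->] [cv ->]; rewrite nalg_mul_suml; apply: in_monomials_sum1 => al _.
rewrite nalg_mulZl nalg_mul_sumr -[_ *: _]addr0; apply: in_monomialsL; last exact: in_monomials0.
apply: in_monomials_sum1 => be _; rewrite nalg_mulZr -[_ *: _]addr0.
apply: in_monomialsL; last exact: in_monomials0.
have W (ga : mon) : (0 < mweight wgt (mexpo ga))%N by have /andP[] := mexpo_weight ga.
rewrite (emonoM gA wgt_gt0 eG) //; apply: in_monomials_emono.
by rewrite mweightD addn_gt0 W.
Qed.

(** Strong induction on the weight: modulo a combination of generators a homogeneous element is a
    sum of products, whose factors have smaller weight because all weights are positive. *)
Lemma monomials_span v : in_monomials v.
Proof.
suff H w u : u \in G w -> in_monomials u.
  by rewrite (gr_pr_sum gA v); apply: in_monomials_sum1 => i _; exact: H (gr_pr_in gA _ _).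
elim/ltn_ind: w u => w IH u uG.
have [c cS] := e_decomp u; set s := \sum_a _ in cS.
have -> : u = 1 *: pr w s + pr w (u - s).
  by rewrite scale1r -(prD gA) addrC subrK (gr_pr_id gA uG).
have psM : in_monomials (pr w s).
  rewrite (pr_sum gA); apply: in_monomials_sum1 => a _; rewrite (prZ gA).
  rewrite -[_ *: _]addr0; apply: in_monomialsL; last exact: in_monomials0.
  have [<-|ne] := eqVneq (wgt a) w.
    rewrite (gr_pr_id gA (eG a)) -[e a](emono_single e).
    by apply: in_monomials_emono; rewrite mweight_single.
  rewrite (gr_pr_out gA (eG a)) 1?eq_sym //; exact: in_monomials0.
have qM : in_monomials (pr w (u - s)).
  move/squareP: cS; apply: (@lspan_sub R A _ (fun v => in_monomials (pr w v))) => [|b x y Hx Hy|_ [a ->]].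
  - rewrite (pr0 gA); exact: in_monomials0.
  - by rewrite (prD gA) (prZ gA); exact: in_monomialsL.
  - have : size (codom a) = 2%N by rewrite size_codom card_ord.
    case: (codom a) => [|x [|y [|]]] //= _; rewrite (pr_mul gA).
    apply: in_monomials_sum1 => i _; apply: in_monomials_sum1 => j /eqP ij.
    apply: in_monomialsM; [apply: (IH i.+1)|apply: (IH j.+1)]; try exact: (gr_pr_in gA).
      by rewrite -ij -addSnnS ltn_addr.
    by rewrite -ij addSn ltnS leq_addl.
exact: in_monomialsL.
Qed.

Hypothesis inj : forall j, (2 <= j <= k)%N -> induced_injective k G mu j.

(* Induction on the degree [j]: modulo the products of [j.+1] elements, a
   relation between monomials of degree at least [j] is the image by m^j of an
   element of weight at most [k] of the symmetric power. *)
Lemma monomials_indep (c : mon -> R) :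
  \sum_al c al *: em al = 0 -> forall al, c al = 0.
Proof.
move=> c0; suff H j al : mdeg (mexpo al) = j -> c al = 0 by move=> al; exact: (H (mdeg (mexpo al))).
elim/ltn_ind: j al => j IH al0 dj0.
have W (ga : mon) : (0 < mweight wgt (mexpo ga) <= k)%N by exact: mexpo_weight.
have j0 : (0 < j)%N by rewrite -dj0 (mdeg_gt0 (wgt := wgt)) //; have /andP[] := W al0.
have jk : (j <= k)%N.
  by rewrite -dj0; apply: leq_trans (mdeg_le_mweight wgt_gt0 _) _; have /andP[] := W al0.
pose Pj := [pred al : mon | mdeg (mexpo al) == j].
pose T : finType := {al : mon | al \in Pj}.
(* The part of degree exactly [j] of the relation. The coefficients of lower degree are zero by
   induction, so [D] is the opposite of the part of higher degree. *)
pose D := \sum_(t : T) c (val t) *: em (val t).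
have DS : power_span mu j.+1 D.
  have E : D + \sum_(al : mon | (j < mdeg (mexpo al))%N) c al *: em al = 0.
    rewrite -[RHS]c0 [RHS](bigID (mem Pj)) /=.
    rewrite (big_sub Pj (fun al : mon => c al *: em al)); congr (_ + _).
    rewrite [RHS](bigID (fun al : mon => (j < mdeg (mexpo al))%N)) /=.
    rewrite [X in _ = _ + X]big1 ?addr0 => [|al /andP[]].
      by apply: eq_bigl => al; rewrite inE neq_ltn; case: ltngtP.
    by rewrite inE => /negbTE nj; rewrite -leqNgt leq_eqVlt nj /= => /IH -> //; rewrite scale0r.
  have -> : D = \sum_(al : mon | (j < mdeg (mexpo al))%N) (- c al) *: em al.
    under eq_bigr do rewrite scaleNr.
    by rewrite sumrN; apply/eqP; rewrite -addr_eq0; apply/eqP.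
  apply: lspan_sum => al jal.
  by apply: (emono_power_span gA wgt_gt0 eG).
have /boolp.choice [hw Hw] : forall t : T, exists h : 'I_j -> 'I_n,
    mcount h =1 mexpo (val t).
  by move=> [al /= /[!inE] /eqP <-]; exact: mcount_surj.
have al0P : al0 \in Pj by rewrite inE dj0.
pose t0 : T := exist _ al0 al0P.
(* In degree 1, where no injectivity is assumed, independence of the generators modulo the square
   takes its place. *)
have [j1|jN1] := eqVneq j 1%N.
  have gt (t : T) : exists a, mexpo (val t) =1 msingle a.
    by apply: mdeg_eq1; have := valP t; rewrite inE => /eqP ->.
  have [a0 Ha0] := gt t0.
  pose ct (a : 'I_n) : R := \sum_(t : T | mexpo (val t) a == 1%N) c (val t).
  have : \sum_a ct a *: e a \in square A.
    apply/squareP; rewrite -[2%N]/(1.+1) -j1.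
    suff -> : \sum_a ct a *: e a = D by [].
    under eq_bigr do rewrite scaler_suml big_mkcond.
    rewrite exchange_big /=; apply: eq_bigr => t _.
    have [a Ha] := gt t; rewrite (bigD1 a) //= Ha /msingle eqxx /=.
    rewrite [X in _ + X]big1 ?addr0; last first.
      by move=> b /negbTE ba; rewrite Ha /msingle ba.
    by rewrite (eq_emono e Ha) emono_single.
  move=> /e_indep /(_ a0); rewrite /ct (bigD1 t0) /=; last by rewrite Ha0 /msingle eqxx.
  rewrite [X in _ + X]big1 ?addr0 // => t /andP[ta tt0].
  have [a Ha] := gt t; case/eqP: tt0; apply/val_inj/mexpo_inj => b /=.
  by move: ta; rewrite Ha Ha0 /msingle; case: (a0 =P a) => [->|].
have j2 : (2 <= j <= k)%N by rewrite jk andbT ltn_neqAle eq_sym jN1.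
have [Ehat [Q [S [p [q [sigma [mj [[psurj pker] [qsurj qker] [[sm ss] su] Emj Hinj]]]]]]]] := inj j2.
have [Y [YE YK YL]] : exists Y : Ehat -> 'I_n -> R,
    [/\ forall v, v = \sum_t Y v t *: p (e t),
        forall c t, Y (\sum_t c t *: p (e t)) t = c t
      & forall a u v t, Y (a *: u + v) t = a * Y u t + Y v t].
  apply: coordinates_exist.
    move=> z; have [v <-] := psurj z; have [cc Hcc] := e_decomp v.
    exists cc; move/squareP/pker: Hcc; rewrite linearB linear_sum => /eqP.
    by rewrite subr_eq0 => /eqP ->; apply: eq_bigr => a _; rewrite linearZ.
  move=> cc E; apply: e_indep; apply/squareP/pker; rewrite linear_sum -[RHS]E.
  by apply: eq_bigr => a _; rewrite linearZ.
pose y (v : Ehat) : 'rV[R]_n := \row_a Y v a.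
have yL b u v : y (b *: u + v) = b *: y u + y v.
  by apply/rowP => a; rewrite !mxE YL.
have yp a : y (p (e a)) = delta_mx 0 a.
  apply/rowP => b; rewrite !mxE eqxx /=.
  rewrite -[RHS](YK (fun b => (b == a)%:R) b); congr (Y _ b).
  by rewrite (bigD1 a) //= eqxx scale1r [X in _ + X]big1 ?addr0 // => b' /negbTE ->; rewrite scale0r.
(* The symmetric form that reads the coefficient of the monomial [t0]. By the universal property it
   factors through a linear form on [S], which takes the value [c al0] at [z]. *)
pose f (x : {ffun 'I_j -> Ehat}) : R^o := symprod [ffun i => y (x i)] (msof (finfun (hw t0))).
have fs : symmetric_multilinear f.
  split.
    move=> a i b u v; rewrite /f.
    have E w : [ffun l => y (ffupd a i w l)] = ffupd [ffun l => y (a l)] i (y w).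
      by apply/ffunP => l; rewrite !ffunE; case: eqP.
    by rewrite !E yL symprod_multilinear !ffunE.
  move=> a s; rewrite /f -(symprod_sym [ffun i => y (a i)] s).
  by congr (symprod _ _); apply/ffunP => i; rewrite !ffunE.
have [g [Hg _]] := su _ f fs.
pose bw (t : T) : {ffun 'I_j -> A} := [ffun i => e (hw t i)].
pose z := \sum_(t : T) c (val t) *: sigma [ffun i => p (bw t i)].
have emE (t : T) : iter_prod mu (codom (bw t)) = em (val t).
  apply: uin_inj; rewrite iter_prod_codom //.
  rewrite (uin_emono gA wgt_gt0 eG); last by have /andP[] := W (val t).
  rewrite -(eq_emonoU e (Hw t)) emonoU_count; apply: eq_bigr => i _.
  by rewrite ffunE.
have z0 : z = 0.
  apply: Hinj.
    apply: lspan_sum => t _; apply: lspan_in; exists (bw t), (fun i => wgt (hw t i)); split => //.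
      by move=> i; rewrite ffunE; exact: eG.
    rewrite -mweight_count (eq_mweight _ (Hw t)).
    by have /andP[] := W (val t).
  rewrite /z linear_sum (eq_bigr (fun t => q (c (val t) *: em (val t)))).
    by rewrite -linear_sum; apply/qker.
  have qZ b v : q (b *: v) = b *: q v by exact: linearZ_LR.
  have mjZ b v : mj (b *: v) = b *: mj v by exact: linearZ_LR.
  by move=> t _; rewrite qZ -emE -Emj -mjZ.
have : g z = c al0.
  have gZ b v : g (b *: v) = b *: g v by exact: linearZ_LR.
  rewrite /z linear_sum (bigD1 t0) //= gZ Hg /f.
  have fE (t : T) : symprod [ffun i => y ([ffun i => p (bw t i)] i)] = symprod (basis_word R (finfun (hw t))).
    by congr symprod; apply/ffunP => i; rewrite !ffunE yp.
  rewrite fE symprod_basis eqxx [X in _ + X]big1 ?addr0; first by rewrite /GRing.scale /= mulr1.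
  move=> t tt0; rewrite gZ Hg /f fE symprod_basis.
  case: eqVneq => [E|_]; last by rewrite scaler0.
  case/eqP: tt0; apply/val_inj/mexpo_inj => b; rewrite -Hw -Hw.
  have /(congr1 val) /= /eq_word_type/(_ b) := E.
  by rewrite /mcount; under eq_bigr do rewrite ffunE; under [RHS]eq_bigr do rewrite ffunE.
by rewrite z0 linear0.
Qed.

End FreeFromGenerators.

Lemma free_gens_exist (R : realType) (k : nat) (A : nalg R) (G : nat -> {vspace A})
    (pr : nat -> A -> A) :
  is_graded_alg k G pr ->
  (forall j, (2 <= j <= k)%N -> induced_injective k G (nalg_mul A) j) ->
  exists (d : 'I_k -> nat) (e : 'I_(\sum_i d i) -> A),
    (forall a, e a \in G (dwt a)) /\ free_gens k (dwt (d := d)) e.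
Proof.
move=> gA inj; exists (gdim G), (@gen _ _ _ G); split; first exact: gen_in.
split.
  apply: (monomials_span gA (dwt_gt0 (d := _)) (@gen_in _ _ _ G)).
  exact: (gen_decomp gA).
apply: (monomials_indep gA (dwt_gt0 (d := _)) (@gen_in _ _ _ G) (gen_decomp gA) (gen_indep gA) inj).
Qed.

(** * Dimensions of the graded pieces and numbers of generators *)

Lemma dim_of_basis (R : realType) (V : vectType R) (U : {vspace V}) (T : finType)
    (b : T -> V) :
  (forall t, b t \in U) ->
  (forall v, v \in U -> exists c : T -> R, v = \sum_t c t *: b t) ->
  (forall c : T -> R, \sum_t c t *: b t = 0 -> forall t, c t = 0) ->
  \dim U = #|T|.
Proof.
move=> bU sb ib; pose X := [tuple b (enum_val i) | i < #|T|].
have XE (i : 'I_#|T|) : X`_i = b (enum_val i) by rewrite -tnth_nth tnth_mktuple.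
apply: (size_basis (X := X)); rewrite basisEdim size_tuple; apply/andP; split.
  apply/subvP => v /sb [c ->]; apply: memv_suml => t _; apply: memvZ; apply: memv_span.
  by apply/tnthP; exists (enum_rank t); rewrite tnth_mktuple enum_rankK.
have fX : free X.
  apply/freeP => c Hc i; have := ib (fun t => c (enum_rank t)) _ (enum_val i).
  rewrite enum_valK; apply; rewrite -[RHS]Hc.
  rewrite (reindex (@enum_val T T)) /=; last first.
    by apply: onW_bij; apply: enum_val_bij.
  by apply: eq_bigr => l _; rewrite XE enum_valK.
have := fX; rewrite /free size_tuple => /eqP <-; apply: dimvS.
by apply/span_subvP => v /tnthP [i ->]; rewrite tnth_mktuple.
Qed.

Definition weight_monomial k n (wgt : 'I_n -> nat) (w : nat) : finType :=
  {al : monomial k wgt | mweight wgt (mexpo al) == w}.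

Lemma dim_graded_piece (R : realType) (k : nat) (A : nalg R) (G : nat -> {vspace A})
    (pr : nat -> A -> A) n (wgt : 'I_n -> nat) (e : 'I_n -> A) w :
  is_graded_alg k G pr -> (forall a, (0 < wgt a)%N) ->
  (forall a, e a \in G (wgt a)) -> free_gens k wgt e ->
  \dim (G w) = #|weight_monomial k wgt w|.
Proof.
move=> gA w0 eG [sp ind].
have [X [XE XK XL]] := coordinates_exist sp ind.
pose P := [pred al : monomial k wgt | mweight wgt (mexpo al) == w].
apply: (dim_of_basis (b := fun t : weight_monomial k wgt w => emono e (mexpo (val t)))).
- by move=> [al /= /eqP <-]; apply: (monomial_in gA w0 eG).
- move=> v vG; exists (fun t => X v (val t)).
  rewrite {1}(XE v) (bigID (mem P)) /= [X in _ + X]big1 ?addr0.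
    by rewrite (big_sub P (fun al => X v al *: emono e (mexpo al))).
  move=> al; rewrite inE => nw.
  by rewrite (coef_homogeneous gA w0 eG XE XK vG nw) scale0r.
- move=> c c0 t.
  pose c' (al : monomial k wgt) := if insub al is Some t then c (t : weight_monomial k wgt w) else 0.
  have c'E (u : weight_monomial k wgt w) : c' (val u) = c u by rewrite /c' valK.
  rewrite -c'E; apply: ind; rewrite (bigID (mem P)) /= [X in _ + X]big1 ?addr0.
    rewrite (big_sub P (fun al => c' al *: emono e (mexpo al))) -[RHS]c0.
    by apply: eq_bigr => u _; rewrite -c'E.
  by move=> al /= nP; rewrite /c' insubN ?scale0r.
Qed.

(* If d <= d' up to index i and d i < d' i, transporting exponents gives an
   injection of the monomials of weight i + 1 that misses a generator. *)
Lemma card_weight_monomial_neq k (d d' : 'I_k -> nat) (i : 'I_k) :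
  (forall l : 'I_k, (l < i)%N -> d l = d' l) -> (d i < d' i)%N ->
  #|weight_monomial k (dwt (d := d)) i.+1| <> #|weight_monomial k (dwt (d := d')) i.+1|.
Proof.
move=> Hd di; pose T := weight_monomial k (dwt (d := d)) i.+1.
pose T' := weight_monomial k (dwt (d := d')) i.+1.
have ledd (l : 'I_k) : (l <= i)%N -> (d l <= d' l)%N.
  by rewrite leq_eqVlt => /orP[/eqP/val_inj ->|/Hd ->] //; exact: ltnW.
(* The exponent of the generator [j] of block [l], with default 0 when there is none, so that
   exponents for [d] can be read as exponents for [d']. *)
pose an (al : T) (l : 'I_k) (j : nat) : nat :=
  if insub j is Some j' then mexpo (val al) (tagnat.Rank l (j' : 'I_(d l))) else 0%N.
have anE al l (j : 'I_(d l)) : an al l j = mexpo (val al) (tagnat.Rank l j).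
  by rewrite /an valK.
have an_out al l j : (d l <= j)%N -> an al l j = 0%N.
  by move=> dj; rewrite /an insubN // -leqNgt.
have wsum (dd : 'I_k -> nat) (f : 'I_(\sum_i dd i) -> nat) :
    mweight (dwt (d := dd)) f = (\sum_l \sum_(j < dd l) l.+1 * f (tagnat.Rank l j))%N.
  rewrite /mweight -(big_tagnat addn (fun p => (tag p).+1 * f (tagnat.Rank (tag p) (tagged p)))%N).
  apply: eq_bigr => a _ /=; congr (_ * f _)%N; exact/esym/tagnat.sig2K.
have wal (al : T) : mweight (dwt (d := d)) (mexpo (val al)) = i.+1 by exact/eqP/(valP al).
have an_big al (l : 'I_k) j : (i < l)%N -> an al l j = 0%N.
  move=> il; have [dj|jd] := leqP (d l) j; first exact: an_out.
  rewrite (anE al l (Ordinal jd)); apply/eqP; apply: contraTT il => nz.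
  rewrite -leqNgt -ltnS -(wal al) wsum (bigD1 l) //= (bigD1 (Ordinal jd)) //=.
  have h : (l.+1 <= l.+1 * mexpo (val al) (tagnat.Rank l (Ordinal jd)))%N.
    by rewrite leq_pmulr // lt0n.
  by apply: leq_trans h _; rewrite -addnA; exact: leq_addr.
pose f0 (al : T) (a : 'I_(\sum_i d' i)) : nat := an al (tagnat.sig1 a) (tagnat.sig2 a).
have f0R al l (j : 'I_(d' l)) : f0 al (tagnat.Rank l j) = an al l j.
  have E : nat_of_ord (tagnat.sig2 (tagnat.Rank l j)) = j by rewrite tagnat.Rank2K.
  by rewrite /f0 E tagnat.Rank1K.
have wf0 al : mweight (dwt (d := d')) (f0 al) = i.+1.
  rewrite -(wal al) !wsum; apply: eq_bigr => l _.
  transitivity (\sum_(j < d' l) l.+1 * an al l j)%N.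
    by apply: eq_bigr => j _; rewrite f0R.
  transitivity (\sum_(j < d l) l.+1 * an al l j)%N; last first.
    by apply: eq_bigr => j _; rewrite anE.
  have [li|il] := leqP l i; last first.
    by rewrite !big1 // => j _; rewrite an_big // muln0.
  rewrite (big_ord_widen (d' l) (fun j => l.+1 * an al l j)%N (ledd l li)).
  rewrite [RHS]big_mkcond; apply: eq_bigr => j _; case: ltnP => // /an_out ->.
  by rewrite muln0.
have /boolp.choice [f1 Hf1] : forall al : T, exists be : monomial k (dwt (d := d')),
    mexpo be =1 f0 al.
  by move=> al; apply: (monomialP (dwt_gt0 (d := d'))); rewrite wf0 /=; exact: ltn_ord.
have f1P al : mweight (dwt (d := d')) (mexpo (f1 al)) == i.+1.
  by rewrite (eq_mweight _ (Hf1 al)) wf0.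
pose f (al : T) : T' := exist _ (f1 al) (f1P al).
have fI : injective f.
  move=> al be /(congr1 val) /= E; apply/val_inj/mexpo_inj => a.
  rewrite -(tagnat.sig2K a) -!anE; set l := tagnat.sig1 a; set j := tagnat.sig2 a.
  have [li|il] := leqP l i; last by rewrite !an_big.
  have jd : (j < d' l)%N by exact: leq_trans (ltn_ord j) (ledd l li).
  by rewrite -(f0R al l (Ordinal jd)) -(f0R be l (Ordinal jd)) -!Hf1 E.
(* The generator number [d i] of block [i] exists for [d'] only: transported exponents are 0 there,
   so the monomial consisting of it alone is not in the image. *)
move=> cTT; pose b0 := tagnat.Rank i (Ordinal di).
have wb0 : dwt b0 = i.+1 by rewrite /dwt tagnat.Rank1K.
have [ga Hga] : exists ga : monomial k (dwt (d := d')), mexpo ga =1 msingle b0.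
  by apply: (monomialP (dwt_gt0 (d := d'))); rewrite mweight_single wb0; exact: ltn_ord.
have gaP : mweight (dwt (d := d')) (mexpo ga) == i.+1.
  by rewrite (eq_mweight _ Hga) mweight_single wb0.
have : (exist _ ga gaP : T') \in codom f by apply: inj_card_onto => //; rewrite cTT.
move=> /codomP [al /(congr1 val) /= E].
have := Hga b0; rewrite E Hf1 f0R an_out // /msingle eqxx.
by [].
Qed.

(** Triangularity: monomials of weight [i.+1] only involve the blocks up to [i], so the first block
    where [d] and [d'] differ is detected by the count in its own weight. *)
Lemma weight_monomial_rank_inj k (d d' : 'I_k -> nat) :
  (forall i : 'I_k, #|weight_monomial k (dwt (d := d)) i.+1| =
                    #|weight_monomial k (dwt (d := d')) i.+1|) -> d = d'.
Proof.
move=> H; apply/funext => i; elim/ltn_ind: {i}(nat_of_ord i) {-2}i (erefl (nat_of_ord i)) => m IH i im.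
have Hd (l : 'I_k) : (l < i)%N -> d l = d' l by move=> li; apply: (IH l) => //; rewrite -im.
have [lt|lt|//] := ltngtP (d i) (d' i).
  by case: (card_weight_monomial_neq Hd lt).
by case: (card_weight_monomial_neq (fun l li => esym (Hd l li)) lt).
Qed.

(** * Smooth families of matrices *)

Section MatrixSmooth.
Variables (R : realType) (M : chartedSpace R) (pM : is_premanifold M) (x : M).

Lemma rsmooth_at_det n (A : M -> 'M[R]_n) :
  (forall i j, rsmooth_at x (fun z => A z i j)) -> rsmooth_at x (fun z => \det (A z)).
Proof.
move=> sA; rewrite /determinant; apply: (rsmooth_at_sum pM) => s _.
apply: (rsmooth_atM pM); first exact: rsmooth_at_cst.
by apply: (rsmooth_at_prod pM).
Qed.

Lemma rsmooth_at_adj n (A : M -> 'M[R]_n) i j :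
  (forall i j, rsmooth_at x (fun z => A z i j)) -> rsmooth_at x (fun z => (\adj (A z)) i j).
Proof.
move=> sA; under eq_fun do rewrite mxE /cofactor.
apply: (rsmooth_atM pM); first exact: rsmooth_at_cst.
apply: rsmooth_at_det => a b; under eq_fun do rewrite !mxE.
exact: sA.
Qed.

Lemma det_near n (A : M -> 'M[R]_n) : (forall i j, rsmooth_at x (fun z => A z i j)) ->
  \det (A x) != 0 -> \forall z \near x, \det (A z) != 0.
Proof.
move=> sA d0; have := rsmooth_at_continuous pM (rsmooth_at_det sA).
have O0 : open [set t : R | t != 0] by exact: open_neq.
by move=> /(_ _ (open_nbhs_nbhs (conj O0 d0))); rewrite nbhs_simpl.
Qed.

Lemma rsmooth_at_inv n (A : M -> 'M[R]_n) i j :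
  (forall i j, rsmooth_at x (fun z => A z i j)) -> \det (A x) != 0 ->
  rsmooth_at x (fun z => (invmx (A z)) i j).
Proof.
move=> sA d0; apply: (@rsmooth_at_near _ _ _ (fun z => (\det (A z))^-1 * (\adj (A z)) i j)).
  apply: filterS (det_near sA d0) => z dz.
  by rewrite /invmx unitmxE unitfE dz [RHS]mxE.
apply: (rsmooth_atM pM); last exact: rsmooth_at_adj.
by apply: (rsmooth_atV pM) => //; exact: rsmooth_at_det.
Qed.

(** Near [x] the solution is [v z *m invmx (A z)]. The equality [m = n] is a hypothesis because it
    is meant for the number of elements of a frame and the rank of a bundle, which are equal without
    being convertible. *)
Lemma rsmooth_at_solve m n (A : M -> 'M[R]_(m, n)) (c : M -> 'rV[R]_m) (v : M -> 'rV[R]_n) i :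
  m = n -> row_free (A x) ->
  (forall i j, rsmooth_at x (fun z => A z i j)) ->
  (forall j, rsmooth_at x (fun z => v z 0 j)) ->
  (\forall z \near x, v z = c z *m A z) -> rsmooth_at x (fun z => c z 0 i).
Proof.
move=> mn; subst n => fA sA sv cA.
have d0 : \det (A x) != 0 by rewrite -unitfE -unitmxE -row_free_unit.
apply: (@rsmooth_at_near _ _ _ (fun z => (v z *m invmx (A z)) 0 i)).
  near=> z; have -> : v z = c z *m A z by near: z.
  rewrite mulmxK // unitmxE unitfE; near: z; exact: det_near.
under eq_fun do rewrite mxE; apply: (rsmooth_at_sum pM) => j _.
by apply: (rsmooth_atM pM) => //; exact: rsmooth_at_inv.
Unshelve. all: by end_near.
Qed.

Lemma row_free_near m n (A : M -> 'M[R]_(m, n)) :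
  m = n -> row_free (A x) -> (forall i j, rsmooth_at x (fun z => A z i j)) ->
  \forall z \near x, row_free (A z).
Proof.
move=> mn; subst n => fA sA.
have d0 : \det (A x) != 0 by rewrite -unitfE -unitmxE -row_free_unit.
by apply: filterS (det_near sA d0) => z dz; rewrite row_free_unit unitmxE unitfE.
Qed.

End MatrixSmooth.

(** * Smooth sections *)

Section Sections.
Variables (R : realType) (M : manifold R) (k : nat) (E : gradedVectorBundle M k).
Let pM : is_premanifold M := manifold_premanifold (mfd_axioms M).
Local Notation N := (\sum_i gv_rank E i)%N.

Lemma triv_invK (phi : trivialization E N) x u :
  gv_atlas E phi -> triv_dom phi x -> phi x ((phi x)^-1%VF u) = u.
Proof.
move=> Ap px; have [g gK Kg] := gv_bij Ap px.
by rewrite -[RHS](Kg u) -{1}(Kg u) lker0_lfunK //; apply/lker0P; exact: can_inj gK.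
Qed.

Lemma triv_Kinv (phi : trivialization E N) x v :
  gv_atlas E phi -> triv_dom phi x -> (phi x)^-1%VF (phi x v) = v.
Proof.
move=> Ap px; have [g gK _] := gv_bij Ap px.
by rewrite lker0_lfunK //; apply/lker0P; exact: can_inj gK.
Qed.

Lemma gv_gradeP (phi : trivialization E N) x w v : gv_atlas E phi -> triv_dom phi x ->
  v \in gv_grade E x w <-> forall b, dwt b != w -> phi x v 0 b = 0.
Proof.
move=> Ap px; rewrite (gv_trivP Ap px); split=> H.
  move=> b nb; have /matrixP/(_ 0 (tagnat.sig2 b)) := H (tagnat.sig1 b) nb.
  by rewrite !mxE tagnat.sig2K.
move=> i ni; apply/matrixP => u j; rewrite !mxE !ord1; apply: H.
by rewrite /dwt tagnat.Rank1K.
Qed.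

Definition ssmooth_at (x : M) (s : forall x, E x) : Prop :=
  exists phi : trivialization E N, [/\ gv_atlas E phi, triv_dom phi x
    & forall b, rsmooth_at x (fun z => phi z (s z) 0 b)].

(** Transition maps are known to be smooth for each fixed vector [u]; the components of [s] are
    therefore expanded over the standard basis. *)
Lemma ssmooth_at_triv x s (psi : trivialization E N) :
  ssmooth_at x s -> gv_atlas E psi -> triv_dom psi x ->
  forall b, rsmooth_at x (fun z => psi z (s z) 0 b).
Proof.
move=> [phi [Ap px ss]] As sx b.
have near_dom (chi : trivialization E N) : gv_atlas E chi -> triv_dom chi x ->
    \forall z \near x, triv_dom chi z.
  by move=> Ac cx; apply: open_nbhs_nbhs; split => //; exact: gv_open Ac.
have tr u a : rsmooth_at x (fun z => psi z ((phi z)^-1%VF u) 0 a).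
  have O : open (triv_dom phi `&` triv_dom psi) by apply: openI; exact: gv_open.
  have /(smooth_onP _ pM (euclidean_premanifold R N) O)/(_ x (conj px sx)) := gv_transition Ap As u.
  by move/(smooth_at_euclidean _ _ pM); exact.
apply: (@rsmooth_at_near _ _ _
  (fun z => \sum_a phi z (s z) 0 a * psi z ((phi z)^-1%VF (delta_mx 0 a)) 0 b)).
  apply: filterS (near_dom _ Ap px) => z pz.
  rewrite -[in RHS](triv_Kinv (s z) Ap pz) {2}(row_sum_delta (phi z (s z))).
  rewrite !linear_sum summxE; apply: eq_bigr => a _.
  by rewrite !linearZ mxE.
by apply: (rsmooth_at_sum pM) => a _; exact: rsmooth_atM.
Qed.

Lemma smooth_sectionP s : smooth_section s <-> forall x, ssmooth_at x s.
Proof.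
split=> H.
  move=> x; have [phi Ap px] := gv_cover E x; exists phi; split => //.
  have /(smooth_onP _ pM (euclidean_premanifold R N) (gv_open Ap))/(_ x px) := H phi Ap.
  by move/(smooth_at_euclidean _ _ pM).
move=> phi Ap; apply/(smooth_onP _ pM (euclidean_premanifold R N) (gv_open Ap)) => x px.
by apply/(smooth_at_euclidean _ _ pM); exact: ssmooth_at_triv.
Qed.

Lemma ssmooth_at_near x (s s' : forall x, E x) :
  (\forall z \near x, s z = s' z) -> ssmooth_at x s -> ssmooth_at x s'.
Proof.
move=> ss' [phi [Ap px ss]]; exists phi; split => // b.
by apply: rsmooth_at_near (ss b); apply: filterS ss' => z ->.
Qed.

Lemma ssmooth_at0 x : ssmooth_at x (fun z => 0).
Proof.
have [phi Ap px] := gv_cover E x; exists phi; split => // b.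
by under eq_fun do rewrite linear0 mxE; exact: rsmooth_at_cst.
Qed.

Lemma ssmooth_atD x s s' : ssmooth_at x s -> ssmooth_at x s' ->
  ssmooth_at x (fun z => s z + s' z).
Proof.
move=> [phi [Ap px ss]] ss'; exists phi; split => // b.
under eq_fun do rewrite linearD mxE; apply: (rsmooth_atD pM) => //.
exact: ssmooth_at_triv.
Qed.

Lemma ssmooth_atZ x f s : rsmooth_at x f -> ssmooth_at x s ->
  ssmooth_at x (fun z => f z *: s z).
Proof.
move=> sf [phi [Ap px ss]]; exists phi; split => // b.
by under eq_fun do rewrite linearZ mxE; exact: (rsmooth_atM pM).
Qed.

Lemma ssmooth_at_sum x (I : finType) (P : pred I) (F : I -> forall x, E x) :
  (forall i, P i -> ssmooth_at x (F i)) -> ssmooth_at x (fun z => \sum_(i | P i) F i z).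
Proof.
move=> sF; have [phi Ap px] := gv_cover E x; exists phi; split => // b.
under eq_fun do rewrite linear_sum summxE; apply: (rsmooth_at_sum pM) => i Pi.
exact: ssmooth_at_triv (sF i Pi) Ap px b.
Qed.

Lemma ssmooth_at_const (phi : trivialization E N) x u : gv_atlas E phi -> triv_dom phi x ->
  ssmooth_at x (fun z => (phi z)^-1%VF u).
Proof.
move=> Ap px; exists phi; split => // b.
apply: (@rsmooth_at_near _ _ _ (fun=> u 0 b)); last exact: rsmooth_at_cst.
have : \forall z \near x, triv_dom phi z.
  by apply: open_nbhs_nbhs; split => //; exact: gv_open Ap.
by apply: filterS => z pz; rewrite triv_invK.
Qed.

Lemma dim_fibre x : \dim {:E x} = N.
Proof.
have [phi Ap px] := gv_cover E x; have [g gK Kg] := gv_bij Ap px.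
have k0 : lker (phi x) == 0%VS by apply/lker0P; exact: can_inj gK.
rewrite -(limg_dim_eq (f := phi x)); last by rewrite (eqP k0) capv0.
have -> : (phi x @: fullv)%VS = fullv.
  apply/vspaceP => u; rewrite memvf; apply/memv_imgP; exists (g u); rewrite ?memvf //.
by rewrite dimvf /dim /= mul1n.
Qed.

End Sections.

(** * The fibres of a product bundle as graded algebras *)

Section FibreAlgebra.
Variables (R : realType) (M : manifold R) (k : nat) (E : productBundle M k).
Let pM : is_premanifold M := manifold_premanifold (mfd_axioms M).
Local Notation N := (\sum_i gv_rank E i)%N.

Definition fibre_alg x : nalg R :=
  @Nalg R (E x) (pb_prod E x) ((pb_sym2 E).1 x) (@pb_assoc _ _ _ E x).

Definition fibre_triv x : trivialization E N := s2val (cid2 (gv_cover E x)).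

Lemma fibre_triv_atlas x : gv_atlas E (fibre_triv x).
Proof. exact: s2valP (cid2 (gv_cover E x)). Qed.

Lemma fibre_triv_dom x : triv_dom (fibre_triv x) x.
Proof. exact: s2valP' (cid2 (gv_cover E x)). Qed.

Definition block_row (w : nat) (u : 'rV[R]_N) : 'rV[R]_N :=
  \row_b (if dwt b == w then u 0 b else 0).

Definition fibre_pr x (w : nat) (v : E x) : E x :=
  (fibre_triv x x)^-1%VF (block_row w (fibre_triv x x v)).

Lemma fibre_graded x : @is_graded_alg R k (fibre_alg x) (gv_grade E x) (@fibre_pr x).
Proof.
have Ap := fibre_triv_atlas x; have px := fibre_triv_dom x.
have phiK u : fibre_triv x x ((fibre_triv x x)^-1%VF u) = u by exact: triv_invK.
split.
- move=> i j u v; exact: pb_graded.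
- move=> w c u v; rewrite /fibre_pr.
  have -> : block_row w (fibre_triv x x (c *: u + v)) =
    c *: block_row w (fibre_triv x x u) + block_row w (fibre_triv x x v).
    apply/rowP => b; rewrite !mxE linearP !mxE; case: ifP => // _.
    by rewrite mulr0 addr0.
  by rewrite linearP.
- move=> w v; apply/(gv_gradeP w _ Ap px) => b /negbTE nb.
  by rewrite phiK mxE nb.
- move=> w v /(gv_gradeP w _ Ap px) vw; rewrite -[RHS](triv_Kinv v Ap px) /fibre_pr.
  have -> // : block_row w (fibre_triv x x v) = fibre_triv x x v.
  by apply/rowP => b; rewrite mxE; case: eqVneq => // /vw ->.
- move=> w w' v /(gv_gradeP w _ Ap px) vw ww'; rewrite /fibre_pr.
  have -> : block_row w' (fibre_triv x x v) = 0.
    by apply/rowP => b; rewrite !mxE; case: eqP => // bw; apply: vw; rewrite bw.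
  by rewrite linear0.
- move=> v; rewrite -[LHS](triv_Kinv v Ap px) -linear_sum; congr (_ _).
  apply/rowP => b; rewrite summxE [RHS](bigD1 (tagnat.sig1 b)) //= mxE /dwt eqxx.
  rewrite [X in _ + X]big1 ?addr0 // => i ib; rewrite mxE eqSS.
  by case: eqP => // /val_inj E'; rewrite E' eqxx in ib.
Qed.

Lemma ssmooth_at_prod x (s s' : forall x, E x) :
  ssmooth_at x s -> ssmooth_at x s' -> ssmooth_at x (fun z => pb_prod E z (s z) (s' z)).
Proof.
move=> [phi [Ap px ss]] ss'; exists phi; split => // b.
have near_phi : \forall z \near x, triv_dom phi z.
  by apply: open_nbhs_nbhs; split => //; exact: gv_open Ap.
have sm u v a : rsmooth_at x
    (fun z => phi z (pb_prod E z ((phi z)^-1%VF u) ((phi z)^-1%VF v)) 0 a).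
  have /(smooth_onP _ pM (euclidean_premanifold R N) (gv_open Ap))/(_ x px) :=
    (pb_sym2 E).2 phi Ap u v.
  by move/(smooth_at_euclidean _ _ pM); exact.
apply: (@rsmooth_at_near _ _ _ (fun z => \sum_a \sum_c
   (phi z (s z) 0 a * phi z (s' z) 0 c) * phi z (pb_prod E z ((phi z)^-1%VF (delta_mx 0 a))
     ((phi z)^-1%VF (delta_mx 0 c))) 0 b)).
  apply: filterS near_phi => z pz.
  have dec v : v = \sum_a phi z v 0 a *: (phi z)^-1%VF (delta_mx 0 a) :> fibre_alg z.
    rewrite -{1}(triv_Kinv v Ap pz) {1}(row_sum_delta (phi z v)) linear_sum.
    by apply: eq_bigr => a _; rewrite linearZ.
  have -> : pb_prod E z (s z) (s' z) = \sum_a \sum_c (phi z (s z) 0 a * phi z (s' z) 0 c) *: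
     pb_prod E z ((phi z)^-1%VF (delta_mx 0 a)) ((phi z)^-1%VF (delta_mx 0 c)).
    rewrite -[LHS]/(nalg_mul (fibre_alg z) (s z) (s' z)) {1}(dec (s z)) {1}(dec (s' z)).
    rewrite nalg_mul_suml; apply: eq_bigr => a _.
    rewrite nalg_mul_sumr; apply: eq_bigr => c _.
    by rewrite nalg_mulZl nalg_mulZr scalerA.
  rewrite linear_sum summxE; apply: eq_bigr => a _.
  by rewrite linear_sum summxE; apply: eq_bigr => c _; rewrite linearZ mxE.
apply: (rsmooth_at_sum pM) => a _; apply: (rsmooth_at_sum pM) => c _.
apply: (rsmooth_atM pM) => //; apply: (rsmooth_atM pM) => //.
exact: ssmooth_at_triv ss' Ap px c.
Qed.

End FibreAlgebra.

Definition is_basis (R : realType) (V : vectType R) (T : finType) (b : T -> V) : Prop :=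
  (forall v, exists c : T -> R, v = \sum_t c t *: b t) /\
  (forall c : T -> R, \sum_t c t *: b t = 0 -> forall t, c t = 0).

Lemma vbasis_fam_card (R : realType) (V : vectType R) (T : finType) (b : T -> V) :
  is_basis b -> #|T| = \dim {:V}.
Proof.
move=> [sb ib]; symmetry; apply: (dim_of_basis (b := b)) => // t; exact: memvf.
Qed.

Lemma vbasis_fam_indep (R : realType) (V : vectType R) (T : finType) (b : T -> V) :
  #|T| = \dim {:V} -> (forall c : T -> R, \sum_t c t *: b t = 0 -> forall t, c t = 0) ->
  is_basis b.
Proof.
move=> cT ib; split=> // v; pose X := [tuple b (enum_val i) | i < #|T|].
have XE (i : 'I_#|T|) : X`_i = b (enum_val i) by rewrite -tnth_nth tnth_mktuple.
have fX : free X.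
  apply/freeP => c Hc i; have := ib (fun t => c (enum_rank t)) _ (enum_val i).
  rewrite enum_valK; apply; rewrite -[RHS]Hc.
  rewrite (reindex (@enum_val T T)) /=; last by apply: onW_bij; apply: enum_val_bij.
  by apply: eq_bigr => l _; rewrite XE enum_valK.
have bX : basis_of fullv X by rewrite basisEfree fX subvf size_tuple cT leqnn.
exists (fun t => coord X (enum_rank t) v).
rewrite {1}(coord_basis bX (memvf v)) (reindex (@enum_rank T)) /=.
  by apply: eq_bigr => t _; rewrite XE enum_rankK.
by apply: onW_bij; apply: enum_rank_bij.
Qed.

(** * Local frames and coordinates of sections *)

Section Frames.
Variables (R : realType) (M : manifold R) (k : nat) (E : gradedVectorBundle M k).
Let pM : is_premanifold M := manifold_premanifold (mfd_axioms M).
Local Notation N := (\sum_i gv_rank E i)%N.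
Variables (T : finType) (S : T -> forall x, E x) (x : M).
Hypotheses (sS : forall t, ssmooth_at x (S t)) (bS : is_basis (fun t => S t x)).

Definition frame_mx (phi : trivialization E N) z : 'M[R]_(#|T|, N) :=
  \matrix_i phi z (S (enum_val i) z).

Lemma frame_mx_sum (phi : trivialization E N) z (c : T -> R) :
  phi z (\sum_t c t *: S t z) = (\row_i c (enum_val i)) *m frame_mx phi z.
Proof.
rewrite mulmx_sum_row linear_sum (reindex (@enum_val T T)) /=; last first.
  by apply: onW_bij; apply: enum_val_bij.
by apply: eq_bigr => i _; rewrite linearZ mxE rowK.
Qed.

Lemma frame_mx_free (phi : trivialization E N) z : gv_atlas E phi -> triv_dom phi z ->
  row_free (frame_mx phi z) <->
  (forall c : T -> R, \sum_t c t *: S t z = 0 -> forall t, c t = 0).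
Proof.
move=> Ap pz; split=> H.
  move=> c c0 t; have := frame_mx_sum phi z c; rewrite c0 linear0 => /esym.
  move/(congr1 (fun A => A *m pinvmx (frame_mx phi z))); rewrite mul0mx.
  rewrite mulmxKp // => /rowP /(_ (enum_rank t)).
  by rewrite !mxE enum_rankK.
apply/row_freeP; suff K : kermx (frame_mx phi z) = 0.
  have : row_free (frame_mx phi z) by rewrite -kermx_eq0 K.
  by move/row_freeP.
apply/row_matrixP => i; rewrite row0.
set u := row i _; have : u *m frame_mx phi z = 0 by apply: sub_kermxP; exact: row_sub.
have uE : u = \row_i (fun t => u 0 (enum_rank t)) (enum_val i).
  by apply/rowP => j; rewrite [RHS]mxE enum_valK.
rewrite {1}uE -(frame_mx_sum phi z (fun t => u 0 (enum_rank t))).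
move/(congr1 (fun v => (phi z)^-1%VF v)); rewrite triv_Kinv // linear0 => /H u0.
by apply/rowP => j; rewrite [RHS]mxE -[j]enum_valK u0.
Qed.

Lemma card_frame : #|T| = N.
Proof. by rewrite (vbasis_fam_card bS) dim_fibre. Qed.

Lemma rsmooth_frame_mx phi : gv_atlas E phi -> triv_dom phi x ->
  forall i j, rsmooth_at x (fun z => frame_mx phi z i j).
Proof.
move=> Ap px i j; under eq_fun do rewrite mxE.
exact: ssmooth_at_triv.
Qed.

(** In a trivialization the family is a square matrix with smooth entries, invertible near [x] since
    it is at [x]. *)
Lemma frame_near : \forall z \near x, is_basis (fun t => S t z).
Proof.
have [phi Ap px] := gv_cover E x.
have fr : row_free (frame_mx phi x) by apply/(frame_mx_free Ap px); case: bS.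
have dom : \forall z \near x, triv_dom phi z.
  by apply: open_nbhs_nbhs; split => //; exact: gv_open Ap.
have := row_free_near pM card_frame fr (rsmooth_frame_mx Ap px).
apply: filterS2 dom => z pz /(frame_mx_free Ap pz) ind.
by apply: vbasis_fam_indep => //; rewrite card_frame dim_fibre.
Qed.

(** The coordinates solve a linear system whose matrix is smooth and invertible at [x]. *)
Lemma frame_coord (s : forall x, E x) (c : M -> T -> R) : ssmooth_at x s ->
  (\forall z \near x, s z = \sum_t c z t *: S t z) -> forall t, rsmooth_at x (fun z => c z t).
Proof.
move=> ss sE t; have [phi Ap px] := gv_cover E x.
have fr : row_free (frame_mx phi x) by apply/(frame_mx_free Ap px); case: bS.
apply: (@rsmooth_at_near _ _ _ (fun z => (\row_i c z (enum_val i)) 0 (enum_rank t))).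
  by apply: filterE => z; rewrite mxE enum_rankK.
have := @rsmooth_at_solve R M pM x #|T| N (frame_mx phi) (fun z => \row_i c z (enum_val i)) (fun z => phi z (s z)) (enum_rank t) card_frame fr.
apply.
- exact: rsmooth_frame_mx.
- exact: ssmooth_at_triv.
- by apply: filterS sE => z ->; rewrite frame_mx_sum.
Qed.

End Frames.

Section MonomialSections.
Variables (R : realType) (M : manifold R) (k : nat) (E : productBundle M k).

Lemma ssmooth_at_iter_prod (I : Type) (eta : I -> forall x, E x) x (s : seq I) :
  (forall a, ssmooth_at x (eta a)) ->
  ssmooth_at x (fun z => iter_prod (pb_prod E z) [seq eta a z | a <- s]).
Proof.
move=> se; case: s => [|a s] /=; first exact: ssmooth_at0.
elim: s (eta a) (se a) => [|b s IH] s0 ss //=.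
by apply: (IH (fun z => pb_prod E z (s0 z) (eta b z))); exact: ssmooth_at_prod.
Qed.

(** The monomial is written as an iterated product along a word, since smoothness is known for
    products inside [E], not for the unitalization. *)
Lemma ssmooth_at_emono n (eta : 'I_n -> forall x, E x) x (b : 'I_n -> nat) :
  (forall a, ssmooth_at x (eta a)) -> (0 < mdeg b)%N ->
  ssmooth_at x (fun z => emono (A := fibre_alg E z) (fun a => eta a z) b).
Proof.
move=> se b0; have [h Hh] := mcount_surj b.
apply: ssmooth_at_near (ssmooth_at_iter_prod (codom h) se).
apply: filterE => z; apply: (@uin_inj R (fibre_alg E z)).
have e0 : (0 < size [seq eta a z | a <- codom h])%N by rewrite size_map size_codom card_ord.
rewrite (@uin_iter_prod R (fibre_alg E z) _ e0) big_map /codom big_image /=.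
transitivity (emonoU (A := fibre_alg E z) (fun a => eta a z) b).
  by rewrite -(eq_emonoU _ Hh) emonoU_count.
have -> : emonoU (A := fibre_alg E z) (fun a => eta a z) b =
  uin (emono (A := fibre_alg E z) (fun a => eta a z) b); last by [].
apply/esym; apply: injective_projections => //=; rewrite -(eq_emonoU _ Hh) emonoU_count.
move: b0; case: (mdeg b) h {Hh e0} => // m h _.
by rewrite big_ord_recl /= mul0r.
Qed.

End MonomialSections.

(** * Characters *)

Lemma base_expansion_inj (B n : nat) (f g : 'I_n -> nat) :
  (forall a, (f a < B)%N) -> (forall a, (g a < B)%N) ->
  (\sum_a f a * B ^ a = \sum_a g a * B ^ a)%N -> f =1 g.
Proof.
elim: n f g => [|n IH] f g fB gB; first by move=> _ [].
have E (h : 'I_n.+1 -> nat) :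
    (\sum_a h a * B ^ a = h ord0 + (\sum_(a < n) h (lift ord0 a) * B ^ a) * B)%N.
  rewrite big_ord_recl /= expn0 muln1 big_distrl /=; congr addn.
  by apply: eq_bigr => a _; rewrite /bump /= add1n expnSr mulnA.
rewrite !E => H.
have H0 : f ord0 = g ord0.
  have := congr1 (modn^~ B) H.
  by rewrite /= -modnDmr modnMl addn0 -[in RHS]modnDmr modnMl addn0 !modn_small.
move: H; rewrite H0 => /addnI /eqP; rewrite eqn_pmul2r; last exact: leq_ltn_trans (fB ord0).
move=> /eqP /(IH (fun a => f (lift ord0 a)) (fun a => g (lift ord0 a))) H.
move=> a; case: (unliftP ord0 a) => [b ->|-> //].
by apply: H.
Qed.

(* Substituting y_a = t ^ (B ^ a) with B large makes the monomials distinct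
   powers of t. *)
Lemma mono_indep (R : realType) k n (wgt : 'I_n -> nat) (c : monomial k wgt -> R) :
  (forall y : 'rV[R]_n, \sum_al c al * mono (mexpo al) y = 0) -> forall al, c al = 0.
Proof.
move=> H al0; pose B := k.+1.
pose deg (al : monomial k wgt) := (\sum_a mexpo al a * B ^ a)%N.
have degI : injective deg.
  by move=> al be /base_expansion_inj E; apply: mexpo_inj => a; apply: E => b; exact: ltn_ord.
pose p : {poly R} := \sum_al c al *: 'X^(deg al).
have p0 t : p.[t] = 0.
  rewrite /p horner_sum -[RHS](H (\row_a t ^+ (B ^ a))); apply: eq_bigr => al _.
  rewrite hornerZ hornerXn /mono; congr (_ * _).
  rewrite /deg; elim/big_rec2 : _ => // a x y _ IH.
  by rewrite exprD IH mxE -exprM [(B ^ a * _)%N]mulnC.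
have pE : p = 0.
  apply/eqP; apply: contraT => pN0.
  (* The first [size p] natural numbers would be more roots than the degree of [p] allows. *)
  have := max_poly_roots pN0 (rs := [seq i%:R | i <- iota 0 (size p)]).
  rewrite size_map size_iota ltnn; apply.
    by apply/allP => t _; rewrite rootE p0.
  by rewrite map_inj_uniq ?iota_uniq // => i j /eqP; rewrite eqr_nat => /eqP.
have := congr1 (fun q : {poly R} => q`_(deg al0)) pE.
rewrite coef0 coef_sum (bigD1 al0) //= coefZ coefXn eqxx mulr1 big1 ?addr0 // => al ne.
by rewrite coefZ coefXn (inj_eq degI) eq_sym (negbTE ne) mulr0.
Qed.

Section Characters.
Variables (R : realType) (k : nat) (A : nalg R) (G : nat -> {vspace A}) (pr : nat -> A -> A).
Hypothesis gA : is_graded_alg k G pr.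
Variables (n : nat) (wgt : 'I_n -> nat).
Hypothesis wgt_gt0 : forall a, (0 < wgt a)%N.
Local Notation mu := (@nalg_mul R A).
Local Notation mon := (monomial k wgt).

(** Truncated characters: beyond weight [k] products vanish in [A] but not in R, so multiplicativity
    is only asked up to [k]. *)
Definition is_character (chi : A -> R) : Prop :=
  (forall c u v, chi (c *: u + v) = c * chi u + chi v) /\
  (forall i j u v, u \in G i -> v \in G j -> (i + j <= k)%N ->
     chi (mu u v) = chi u * chi v).

Section OneCharacter.
Variable chi : A -> R.
Hypothesis hc : is_character chi.

Lemma character0 : chi 0 = 0.
Proof.
by have := hc.1 (-1) 0 0; rewrite scaler0 addr0 mulN1r addNr.
Qed.

Lemma characterZ c v : chi (c *: v) = c * chi v.
Proof. by have := hc.1 c v 0; rewrite !addr0 character0 addr0. Qed.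

Lemma characterD u v : chi (u + v) = chi u + chi v.
Proof. by have := hc.1 1 u v; rewrite scale1r mul1r. Qed.

Lemma character_sum (I : Type) (s : seq I) (P : pred I) (F : I -> A) :
  chi (\sum_(i <- s | P i) F i) = \sum_(i <- s | P i) chi (F i).
Proof. by apply: (big_morph chi) => [u v|]; [exact: characterD|exact: character0]. Qed.

Variable e : 'I_n -> A.
Hypothesis eG : forall a, e a \in G (wgt a).

(** Induction on the degree, splitting off the first letter of a word: all partial products have
    weight at most [k], so multiplicativity applies. *)
Lemma character_emono b : (0 < mweight wgt b <= k)%N ->
  chi (emono e b) = mono b (\row_a chi (e a)).
Proof.
move=> /andP[b0 bk]; move: {-1}(mdeg b) (erefl (mdeg b)) => j; elim: j b b0 bk => [|j IH] b b0 bk dj.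
  by have := mdeg_gt0 b0; rewrite dj.
have [h Hh] := mcount_surj b; move: h Hh; rewrite dj => h Hh.
pose b' := mcount (fun i => h (lift ord0 i)).
have bE : b =1 (fun a => msingle (h ord0) a + b' a)%N.
  by move=> a; rewrite -Hh /mcount big_ord_recl /= /msingle eq_sym.
have monoE (y : 'rV[R]_n) : mono b y = y 0 (h ord0) * mono b' y.
  rewrite /mono (eq_bigr (fun a => y 0 a ^+ msingle (h ord0) a * y 0 a ^+ b' a)).
    rewrite big_split /=; congr (_ * _); rewrite (bigD1 (h ord0)) //= /msingle eqxx expr1.
    by rewrite big1 ?mulr1 // => a /negbTE ->.
  by move=> a _; rewrite bE exprD.
rewrite (eq_emono e bE) monoE mxE.
have wE : mweight wgt b = (wgt (h ord0) + mweight wgt b')%N.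
  by rewrite (eq_mweight _ bE) mweightD mweight_single.
have dE : mdeg b' = j by exact: mdeg_count.
case: j IH {dj} h Hh b' bE monoE wE dE => [|j] IH h Hh b' bE monoE wE dE.
  have b'0 a : b' a = 0%N.
    by apply/eqP; rewrite -leqn0 -dE /mdeg (bigD1 a) //= leq_addr.
  rewrite /mono big1 ?mulr1; last by move=> a _; rewrite b'0.
  by rewrite -(emono_single e); congr chi; apply: eq_emono => a; rewrite b'0 addn0.
have b'w : (0 < mweight wgt b')%N by apply: mweight_gt0 => //; rewrite dE.
have wk : (wgt (h ord0) + mweight wgt b' <= k)%N by rewrite -wE.
rewrite -(emonoM gA wgt_gt0 eG) ?mweight_single // emono_single.
rewrite (hc.2 (wgt (h ord0)) (mweight wgt b')) //; last exact: (emono_in gA wgt_gt0 eG).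
by rewrite IH //; apply: leq_trans wk; exact: leq_addl.
Qed.

End OneCharacter.

Variable e : 'I_n -> A.
Hypothesis eG : forall a, e a \in G (wgt a).
Hypothesis fe : is_basis (fun al : mon => emono e (mexpo al)).

Lemma free_coord : exists X : A -> mon -> R,
    [/\ forall v, v = \sum_t X v t *: emono e (mexpo t),
        forall c t, X (\sum_t c t *: emono e (mexpo t)) t = c t
      & forall a u v t, X (a *: u + v) t = a * X u t + X v t].
Proof. by case: fe => s i; exact: coordinates_exist. Qed.

(* Evaluation at [y] of the elements of [A] seen as truncated polynomials. *)
Definition is_eval (y : 'rV[R]_n) (chi : A -> R) : Prop :=
  forall c : mon -> R, chi (\sum_al c al *: emono e (mexpo al)) =
    \sum_al c al * mono (mexpo al) y.

Lemma eval_exists y : exists chi, is_eval y chi.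
Proof.
have [X [XE XK XL]] := free_coord; exists (fun v => \sum_al X v al * mono (mexpo al) y).
by move=> c; apply: eq_bigr => al _; rewrite XK.
Qed.

Section OneEvaluation.
Variables (y : 'rV[R]_n) (chi : A -> R).
Hypothesis ey : is_eval y chi.

Lemma eval_linear c u v : chi (c *: u + v) = c * chi u + chi v.
Proof.
have [X [XE XK XL]] := free_coord.
rewrite (XE u) (XE v) scaler_sumr -big_split /=.
rewrite (eq_bigr (fun al => (c * X u al + X v al) *: emono e (mexpo al))); last first.
  by move=> al _; rewrite scalerDl scalerA.
rewrite !ey mulr_sumr -big_split; apply: eq_bigr => al _ /=.
by rewrite mulrDl mulrA.
Qed.

Lemma eval_emono b : (0 < mweight wgt b <= k)%N -> chi (emono e b) = mono b y.
Proof.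
move=> bk; have [al Hal] := monomialP wgt_gt0 bk.
rewrite -(eq_emono e Hal).
have -> : emono e (mexpo al) = \sum_be (be == al)%:R *: emono e (mexpo be).
  rewrite (bigD1 al) //= eqxx scale1r big1 ?addr0 // => be /negbTE ->.
  by rewrite scale0r.
rewrite ey (bigD1 al) //= eqxx mul1r big1 ?addr0 => [|be /negbTE ->]; last by rewrite mul0r.
by apply: eq_bigr => a _; rewrite Hal.
Qed.

Lemma eval_gen a : (wgt a <= k)%N -> chi (e a) = y 0 a.
Proof.
move=> ak; rewrite -(emono_single e) eval_emono ?mweight_single ?wgt_gt0 //.
rewrite /mono (bigD1 a) //= /msingle eqxx expr1 big1 ?mulr1 // => b /negbTE.
by rewrite eq_sym => ->.
Qed.

Lemma eval_homogeneous w v : v \in G w -> exists c : mon -> R,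
  (forall al, c al != 0 -> mweight wgt (mexpo al) = w) /\
  v = \sum_al c al *: emono e (mexpo al).
Proof.
move=> vG; have [X [XE XK XL]] := free_coord; exists (X v); split=> // al; apply: contraNeq => nw.
by rewrite (coef_homogeneous gA wgt_gt0 eG XE XK vG nw).
Qed.

(** By bilinearity it is enough to multiply monomials. Those occurring in [u] and [v] have weights
    [i] and [j], hence their product is again a monomial of weight at most [k], which [chi]
    evaluates at [y]. *)
Lemma eval_character : is_character chi.
Proof.
split=> [|i j u v uG vG ij]; first exact: eval_linear.
have c0 : chi 0 = 0.
  by have := eval_linear (-1) 0 0; rewrite scaler0 addr0 mulN1r addNr.
have cD : {morph chi : u v / u + v} by move=> a b; have := eval_linear 1 a b; rewrite scale1r mul1r.
have cZ c a : chi (c *: a) = c * chi a.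
  by have := eval_linear c a 0; rewrite !addr0 c0 addr0.
have csum (I : finType) (F : I -> A) : chi (\sum_i F i) = \sum_i chi (F i).
  exact: (big_morph chi).
have [cu [Hu ->]] := eval_homogeneous uG; have [cv [Hv ->]] := eval_homogeneous vG.
rewrite nalg_mul_suml !csum mulr_suml; apply: eq_bigr => al _.
rewrite nalg_mul_sumr csum mulr_sumr; apply: eq_bigr => be _.
rewrite nalg_mulZl nalg_mulZr !cZ.
have [->|na] := eqVneq (cu al) 0; first by rewrite !mul0r.
have [->|nb] := eqVneq (cv be) 0; first by rewrite !(mul0r, mulr0).
have wa := mexpo_weight al; have wb := mexpo_weight be.
have /andP[wa0 _] := wa; have /andP[wb0 _] := wb.
rewrite (emonoM gA wgt_gt0 eG) // !eval_emono //; last first.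
  by rewrite mweightD addn_gt0 wa0 /= Hu // Hv.
rewrite -mulrA; congr (_ * _); rewrite mulrCA; congr (_ * _).
by rewrite /mono -big_split; apply: eq_bigr => a _; rewrite exprD.
Qed.

End OneEvaluation.

Lemma eval_wscale y chi chi' t w v : is_eval y chi -> is_eval (wscale wgt t y) chi' ->
  v \in G w -> chi' v = t ^+ w * chi v.
Proof.
move=> ey ey' /eval_homogeneous [c [Hc ->]]; rewrite ey ey' mulr_sumr; apply: eq_bigr => al _.
rewrite mono_wscale; have [->|/Hc <-] := eqVneq (c al) 0; first by rewrite !mul0r mulr0.
by rewrite mulrCA.
Qed.

Lemma eval_separates v : (forall y chi, is_eval y chi -> chi v = 0) -> v = 0.
Proof.
move=> H; have [X [XE XK XL]] := free_coord.
rewrite (XE v) big1 // => al _; rewrite [X v al]mono_indep ?scale0r // => y.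
have [chi ey] := eval_exists y.
by rewrite -(ey (X v)) -(XE v); exact: H ey.
Qed.

(** Together with [eval_character], this identifies the truncated characters of a free algebra with
    evaluations at the points of R^n. *)
Lemma character_eval chi : is_character chi -> is_eval (\row_a chi (e a)) chi.
Proof.
move=> hc c; rewrite (character_sum hc); apply: eq_bigr => al _.
by rewrite (characterZ hc) (character_emono hc) // mexpo_weight.
Qed.

End Characters.

(** * Dual pairings *)

Lemma weighted_scalingE (R : realType) k (d : 'I_k -> nat) (t : R) (y : 'rV[R]_(\sum_i d i)) :
  weighted_scaling t y = wscale (dwt (d := d)) t y.
Proof. by apply/rowP => b; rewrite !mxE tagnat.sig2K. Qed.

Section Charts.
Variables (R : realType) (M : manifold R) (k : nat) (F : gradedBundle M k).
Let pM : is_premanifold M := manifold_premanifold (mfd_axioms M).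
Let pF : is_premanifold F := manifold_premanifold (mfd_axioms F).
Local Notation n := (\sum_i gb_rank F i)%N.
Let pMn : is_premanifold (prod_space M (euclidean R n)) :=
  prod_premanifold pM (euclidean_premanifold R n).

Definition gb_chart (U : set M) (y : F -> 'rV[R]_n) (psi : M * 'rV[R]_n -> F) : Prop :=
  [/\ open U,
      @diffeo_on R F (prod_space M (euclidean R n)) (@gb_proj _ _ _ F @^-1` U) (U `*` setT)
        (fun p => (gb_proj p, y p)) psi
    & forall t p, U (gb_proj p) -> y (gb_act t p) = weighted_scaling t (y p)].

Lemma gb_proj_smooth_at p : smooth_at p (@gb_proj _ _ _ F).
Proof. by have /(smooth_onP _ pF pM openT)/(_ p I) := @gb_proj_smooth _ _ _ F. Qed.

Lemma open_gb_proj (U : set M) : open U -> open (@gb_proj _ _ _ F @^-1` U).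
Proof.
move=> oU; rewrite -[X in open X]setTI; apply: open_preimageI => //; first exact: openT.
by move=> p _; have [] := gb_proj_smooth_at p.
Qed.

Lemma near_gb_proj (P : set M) p : (\forall z \near gb_proj p, P z) ->
  \forall q \near p, P (@gb_proj _ _ _ F q).
Proof. by move=> H; have [c _] := gb_proj_smooth_at p; exact: (c _ H). Qed.

(** Because [h_0 \o h_t = h_0], and [gb_proj] has the same fibres as [h_0]. *)
Lemma gb_proj_act t p : gb_proj (gb_act t p) = @gb_proj _ _ _ F p.
Proof. by apply/gb_proj_act0; rewrite gb_actM mul0r. Qed.

Lemma rsmooth_at_base f p : rsmooth_at (gb_proj p) f -> rsmooth_at p (fun q : F => f (gb_proj q)).
Proof. exact: (rsmooth_at_pullback pF (gb_proj_smooth_at p)). Qed.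

Section OneChart.
Variables (U : set M) (y : F -> 'rV[R]_n) (psi : M * 'rV[R]_n -> F).
Hypothesis ch : gb_chart U y psi.

Lemma gb_chart_open : open U. Proof. by case: ch. Qed.

Lemma gb_chart_act t p : U (gb_proj p) -> y (gb_act t p) = wscale (dwt (d := gb_rank F)) t (y p).
Proof. by rewrite -weighted_scalingE; case: ch => _ _; exact. Qed.

Lemma gb_chart_psi z u : U z -> gb_proj (psi (z, u)) = z /\ y (psi (z, u)) = u.
Proof.
move=> Uz; case: ch => _ [_ _ _ /(_ (z, u))] + _.
by case=> [|_ [-> ->]].
Qed.

Lemma gb_chartK p : U (gb_proj p) -> psi (gb_proj p, y p) = p.
Proof. by move=> Up; case: ch => _ [_ _ /(_ p Up) []]. Qed.

Lemma gb_chart_psi_act t z u : U z ->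
  psi (z, wscale (dwt (d := gb_rank F)) t u) = gb_act t (psi (z, u)).
Proof.
move=> Uz; have [px yu] := gb_chart_psi u Uz.
by rewrite -[RHS]gb_chartK gb_proj_act px // gb_chart_act ?px // yu.
Qed.

Lemma gb_chart_coord p a : U (gb_proj p) -> rsmooth_at p (fun q => y q 0 a).
Proof.
move=> Up; case: ch => oU [s1 _ _ _] _.
move/(smooth_onP _ pF pMn (open_gb_proj oU))/(_ p Up): s1 => s1.
have := smooth_at_comp pF s1 (@smooth_at_snd R M (euclidean R n) (gb_proj p, y p) pM).
by move/(smooth_at_euclidean _ _ pF); exact.
Qed.

Lemma gb_chart_psi_smooth z u : U z ->
  @smooth_at R (prod_space M (euclidean R n)) F (z, u) psi.
Proof.
move=> Uz; case: ch => oU [_ s2 _ _] _.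
have oUT : @open (prod_space M (euclidean R n)) (U `*` setT).
  rewrite openE => -[x v] [Ux _]; exists (U, setT) => //=; split; last exact: filterT.
  exact: open_nbhs_nbhs.
by move/(smooth_onP _ pMn pF oUT)/(_ (z, u)): s2; apply.
Qed.

End OneChart.
End Charts.

Section Polynomials.
Variables (R : realType) (M : manifold R) (k : nat) (E : productBundle M k).
Variables (n : nat) (wgt : 'I_n -> nat) (eta : 'I_n -> forall x, E x).
Hypothesis wgt_gt0 : forall a, (0 < wgt a)%N.
Implicit Types l : seq ((M -> R) * ('I_n -> nat)).

(** Carries the expansions given by [homogeneous_polynomial] from [F] to [E], by substituting the
    sections [eta] for the fibre coordinates. *)
Definition poly_section l (z : M) : E z :=
  \sum_(c <- l) c.1 z *: emono (A := fibre_alg E z) (fun a => eta a z) c.2.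

Lemma ssmooth_at_poly l x : (forall a, ssmooth_at x (eta a)) ->
  List.Forall (fun c => rsmooth_at x c.1 /\ (0 < mdeg c.2)%N) l ->
  ssmooth_at x (poly_section l).
Proof.
move=> se; elim=> [|c l' [sc c0] _ IH].
  apply: ssmooth_at_near (ssmooth_at0 E x).
  by apply: filterE => z; rewrite /poly_section big_nil.
apply: (@ssmooth_at_near _ _ _ _ _ (fun z =>
   c.1 z *: emono (A := fibre_alg E z) (fun a => eta a z) c.2 + poly_section l' z)).
  by apply: filterE => z; rewrite /poly_section big_cons.
by apply: ssmooth_atD => //; apply: ssmooth_atZ => //; exact: ssmooth_at_emono.
Qed.

Lemma poly_graded l z w : (forall a, eta a z \in gv_grade E z (wgt a)) -> (0 < w)%N ->
  List.Forall (fun c => mweight wgt c.2 = w) l -> poly_section l z \in gv_grade E z w.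
Proof.
move=> eG w0; elim=> [|c l' wc _ IH]; rewrite /poly_section; first by rewrite big_nil mem0v.
rewrite big_cons memvD // memvZ // -wc.
by apply: (emono_in (fibre_graded E z) wgt_gt0) => //; rewrite wc.
Qed.

Lemma character_poly l z w (chi : E z -> R) : is_character k (A := fibre_alg E z) (gv_grade E z) chi ->
  (forall a, eta a z \in gv_grade E z (wgt a)) -> (1 <= w <= k)%N ->
  List.Forall (fun c => mweight wgt c.2 = w) l ->
  chi (poly_section l z) = \sum_(c <- l) c.1 z * mono c.2 (\row_a chi (eta a z)).
Proof.
move=> hc eG wk; elim=> [|c l' wc _ IH]; rewrite /poly_section.
  by rewrite !big_nil (character0 hc).
rewrite !big_cons (characterD hc) (characterZ hc) -IH; congr (_ * _ + _).
by rewrite (character_emono (fibre_graded E z) wgt_gt0 hc eG) // wc.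
Qed.

End Polynomials.

Section Dual.
Variables (R : realType) (M : manifold R) (k : nat) (F : gradedBundle M k) (E : productBundle M k).
Variable ev : forall x, E x -> F -> R.
Let pM : is_premanifold M := manifold_premanifold (mfd_axioms M).
Let pF : is_premanifold F := manifold_premanifold (mfd_axioms F).
Local Notation n := (\sum_i gb_rank F i)%N.
Local Notation wgt := (dwt (d := gb_rank F)).
Local Notation em eta z := (fun al : monomial k wgt =>
  emono (A := fibre_alg E z) (fun a => eta a z) (mexpo al)).

(* Around a point, [F] has coordinates [y] and [E] a frame [eta] of
   generators such that [ev] evaluates the polynomials in [eta] at [y]. *)
Record local_dual (U : set M) (y : F -> 'rV[R]_n) (psi : M * 'rV[R]_n -> F)
    (eta : 'I_n -> forall x, E x) : Prop := LocalDual {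
  ld_chart : gb_chart U y psi;
  ld_smooth : forall z a, U z -> ssmooth_at z (eta a);
  ld_grade : forall z a, U z -> eta a z \in gv_grade E z (wgt a);
  ld_basis : forall z, U z -> is_basis (em eta z);
  ld_eval : forall p, U (gb_proj p) ->
    @is_eval R k (fibre_alg E (gb_proj p)) _ wgt (fun a => eta a (gb_proj p)) (y p) (fun v => ev v p) }.

Definition dual_pairing : Prop := forall x, exists U y psi eta, U x /\ local_dual U y psi eta.

Hypothesis dEF : dual_pairing.

Lemma dual_character p : is_character k (A := fibre_alg E (gb_proj p))
  (gv_grade E (gb_proj p)) (fun v => ev v p).
Proof.
have [U [y [psi [eta [Up ld]]]]] := dEF (gb_proj p).
apply: (eval_character (fibre_graded E _) (@dwt_gt0 _ _) _ (ld_basis ld Up) (ld_eval ld Up)).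
by move=> a; exact: (ld_grade ld a Up).
Qed.

(** The base point is a variable because the projections of [p] and [gb_act t p] are equal without
    being convertible. *)
Lemma dual_act x w (v : E x) t p : gb_proj p = x -> v \in gv_grade E x w ->
  ev v (gb_act t p) = t ^+ w * ev v p.
Proof.
move=> px; subst x => vw; have [U [y [psi [eta [Up ld]]]]] := dEF (gb_proj p).
have ey' : @is_eval R k (fibre_alg E (gb_proj p)) _ wgt (fun a => eta a (gb_proj p))
    (wscale wgt t (y p)) (fun v => ev v (gb_act t p)).
  rewrite -(gb_chart_act (ld_chart ld)) //.
  by move: (ld_eval ld (p := gb_act t p)); rewrite gb_proj_act; apply.
exact: (eval_wscale (fibre_graded E _) (@dwt_gt0 _ _) (fun a => ld_grade ld a Up)
  (ld_basis ld Up) (ld_eval ld Up) ey' vw).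
Qed.

(** Locally [s] is a polynomial in the frame with smooth coefficients, and the pairing replaces the
    frame by the coordinates. *)
Lemma dual_smooth p s : ssmooth_at (gb_proj p) s ->
  rsmooth_at p (fun q => ev (s (gb_proj q)) q).
Proof.
move=> ss; have [U [y [psi [eta [Up ld]]]]] := dEF (gb_proj p).
have [c Hc] : exists c : forall z, monomial k wgt -> R,
    forall z, U z -> s z = \sum_al c z al *: em eta z al.
  have H z : exists c : monomial k wgt -> R, U z -> s z = \sum_al c al *: em eta z al.
    have [Uz|nU] := pselect (U z); last by exists (fun=> 0).
    by have [c Ec] := (ld_basis ld Uz).1 (s z); exists c.
  by have [c Hc] := boolp.choice H; exists c.
have nU : \forall z \near gb_proj p, U z.
  by apply: open_nbhs_nbhs; split => //; exact: gb_chart_open (ld_chart ld).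
apply: (@rsmooth_at_near _ _ _
    (fun q => \sum_al c (gb_proj q) al * mono (mexpo al) (y q))).
  apply: filterS (near_gb_proj nU) => q Uq.
  by rewrite (Hc _ Uq) (ld_eval ld Uq).
apply: (rsmooth_at_sum pF) => al _; apply: (rsmooth_atM pF).
  apply: (rsmooth_at_base (f := fun z => c z al)).
  apply: (frame_coord (S := fun be z => em eta z be) _ (ld_basis ld Up) ss).
    move=> be; apply: ssmooth_at_emono => [a|]; first exact: (ld_smooth ld a Up).
    by apply: (mdeg_gt0 (wgt := wgt)); have /andP[] := mexpo_weight be.
  by apply: filterS nU => z Uz; exact: Hc.
apply: (rsmooth_at_prod pF) => a _; apply: (rsmooth_atX pF).
exact: (gb_chart_coord (ld_chart ld)).
Qed.

Lemma dual_separates x (v : E x) : (forall p, gb_proj p = x -> ev v p = 0) -> v = 0.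
Proof.
move=> H; have [U [y [psi [eta [Ux ld]]]]] := dEF x.
apply: (eval_separates (ld_basis ld Ux)).
move=> u chi eu; have [px yu] := gb_chart_psi (ld_chart ld) u Ux.
have := ld_eval ld (p := psi (x, u)); rewrite px yu => /(_ Ux) eu'.
have [X [XE _ _]] := free_coord (ld_basis ld Ux).
by rewrite (XE v) eu -eu' -XE; exact: H.
Qed.

(** The local expansion of [g] in the coordinates, with the frame substituted for them, is the
    section. Homogeneity is assumed over [V] only, so that the coordinate functions of a chart are
    admissible. *)
Lemma dual_sections x w (V : set M) (g : F -> R) : open V -> V x -> (1 <= w <= k)%N ->
  (forall p, V (gb_proj p) -> rsmooth_at p g) ->
  (forall t p, V (gb_proj p) -> g (gb_act t p) = t ^+ w * g p) ->
  exists s : forall x, E x, ssmooth_at x s /\ \forall z \near x,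
    s z \in gv_grade E z w /\ forall p, gb_proj p = z -> ev (s z) p = g p.
Proof.
move=> oV Vx wk sg hg; have [U [y [psi [eta [Ux ld]]]]] := dEF x.
have oU := gb_chart_open (ld_chart ld).
have oUV : open (U `&` V) by exact: openI.
have sG z u : (U `&` V) z ->
    @rsmooth_at R (prod_space M (euclidean R n)) (z, u) (g \o psi).
  move=> [Uz Vz]; apply: rsmooth_at_pullback.
  - exact: prod_premanifold pM (euclidean_premanifold R n).
  - exact: (gb_chart_psi_smooth (ld_chart ld) u Uz).
  - by apply: sg; rewrite (gb_chart_psi (ld_chart ld) u Uz).1.
have hG t z u : (U `&` V) z -> (g \o psi) (z, wscale wgt t u) = t ^+ w * (g \o psi) (z, u).
  move=> [Uz Vz] /=; have [px yu] := gb_chart_psi (ld_chart ld) u Uz.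
  by rewrite (gb_chart_psi_act (ld_chart ld)) // hg ?px.
have [l [Hl El]] := homogeneous_polynomial pM (@dwt_gt0 _ _) oUV (conj Ux Vx) sG hG.
pose s := poly_section eta l.
have lw : List.Forall (fun c => mweight wgt c.2 = w) l by elim: Hl => // c l' [_ ?]; constructor.
have w0 : (0 < w)%N by case/andP: wk.
exists s; split.
  apply: ssmooth_at_poly => [a|]; first exact: (ld_smooth ld a Ux).
  elim: Hl => [|c l' [sc wc] _ IH]; constructor => //; split=> //.
  by apply: (mdeg_gt0 (wgt := wgt)); rewrite wc.
have nU : \forall z \near x, U z by apply: open_nbhs_nbhs.
apply: filterS2 nU El => z Uz Ez; split.
  exact: (poly_graded (@dwt_gt0 _ _) (fun a => ld_grade ld a Uz) w0 lw).
move=> p pz; have := Ez (y p); rewrite /= -{1}pz (gb_chartK (ld_chart ld)); last by rewrite pz.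
move=> ->; subst z; have hc := dual_character p.
rewrite /s (character_poly (@dwt_gt0 _ _) hc (fun a => ld_grade ld a Uz) wk lw).
apply: eq_bigr => c _; congr (_ * mono _ _); apply/rowP => a; rewrite mxE.
by rewrite (eval_gen (@dwt_gt0 _ _) (ld_eval ld Uz)) // dwt_le.
Qed.

(** A vector with prescribed values of the pairing is unique in its fibre, so the sections found
    locally by [dual_sections] agree with one global section. *)
Lemma dual_corresponds : corresponds F E.
Proof.
exists (fun s p => ev (s (gb_proj p)) p); split.
- move=> f s s' _ _ _ p; exact: (dual_character p).1.
- move=> w s wk [/smooth_sectionP ss sw]; split.
    by apply/(smooth_funP _ pF) => p; exact: dual_smooth.
  by move=> t p; rewrite gb_proj_act (dual_act _ _ (sw _)).
- move=> w g wk [/(smooth_funP _ pF) sg hg].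
  have loc x := dual_sections openT I wk (fun p _ => sg p) (fun t p _ => hg t p) (x := x).
  have ex x : exists v : E x, v \in gv_grade E x w /\ forall p, gb_proj p = x -> ev v p = g p.
    by have [s [_ /nbhs_singleton H]] := loc x; exists (s x).
  pose s x : E x := sval (cid (ex x)).
  have sP x : s x \in gv_grade E x w /\ forall p, gb_proj p = x -> ev (s x) p = g p.
    by rewrite /s; case: cid.
  have uniq x (v v' : E x) : (forall p, gb_proj p = x -> ev v p = g p) ->
      (forall p, gb_proj p = x -> ev v' p = g p) -> v = v'.
    move=> Hv Hv'; apply/eqP; rewrite -subr_eq0; apply/eqP/dual_separates => p px; subst x.
    have := (dual_character p).1 (-1) v' v; rewrite scaleN1r addrC => ->.
    by rewrite Hv // Hv' // mulN1r addNr.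
  exists s; split.
    split; last by apply/funext => p; exact: (sP _).2.
    split; last by move=> x; exact: (sP x).1.
    apply/smooth_sectionP => x; have [s' [ss' Hs']] := loc x.
    apply: ssmooth_at_near ss'; apply: filterS Hs' => z [_ Hz].
    by apply: uniq => //; exact: (sP z).2.
  move=> s' [_ gs']; apply: functional_extensionality_dep => x; apply: uniq; first exact: (sP x).2.
  by move=> p px; subst x; rewrite -gs'.
- move=> i j s s' i0 j0 ij [_ si] [_ sj] p.
  exact: (dual_character p).2 (si _) (sj _) ij.
Qed.

End Dual.

Lemma is_eval_uniq (R : realType) (k : nat) (A : nalg R) n (wgt : 'I_n -> nat) (e : 'I_n -> A) y
    (chi chi' : A -> R) :
  is_basis (fun al : monomial k wgt => emono e (mexpo al)) ->
  is_eval k wgt e y chi -> is_eval k wgt e y chi' -> chi =1 chi'.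
Proof. by move=> [sp _] e1 e2 v; have [c ->] := sp v; rewrite e1 e2. Qed.

Lemma emono_morph (R : realType) (A A' : nalg R) (h : A -> A') n (e : 'I_n -> A) (b : 'I_n -> nat) :
  linear h -> (forall u v, h (nalg_mul A u v) = nalg_mul A' (h u) (h v)) ->
  emono (fun a => h (e a)) b = h (emono e b).
Proof.
move=> hL hM; pose H (x : unitz A) : unitz A' := (x.1, h x.2).
have h0 : h 0 = 0 by have := hL (-1) 0 0; rewrite scaleN1r addNr scaleN1r addNr.
have hD u v : h (u + v) = h u + h v by have := hL 1 u v; rewrite !scale1r.
have hZ c u : h (c *: u) = c *: h u by have := hL c u 0; rewrite h0 !addr0.
have HM : {morph H : x y / x * y}.
  by move=> [c u] [c' u']; congr pair; rewrite /= !hD !hZ hM.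
have H1 : H 1 = 1 by congr pair; exact: h0.
rewrite /emono; suff -> : emonoU (fun a => h (e a)) b = H (emonoU e b) by [].
rewrite /emonoU (big_morph H HM H1); apply: eq_bigr => a _.
have E : uin (h (e a)) = H (uin (e a)) by [].
by rewrite E; elim: (b a) => [|m IH]; rewrite ?expr0 ?H1 // !exprS HM IH.
Qed.

(** Products of homogeneous components are compared through characters that separate the points of
    [A']. Above weight [k], where characters say nothing, both products vanish. *)
Lemma character_morphism (R : realType) (k : nat) (A A' : nalg R) (G : nat -> {vspace A})
    (G' : nat -> {vspace A'}) pr pr' (h : A -> A') (I : Type) (chi : I -> A -> R) (chi' : I -> A' -> R) :
  is_graded_alg k G pr -> is_graded_alg k G' pr' -> linear h ->
  (forall w v, v \in G w -> h v \in G' w) ->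
  (forall i, is_character k G (chi i)) -> (forall i, is_character k G' (chi' i)) ->
  (forall i v, chi' i (h v) = chi i v) ->
  (forall u v, (forall i, chi' i u = chi' i v) -> u = v) ->
  forall a b, h (nalg_mul A a b) = nalg_mul A' (h a) (h b).
Proof.
move=> gA gA' hL hG hc hc' hE sep a b.
have h0 : h 0 = 0 by have := hL (-1) 0 0; rewrite scaleN1r addNr scaleN1r addNr.
have hD : {morph h : u v / u + v} by move=> u v; have := hL 1 u v; rewrite !scale1r.
have hsum (J : finType) (V : J -> A) : h (\sum_j V j) = \sum_j h (V j).
  exact: (big_morph h hD h0).
rewrite (gr_pr_sum gA a) (gr_pr_sum gA b).
rewrite nalg_mul_suml !hsum nalg_mul_suml; apply: eq_bigr => i _.
rewrite [nalg_mul A _ _]nalg_mul_sumr hsum nalg_mul_sumr; apply: eq_bigr => j _.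
have ai := gr_pr_in gA i.+1 a; have bj := gr_pr_in gA j.+1 b.
have [ij|ij] := leqP (i.+1 + j.+1) k; last first.
  rewrite (gr_out gA (gr_mul gA ai bj)) ?ij ?orbT //.
  by rewrite (gr_out gA' (gr_mul gA' (hG _ _ ai) (hG _ _ bj))) ?ij ?orbT.
apply: sep => l; rewrite hE ((hc l).2 _ _ _ _ ai bj ij).
by rewrite ((hc' l).2 _ _ _ _ (hG _ _ ai) (hG _ _ bj) ij) !hE.
Qed.

(** * Uniqueness of the partner in a dual pairing *)

Section DualMap.
Variables (R : realType) (M : manifold R) (k : nat) (F F' : gradedBundle M k) (E : productBundle M k).
Variables (ev : forall x, E x -> F -> R) (ev' : forall x, E x -> F' -> R).
Hypotheses (dEF : dual_pairing ev) (dEF' : dual_pairing ev').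
Let pM : is_premanifold M := manifold_premanifold (mfd_axioms M).
Let pF : is_premanifold F := manifold_premanifold (mfd_axioms F).
Let pF' : is_premanifold F' := manifold_premanifold (mfd_axioms F').

Lemma dual_point_uniq (p q : F') : gb_proj p = gb_proj q ->
  (forall v : E (gb_proj p), ev' v p = ev' v q) -> p = q.
Proof.
move=> pq H; have [U [y [psi [eta [Up ld]]]]] := dEF' (gb_proj p).
rewrite -(gb_chartK (ld_chart ld) Up) -(gb_chartK (ld_chart ld) (p := q)) -?pq //.
congr (psi (_, _)); apply/rowP => a.
have := H (eta a (gb_proj p)).
rewrite (eval_gen (@dwt_gt0 _ _) (ld_eval ld Up)) ?dwt_le // => ->.
have := ld_eval ld (p := q); rewrite -pq => /(_ Up) eq_.
by rewrite (eval_gen (@dwt_gt0 _ _) eq_) ?dwt_le.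
Qed.

(** [p] is a character of the fibre of [E], and the point of [F'] whose coordinates are its values
    on the generators induces the same character. *)
Lemma dual_point_at (U : set M) y psi eta p : local_dual ev' U y psi eta -> U (gb_proj p) ->
  let p' := psi (gb_proj p, \row_a ev (eta a (gb_proj p)) p) in
  gb_proj p' = gb_proj p /\ forall v : E (gb_proj p), ev' v p' = ev v p.
Proof.
move=> ld Up p'; have [pp yp] := gb_chart_psi (ld_chart ld) (\row_a ev (eta a (gb_proj p)) p) Up.
split=> // v; have := ld_eval ld (p := p'); rewrite pp => /(_ Up); rewrite yp => ev1.
have ev2 := character_eval (fibre_graded E _) (@dwt_gt0 _ _) (fun a => ld_grade ld a Up)
  (dual_character dEF p).
exact: (is_eval_uniq (ld_basis ld Up) ev1 ev2).
Qed.

(** [f p] is chosen as a point with the same pairings as [p]. Such a point is unique, so near each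
    point [f] is the explicit formula of [dual_point_at], which is smooth. *)
Lemma dual_map : exists f : F -> F',
  [/\ forall p, gb_proj (f p) = gb_proj p,
      forall x (v : E x) p, gb_proj p = x -> ev' v (f p) = ev v p
    & forall p, smooth_at p f].
Proof.
have ex p : exists p' : F', gb_proj p' = gb_proj p /\
    forall v : E (gb_proj p), ev' v p' = ev v p.
  have [U [y [psi [eta [Up ld]]]]] := dEF' (gb_proj p).
  by eexists; exact: (dual_point_at ld Up).
have [f Hf] := boolp.choice ex; exists f; split.
- by move=> p; case: (Hf p).
- by move=> x v p px; subst x; case: (Hf p).
move=> p; have [U [y [psi [eta [Up ld]]]]] := dEF' (gb_proj p).
have oU := gb_chart_open (ld_chart ld).
pose u q : 'rV[R]_(\sum_i gb_rank F' i) := \row_a ev (eta a (gb_proj q)) q.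
apply: (@smooth_at_near _ _ _ _ (fun q => psi (gb_proj q, u q))).
  have nU : \forall z \near gb_proj p, U z by apply: open_nbhs_nbhs.
  apply: filterS (near_gb_proj nU) => q Uq.
  have [pq Hq] := dual_point_at ld Uq.
  apply: dual_point_uniq; first by rewrite pq; case: (Hf q).
  by rewrite pq => v; rewrite Hq; case: (Hf q).
apply: (smooth_at_comp (f := fun q => (gb_proj q, u q))
  (Y := prod_space M (euclidean R (\sum_i gb_rank F' i))) pF).
  apply: (smooth_at_pair (Z := euclidean R (\sum_i gb_rank F' i)) (g := u)); first exact: gb_proj_smooth_at.
  apply/(smooth_at_euclidean _ _ pF) => a.
  apply: rsmooth_at_near (dual_smooth dEF (ld_smooth ld a Up)).
  by apply: filterE => q; rewrite mxE.
exact: (gb_chart_psi_smooth (ld_chart ld) (u p) Up).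
Qed.

End DualMap.

Lemma dual_gb_isomorphic (R : realType) (M : manifold R) (k : nat) (F F' : gradedBundle M k)
    (E : productBundle M k) (ev : forall x, E x -> F -> R) (ev' : forall x, E x -> F' -> R) :
  dual_pairing ev -> dual_pairing ev' -> gb_isomorphic F F'.
Proof.
move=> dF dF'; have [f [pf ef sf]] := dual_map dF dF'; have [g [pg eg sg]] := dual_map dF' dF.
have pF : is_premanifold F := manifold_premanifold (mfd_axioms F).
have pF' : is_premanifold F' := manifold_premanifold (mfd_axioms F').
exists f, g; split => //.
- split.
  + by apply/(smooth_onP _ pF pF' openT) => p _.
  + by apply/(smooth_onP _ pF' pF openT) => p _.
  + move=> p _; split=> //; apply: (dual_point_uniq dF); first by rewrite pg pf.
    by move=> v; rewrite eg ?ef // pg.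
  + move=> p _; split=> //; apply: (dual_point_uniq dF'); first by rewrite pf pg.
    by move=> v; rewrite ef ?eg // pf.
- move=> t p; apply: (dual_point_uniq dF'); first by rewrite pf !gb_proj_act pf.
  move=> v; have gA := fibre_graded E (gb_proj (f (gb_act t p))).
  set x := gb_proj _ in v gA *.
  have xE : gb_proj p = x by rewrite /x pf gb_proj_act.
  (* The effect of the action on the pairing is only known for homogeneous vectors. *)
  rewrite (gr_pr_sum gA v).
  have c1 := dual_character dF' (f (gb_act t p)).
  have c2 := dual_character dF' (gb_act t (f p)).
  have x2 : gb_proj (gb_act t (f p)) = x by rewrite gb_proj_act pf.
  move: c2; rewrite x2 => c2.
  rewrite (character_sum c1) (character_sum c2); apply: eq_bigr => i _.
  have vi := gr_pr_in gA i.+1 v.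
  rewrite ef ?gb_proj_act // (dual_act dF t xE vi) (dual_act dF' t _ vi) ?pf //.
  by rewrite ef.
Qed.

Section DualIso.
Variables (R : realType) (M : manifold R) (k : nat) (F : gradedBundle M k) (E E' : productBundle M k).
Variables (ev : forall x, E x -> F -> R) (ev' : forall x, E' x -> F -> R).
Hypotheses (dE : dual_pairing ev) (dE' : dual_pairing ev').
Let pM : is_premanifold M := manifold_premanifold (mfd_axioms M).
Local Notation n := (\sum_i gb_rank F i)%N.
Local Notation wgt := (dwt (d := gb_rank F)).

(** The coordinates adapted to [E] are homogeneous functions on [F], hence come from local sections
    [eta'] of [E']. Polynomials with equal coefficients in [eta] and in [eta'] then have equal
    pairings. *)
Lemma dual_transfer x : exists (eta : 'I_n -> forall x, E x) (eta' : 'I_n -> forall x, E' x),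
  [/\ forall a, ssmooth_at x (eta a), forall a, ssmooth_at x (eta' a)
    & \forall z \near x,
      [/\ is_basis (fun al : monomial k wgt =>
            emono (A := fibre_alg E z) (fun a => eta a z) (mexpo al)),
          forall a, eta a z \in gv_grade E z (wgt a),
          forall a, eta' a z \in gv_grade E' z (wgt a)
        & forall (c : monomial k wgt -> R) p, gb_proj p = z ->
            ev' (\sum_al c al *: emono (A := fibre_alg E' z) (fun a => eta' a z) (mexpo al)) p =
            ev (\sum_al c al *: emono (A := fibre_alg E z) (fun a => eta a z) (mexpo al)) p]].
Proof.
have [U [y [psi [eta [Ux ld]]]]] := dE x; have oU := gb_chart_open (ld_chart ld).
have ex a : exists s : forall x, E' x, ssmooth_at x s /\ \forall z \near x,
    s z \in gv_grade E' z (wgt a) /\ forall p, gb_proj p = z -> ev' (s z) p = y p 0 a.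
  apply: (dual_sections dE' oU Ux (g := fun p => y p 0 a)).
  - by rewrite dwt_gt0 dwt_le.
  - by move=> p Up; exact: (gb_chart_coord (ld_chart ld) a Up).
  - by move=> t p Up; rewrite (gb_chart_act (ld_chart ld)) // mxE.
pose eta' a := sval (cid (ex a)).
have H a : ssmooth_at x (eta' a) /\ \forall z \near x,
    eta' a z \in gv_grade E' z (wgt a) /\ forall p, gb_proj p = z -> ev' (eta' a z) p = y p 0 a.
  by rewrite /eta'; case: cid.
exists eta, eta'; split=> [a|a|]; [exact: (ld_smooth ld a Ux)|by case: (H a)|].
have nU : \forall z \near x, U z by apply: open_nbhs_nbhs.
have nH : \forall z \near x, forall a,
    eta' a z \in gv_grade E' z (wgt a) /\ forall p, gb_proj p = z -> ev' (eta' a z) p = y p 0 a.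
  by apply: filter_forall => a; case: (H a).
apply: filterS2 nU nH => z Uz Hz; split=> [|a|a|c p pz].
- exact: ld_basis ld _ Uz.
- exact: (ld_grade ld a Uz).
- by case: (Hz a).
subst z; rewrite (ld_eval ld Uz).
have e' : forall a, eta' a (gb_proj p) \in gv_grade E' (gb_proj p) (wgt a) by move=> a; case: (Hz a).
rewrite (character_eval (fibre_graded E' _) (@dwt_gt0 _ _) e' (dual_character dE' p)).
apply: eq_bigr => al _; congr (_ * mono _ _); apply/rowP => a; rewrite mxE.
by case: (Hz a) => _; exact.
Qed.

Lemma dual_vector_uniq x (v w : E' x) : (forall p, gb_proj p = x -> ev' v p = ev' w p) -> v = w.
Proof.
move=> H; apply/eqP; rewrite -subr_eq0; apply/eqP/(dual_separates dE') => p px; subst x.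
by rewrite addrC -scaleN1r (dual_character dE' p).1 H // mulN1r addNr.
Qed.

(** [h x v] is the vector of [E'] with the same pairings as [v]; locally it substitutes [eta'] for
    [eta] in the expansion of [v], which gives smoothness and the grading. *)
Lemma dual_vector_map : exists h : forall x, E x -> E' x,
  [/\ forall x v p, gb_proj p = x -> ev' (h x v) p = ev v p,
      forall x s, ssmooth_at x s -> ssmooth_at x (fun z => h z (s z))
    & forall x w v, v \in gv_grade E x w -> h x v \in gv_grade E' x w].
Proof.
have ex (xv : {x : M & E x}) : exists v' : E' (tag xv),
    forall p, gb_proj p = tag xv -> ev' v' p = ev (tagged xv) p.
  case: xv => x v /=; have [eta [eta' [_ _ /nbhs_singleton [[sp _] _ _ H]]]] := dual_transfer x.
  by have [c ->] := sp v; eexists; exact: H.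
pose h x (v : E x) : E' x := sval (cid (ex (existT (fun x => E x : Type) x v))).
have hE x v p : gb_proj p = x -> ev' (h x v) p = ev v p.
  by rewrite /h; case: cid => /= v' Hv' px; rewrite Hv'.
exists h; split=> //.
  move=> x s ss; have [eta [eta' [se se' near_x]]] := dual_transfer x.
  have [c Hc] : exists c : forall z, monomial k wgt -> R, \forall z \near x,
      s z = \sum_al c z al *: emono (A := fibre_alg E z) (fun a => eta a z) (mexpo al).
    have H z : exists c : monomial k wgt -> R,
        is_basis (fun al : monomial k wgt => emono (A := fibre_alg E z) (fun a => eta a z) (mexpo al)) ->
        s z = \sum_al c al *: emono (A := fibre_alg E z) (fun a => eta a z) (mexpo al).
      have [[sp _]|nb] := pselect (is_basis (fun al : monomial k wgt =>
          emono (A := fibre_alg E z) (fun a => eta a z) (mexpo al))); last by exists (fun=> 0).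
      by have [c Ec] := sp (s z); exists c.
    have [c Hc] := boolp.choice H; exists c.
    by apply: filterS near_x => z [b _ _ _]; exact: Hc.
  apply: (@ssmooth_at_near _ _ _ _ _ (fun z =>
     \sum_al c z al *: emono (A := fibre_alg E' z) (fun a => eta' a z) (mexpo al))).
    apply: filterS2 near_x Hc => z [_ _ _ H] sz; apply: dual_vector_uniq => p pz.
    by rewrite H // -sz hE.
  apply: (ssmooth_at_sum (F := fun al z =>
    c z al *: emono (A := fibre_alg E' z) (fun a => eta' a z) (mexpo al))) => al _.
  have d0 (be : monomial k wgt) : (0 < mdeg (mexpo be))%N.
    by apply: (mdeg_gt0 (wgt := wgt)); have /andP[] := mexpo_weight be.
  apply: ssmooth_atZ; last exact: ssmooth_at_emono.
  have [bx _ _ _] := nbhs_singleton near_x.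
  apply: (frame_coord (S := fun (be : monomial k wgt) z =>
     emono (A := fibre_alg E z) (fun a => eta a z) (mexpo be)) _ bx ss Hc).
  by move=> be; exact: ssmooth_at_emono.
move=> x w v vG; have [eta [eta' [_ _ /nbhs_singleton [b eG eG' H]]]] := dual_transfer x.
have [c [Hc vE]] := eval_homogeneous (fibre_graded E x) (@dwt_gt0 _ _) eG b vG.
have -> : h x v = \sum_al c al *: emono (A := fibre_alg E' x) (fun a => eta' a x) (mexpo al).
  by apply: dual_vector_uniq => p px; rewrite hE // H // vE.
apply: memv_suml => al _; have [->|/Hc <-] := eqVneq (c al) 0; first by rewrite scale0r mem0v.
apply: memvZ; apply: (emono_in (fibre_graded E' x) (@dwt_gt0 _ _)) => //.
by have /andP[] := mexpo_weight al.
Qed.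

End DualIso.

Lemma dual_pb_isomorphic (R : realType) (M : manifold R) (k : nat) (F : gradedBundle M k)
    (E E' : productBundle M k) (ev : forall x, E x -> F -> R) (ev' : forall x, E' x -> F -> R) :
  dual_pairing ev -> dual_pairing ev' -> pb_isomorphic E E'.
Proof.
move=> dE dE'; have [h [he hs hg]] := dual_vector_map dE dE'.
have [h' [he' hs' hg']] := dual_vector_map dE' dE.
have pM : is_premanifold M := manifold_premanifold (mfd_axioms M).
have hK x : cancel (h x) (h' x).
  by move=> v; apply: (dual_vector_uniq dE) => p px; rewrite he' // he.
have h'K x : cancel (h' x) (h x).
  by move=> v; apply: (dual_vector_uniq dE') => p px; rewrite he // he'.
have hL x : linear (h x).
  move=> c u v; apply: (dual_vector_uniq dE') => p px; rewrite he //; subst x.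
  by rewrite (dual_character dE p).1 (dual_character dE' p).1 !he.
pose f x : 'Hom(E x, E' x) := lfun_of (hL x).
have fE x v : f x v = h x v by exact: lfun_ofE.
exists f; split.
- move=> x; exists (h' x) => v; first by rewrite fE hK.
  by rewrite fE h'K.
- move=> phi psi Ap As u.
  have O : open (triv_dom phi `&` triv_dom psi) by apply: openI; exact: gv_open.
  apply/(smooth_onP _ pM (euclidean_premanifold R _) O) => x [px sx].
  apply/(smooth_at_euclidean _ _ pM) => b.
  have := ssmooth_at_triv (hs _ _ (ssmooth_at_const u Ap px)) As sx b.
  by apply: rsmooth_at_near; apply: filterE => z; rewrite fE.
- move=> x w; apply/vspaceP => v; apply/memv_imgP/idP => [[u uG ->]|vG].
    by rewrite fE; exact: hg.
  by exists (h' x v); [exact: hg'|rewrite fE h'K].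
- move=> x a b; rewrite !fE.
  apply: (@character_morphism R k (fibre_alg E x) (fibre_alg E' x) _ _ _ _ (h x)
    {p : F | gb_proj p = x} (fun p v => ev x v (sval p)) (fun p v => ev' x v (sval p))
    (fibre_graded E x) (fibre_graded E' x)).
  + exact: hL.
  + exact: hg.
  + by case=> p px /=; subst x; exact: dual_character dE p.
  + by case=> p px /=; subst x; exact: dual_character dE' p.
  + by case=> p px v /=; exact: he.
  + by move=> u v H; apply: (dual_vector_uniq dE') => p px; exact: (H (exist _ p px)).
Qed.

(** * Transport of pairings and correspondences along isomorphisms *)

Section Transport.
Variables (R : realType) (M : manifold R) (k : nat).

Lemma dual_pb_transport (F : gradedBundle M k) (E E' : productBundle M k)
    (ev : forall x, E x -> F -> R) : dual_pairing ev -> pb_isomorphic E E' ->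
  exists ev' : forall x, E' x -> F -> R, dual_pairing ev'.
Proof.
have pM : is_premanifold M := manifold_premanifold (mfd_axioms M).
move=> dE [f [bf sf gf mf]]; have kf x : lker (f x) == 0%VS.
  by apply/lker0P; have [g gK _] := bf x; exact: can_inj gK.
have fK x v : (f x)^-1%VF (f x v) = v by rewrite lker0_lfunK.
exists (fun x v => ev x ((f x)^-1%VF v)) => x.
have [U [y [psi [eta [Ux ld]]]]] := dE x; exists U, y, psi, (fun a z => f z (eta a z)).
have emal z (al : monomial k (dwt (d := gb_rank F))) :
   emono (A := fibre_alg E' z) (fun a => f z (eta a z)) (mexpo al) =
   f z (emono (A := fibre_alg E z) (fun a => eta a z) (mexpo al)).
  apply: (@emono_morph _ (fibre_alg E z) (fibre_alg E' z) (f z)) => [c u v|u v].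
    exact: linearP.
  exact: mf.
have fsum z (c : monomial k (dwt (d := gb_rank F)) -> R) : U z ->
   \sum_al c al *: emono (A := fibre_alg E' z) (fun a => f z (eta a z)) (mexpo al) =
   f z (\sum_al c al *: emono (A := fibre_alg E z) (fun a => eta a z) (mexpo al)).
  by move=> Uz; rewrite linear_sum; apply: eq_bigr => al _; rewrite emal // linearZ.
split=> //; split.
- exact: ld_chart ld.
- move=> z a Uz; have [phi Ap pz] := gv_cover E z; have [chi Ac cz] := gv_cover E' z.
  exists chi; split=> // b.
  have O : open (triv_dom phi `&` triv_dom chi) by apply: openI; exact: gv_open.
  have sm u c : rsmooth_at z (fun x => chi x (f x ((phi x)^-1%VF u)) 0 c).
    have /(smooth_onP _ pM (euclidean_premanifold R _) O)/(_ z (conj pz cz)) := sf _ _ Ap Ac u.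
    by move/(smooth_at_euclidean _ _ pM); exact.
  apply: (@rsmooth_at_near _ _ _ (fun x => \sum_c phi x (eta a x) 0 c *
     chi x (f x ((phi x)^-1%VF (delta_mx 0 c))) 0 b)).
    have : \forall x \near z, triv_dom phi x.
      by apply: open_nbhs_nbhs; split => //; exact: gv_open Ap.
    apply: filterS => x' px'; rewrite -[in RHS](triv_Kinv (eta a x') Ap px').
    rewrite [in RHS](row_sum_delta (phi x' (eta a x'))) !linear_sum summxE.
    by apply: eq_bigr => c _; rewrite !linearZ mxE.
  apply: (rsmooth_at_sum pM) => c _; apply: (rsmooth_atM pM) => //.
  exact: (ssmooth_at_triv (ld_smooth ld a Uz) Ap pz).
- by move=> z a Uz; rewrite -gf memv_img // (ld_grade ld).
- move=> z Uz; have [sp ind] := ld_basis ld Uz; split=> [v|c].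
    have [g _ gK] := bf z; have [c Hc] := sp (g v); exists c.
    by rewrite fsum // -Hc gK.
  by rewrite fsum // => /eqP; rewrite -(linear0 (f z)) (inj_eq (lker0P (kf z))) => /eqP /ind.
- by move=> p Up c; rewrite fsum // fK (ld_eval ld Up).
Qed.

Lemma corresponds_gb_transport (F F' : gradedBundle M k) (E : productBundle M k) :
  corresponds F E -> gb_isomorphic F F' -> corresponds F' E.
Proof.
have pM : is_premanifold M := manifold_premanifold (mfd_axioms M).
have pF : is_premanifold F := manifold_premanifold (mfd_axioms F).
have pF' : is_premanifold F' := manifold_premanifold (mfd_axioms F').
move=> [Phi [Pl Ph Pu Pm]] [f [g [[sf sg gf fg] pf af]]].
have {}gf p : g (f p) = p by have [] := gf p I.
have {}fg p : f (g p) = p by have [] := fg p I.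
have pg p : gb_proj (g p) = gb_proj p by rewrite -pf fg.
have ag t p : g (gb_act t p) = gb_act t (g p) by rewrite -{1}(fg p) -af gf.
move/(smooth_onP _ pF pF' openT): sf => sf; move/(smooth_onP _ pF' pF openT): sg => sg.
have homf w (h : F' -> R) : homogeneous w h -> homogeneous w (h \o f).
  move=> [/(smooth_funP _ pF') sh hh]; split; last by move=> t p; rewrite /= af hh.
  by apply/(smooth_funP _ pF) => p; apply: rsmooth_at_pullback => //; exact: sf.
have homg w (h : F -> R) : homogeneous w h -> homogeneous w (h \o g).
  move=> [/(smooth_funP _ pF) sh hh]; split; last by move=> t p; rewrite /= ag hh.
  by apply/(smooth_funP _ pF') => p; apply: rsmooth_at_pullback => //; exact: sg.
exists (fun s p => Phi s (g p)); split.
- by move=> a s s' sa ss ss' p; rewrite Pl // pg.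
- by move=> w s wk gs; exact: homg (Ph _ _ wk gs).
- move=> w h wk hh; have [s [[gs Ps] us]] := Pu _ _ wk (homf _ _ hh).
  exists s; split; first by split=> //; apply/funext => p; rewrite Ps /= fg.
  move=> s' [gs' Ps']; apply: us; split=> //; apply/funext => p.
  by rewrite /= -Ps' gf.
- by move=> i j s s' i0 j0 ij gs gs' p; exact: (Pm i j).
Qed.

End Transport.

(** * The pairing of a correspondence *)

Lemma rsmooth_at_nearby (R : realType) (X : chartedSpace R) (x : X) (f : X -> R) :
  is_premanifold X -> rsmooth_at x f -> \forall z \near x, rsmooth_at z f.
Proof.
move=> pX [a [W [tau [Aa ax [oW Wx] CW ft]]]].
have : nbhs x [set z | f z = tau (a z)] by exact: ft.
rewrite nbhsE => -[B [oB Bx] BP].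
have nB : \forall z \near x, B z by apply: open_nbhs_nbhs.
have nd : \forall z \near x, chart_dom a z.
  by apply: open_nbhs_nbhs; split => //; exact: (pmf_open_dom pX).
have nW : \forall z \near x, W (a z).
  by apply: (pmf_chart_continuous pX Aa ax); exact: open_nbhs_nbhs.
apply: filterS3 nB nd nW => z Bz dz Wz; exists a, W, tau; split=> //.
by apply: filterS (open_nbhs_nbhs (conj oB Bz)) => q /BP.
Qed.

Section Extension.
Variables (R : realType) (M : manifold R) (k : nat) (E : gradedVectorBundle M k).
Let pM : is_premanifold M := manifold_premanifold (mfd_axioms M).

Lemma ssmooth_at_cutoff (O : set M) (rho : M -> R) (s : forall x, E x) :
  (forall x, rsmooth_at x rho) -> (forall x, ~ O x -> \forall z \near x, rho z = 0) ->
  (forall x, O x -> ssmooth_at x s) -> smooth_section (fun x => rho x *: s x).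
Proof.
move=> sr r0 ss; apply/smooth_sectionP => x; have [Ox|/r0 H] := pselect (O x).
  by apply: ssmooth_atZ => //; exact: ss.
by apply: ssmooth_at_near (ssmooth_at0 E x); apply: filterS H => z ->; rewrite scale0r.
Qed.

(** Constant in a trivialization, then cut off. Trivializations respect the grading, so the
    extension stays in every graded piece containing [v]. *)
Lemma section_extension x (v : E x) : exists s : forall z, E z,
  [/\ smooth_section s, s x = v
    & forall w, v \in gv_grade E x w -> forall z, s z \in gv_grade E z w].
Proof.
have [phi Ap px] := gv_cover E x.
have [rho [sr r1 r0]] := bump_function (gv_open Ap) px.
exists (fun z => rho z *: (phi z)^-1%VF (phi x v)); split.
- by apply: (ssmooth_at_cutoff sr r0) => z pz; exact: ssmooth_at_const.
- by rewrite (nbhs_singleton r1) scale1r triv_Kinv.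
- move=> w /(gv_gradeP w _ Ap px) vw z; have [pz|/r0 /nbhs_singleton ->] := pselect (triv_dom phi z).
    apply: memvZ; apply/(gv_gradeP w _ Ap pz) => b nb; rewrite triv_invK //; exact: vw.
  by rewrite scale0r mem0v.
Qed.

End Extension.

Lemma rsmooth_at_cutoff (R : realType) (X : chartedSpace R) (O : set X) (rho f : X -> R) :
  is_premanifold X ->
  (forall x, rsmooth_at x rho) -> (forall x, ~ O x -> \forall z \near x, rho z = 0) ->
  (forall x, O x -> rsmooth_at x f) -> forall x, rsmooth_at x (fun z => rho z * f z).
Proof.
move=> pX sr r0 sf x; have [Ox|/r0 H] := pselect (O x).
  by apply: rsmooth_atM => //; exact: sf.
apply: rsmooth_at_near (rsmooth_at_cst x 0 pX).
by apply: filterS H => z ->; rewrite mul0r.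
Qed.

Section CorrespondsDual.
Variables (R : realType) (M : manifold R) (k : nat) (F : gradedBundle M k) (E : productBundle M k).
Let pM : is_premanifold M := manifold_premanifold (mfd_axioms M).
Let pF : is_premanifold F := manifold_premanifold (mfd_axioms F).
Local Notation n := (\sum_i gb_rank F i)%N.
Local Notation wgt := (dwt (d := gb_rank F)).
Variable Phi : (forall x, E x) -> F -> R.
Hypothesis Phi_lin : forall (f : M -> R) (s s' : forall x, E x), smooth_fun f ->
  smooth_section s -> smooth_section s' -> forall p,
  Phi (fun x => f x *: s x + s' x) p = f (gb_proj p) * Phi s p + Phi s' p.
Hypothesis Phi_hom : forall w s, (1 <= w <= k)%N -> graded_section w s ->
  homogeneous w (Phi s).
Hypothesis Phi_bij : forall w g, (1 <= w <= k)%N -> homogeneous w g ->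
  exists! s, graded_section w s /\ Phi s = g.
Hypothesis Phi_mul : forall i j s s', (1 <= i)%N -> (1 <= j)%N -> (i + j <= k)%N ->
  graded_section i s -> graded_section j s' -> forall p,
  Phi (fun x => pb_prod E x (s x) (s' x)) p = Phi s p * Phi s' p.

Let smooth_section0 : smooth_section (fun x => 0 : E x).
Proof. by apply/smooth_sectionP => x; exact: ssmooth_at0. Qed.

Let smooth_sectionL f s s' : smooth_fun f -> smooth_section s -> smooth_section s' ->
  smooth_section (fun x => f x *: s x + s' x : E x).
Proof.
move=> /(smooth_funP _ pM) sf /smooth_sectionP ss /smooth_sectionP ss'.
by apply/smooth_sectionP => x; apply: ssmooth_atD => //; exact: ssmooth_atZ.
Qed.

Let smooth_cst c : smooth_fun (fun _ : M => c).
Proof. by apply/(smooth_funP _ pM) => x; exact: rsmooth_at_cst. Qed.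

Lemma Phi0 p : Phi (fun=> 0) p = 0.
Proof.
have := Phi_lin (smooth_cst (-1)) smooth_section0 smooth_section0 p.
rewrite mulN1r addNr => <-; congr (Phi _ p).
by apply: functional_extensionality_dep => x; rewrite scaler0 addr0.
Qed.

Lemma PhiZ f s p : smooth_fun f -> smooth_section s ->
  Phi (fun x => f x *: s x) p = f (gb_proj p) * Phi s p.
Proof.
move=> sf ss; have := Phi_lin sf ss smooth_section0 p; rewrite Phi0 addr0 => <-.
by congr (Phi _ p); apply: functional_extensionality_dep => x; rewrite addr0.
Qed.

Lemma Phi_sum (I : finType) (f : I -> M -> R) (s : I -> forall x, E x) p :
  (forall i, smooth_fun (f i)) -> (forall i, smooth_section (s i)) ->
  Phi (fun x => \sum_i f i x *: s i x) p = \sum_i f i (gb_proj p) * Phi (s i) p.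
Proof.
move=> sf ss; suff H (r : seq I) : smooth_section (fun x => \sum_(i <- r) f i x *: s i x : E x) /\
    Phi (fun x => \sum_(i <- r) f i x *: s i x) p = \sum_(i <- r) f i (gb_proj p) * Phi (s i) p.
  by case: (H (index_enum I)).
elim: r => [|i r [IH1 IH2]].
  have -> : (fun x => \sum_(i <- [::]) f i x *: s i x) = (fun x => 0 : E x).
    by apply: functional_extensionality_dep => x; rewrite big_nil.
  by rewrite Phi0 big_nil.
have -> : (fun x => \sum_(j <- i :: r) f j x *: s j x) =
    (fun x => f i x *: s i x + \sum_(j <- r) f j x *: s j x : E x).
  by apply: functional_extensionality_dep => x; rewrite big_cons.
split; first exact: (smooth_sectionL (sf i) (ss i) IH1).
by rewrite (Phi_lin (sf i) (ss i) IH1 p) IH2 big_cons.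
Qed.

(* [rho ^ 2 s] is a combination of global sections whose coefficients vanish
   wherever [s] does. *)
Lemma Phi_local s p : smooth_section s -> s (gb_proj p) = 0 -> Phi s p = 0.
Proof.
move=> ss sp; set x := gb_proj p in sp.
have [phi Ap px] := gv_cover E x.
have [rho [sr r1 r0]] := bump_function (gv_open Ap) px.
have r1x := nbhs_singleton r1.
have r1E : rho x = 1 by [].
pose f b z := rho z * phi z (s z) 0 b.
pose t b z := rho z *: (phi z)^-1%VF (delta_mx 0 b).
have sf b : smooth_fun (f b).
  apply/(smooth_funP _ pM); apply: (rsmooth_at_cutoff pM sr r0) => z pz.
  by apply: ssmooth_at_triv => //; move/smooth_sectionP: ss.
have st b : smooth_section (t b).
  by apply: (ssmooth_at_cutoff sr r0) => z pz; exact: ssmooth_at_const.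
have sr2 : smooth_fun (fun z => rho z * rho z).
  by apply/(smooth_funP _ pM) => z; exact: (rsmooth_atM pM).
have E1 : (fun z => (rho z * rho z) *: s z) = (fun z => \sum_b f b z *: t b z).
  apply: functional_extensionality_dep => z.
  have [pz|/r0 /nbhs_singleton z0] := pselect (triv_dom phi z); last first.
    rewrite z0 mul0r scale0r big1 // => b _.
    by rewrite /f z0 mul0r scale0r.
  rewrite -{1}(triv_Kinv (s z) Ap pz) {1}(row_sum_delta (phi z (s z))) linear_sum scaler_sumr.
  apply: eq_bigr => b _; rewrite linearZ /f /t !scalerA; congr (_ *: _).
  by rewrite -!mulrA; congr (_ * _); rewrite mulrC.
have := PhiZ p sr2 ss; rewrite -/x r1E !mul1r => <-.
rewrite E1 Phi_sum // big1 // => b _.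
by rewrite /f -/x sp linear0 mxE mulr0 mul0r.
Qed.

Lemma Phi_eq s s' p : smooth_section s -> smooth_section s' ->
  s (gb_proj p) = s' (gb_proj p) -> Phi s p = Phi s' p.
Proof.
move=> ss ss' e; apply/eqP; rewrite -subr_eq0 addrC -mulN1r; apply/eqP.
rewrite -(Phi_lin (smooth_cst (-1)) ss' ss p).
apply: (Phi_local (smooth_sectionL (smooth_cst (-1)) ss' ss)).
by rewrite e scaleN1r addNr.
Qed.

Definition extension x (v : E x) : forall z, E z := sval (cid (section_extension v)).

Lemma extensionP x (v : E x) : [/\ smooth_section (extension v), extension v x = v
    & forall w, v \in gv_grade E x w -> forall z, extension v z \in gv_grade E z w].
Proof. by rewrite /extension; case: cid. Qed.

(** Meaningful when [x] is the base point of [p]; there [Phi_eq] makes the choice of the extension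
    irrelevant. *)
Definition pairing x (v : E x) (p : F) : R := Phi (extension v) p.

Lemma pairingE s p : smooth_section s -> pairing (s (gb_proj p)) p = Phi s p.
Proof. by move=> ss; have [sv ev _] := extensionP (s (gb_proj p)); exact: Phi_eq. Qed.

Lemma pairing_character p : is_character k (A := fibre_alg E (gb_proj p))
  (gv_grade E (gb_proj p)) (fun v => pairing v p).
Proof.
set x := gb_proj p.
have lin c (u v : E x) : pairing (c *: u + v) p = c * pairing u p + pairing v p.
  have [su eu _] := extensionP u; have [sv ev _] := extensionP v.
  have := pairingE p (smooth_sectionL (smooth_cst c) su sv); rewrite -/x /= eu ev => ->.
  exact: Phi_lin (smooth_cst c) su sv p.
split=> // i j u v uG vG ij; have gA := fibre_graded E x.
have p0 : pairing (0 : E x) p = 0.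
  by have := lin (-1) 0 0; rewrite scaler0 addr0 mulN1r addNr.
have [i0|i0] := posnP i.
  have u0 : u = 0 by apply: (gr_out gA uG); rewrite i0.
  by rewrite u0 p0 mul0r linear0 lfunE.
have [j0|j0] := posnP j.
  have v0 : v = 0 by apply: (gr_out gA vG); rewrite j0.
  by rewrite v0 p0 mulr0 linear0.
have [su eu gu] := extensionP u; have [sv ev gv] := extensionP v.
rewrite /pairing -(Phi_mul i0 j0 ij (conj su (gu _ uG)) (conj sv (gv _ vG)) p).
have ss : smooth_section (fun z => pb_prod E z (extension u z) (extension v z)).
  by apply/smooth_sectionP => z; apply: ssmooth_at_prod; [move/smooth_sectionP: su|move/smooth_sectionP: sv].
by have := pairingE p ss; rewrite -/x /= eu ev.
Qed.

(** Coordinate functions multiplied by a bump function are global homogeneous functions, hence come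
    from global sections [eta], the future generators. Their monomials are independent because they
    are so as functions on the fibre of [F]; they span by the injectivity of [Phi]. *)
Lemma pairing_dual : dual_pairing pairing.
Proof.
move=> x; have [U [y [psi [oU Ux dU aU]]]] := @gb_locally_trivial _ _ _ F x.
have ch : gb_chart U y psi by [].
have [rho [sr r1 r0]] := bump_function oU Ux.
have : nbhs x [set z | rho z = 1] by exact: r1.
rewrite nbhsE => -[V0 [oV0 V0x] V0P].
(* Over [V] the bump function is 1, so that [Y a] is the coordinate itself. *)
pose V := U `&` V0; have oV : open V by exact: openI.
have r0F p : ~ U (gb_proj p) -> \forall q \near p, rho (@gb_proj _ _ _ F q) = 0.
  by move=> nU; exact: (near_gb_proj (r0 _ nU)).
pose Y a p := rho (@gb_proj _ _ _ F p) * y p 0 a.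
have hY a : homogeneous (wgt a) (Y a).
  split.
    apply/(smooth_funP _ pF); apply: (rsmooth_at_cutoff (O := @gb_proj _ _ _ F @^-1` U) pF) => // p.
      exact: rsmooth_at_base.
    by move=> Up; exact: (gb_chart_coord ch a Up).
  move=> t p; rewrite /Y gb_proj_act; have [Up|nU] := pselect (U (gb_proj p)).
    by rewrite (gb_chart_act ch) // mxE mulrCA.
  by rewrite (nbhs_singleton (r0 _ nU)) !mul0r mulr0.
have wk a : (1 <= wgt a <= k)%N by rewrite dwt_gt0 dwt_le.
have ex a : exists s, graded_section (wgt a) s /\ Phi s = Y a.
  by have [s [H _]] := Phi_bij (wk a) (hY a); exists s.
pose eta a := sval (cid (ex a)).
have [/all_and2 [se eG] eY] : (forall a, graded_section (wgt a) (eta a)) /\ (forall a, Phi (eta a) = Y a).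
  by split=> a; rewrite /eta; case: cid => s [].
have seP z a : ssmooth_at z (eta a) by move/smooth_sectionP: (se a).
have pe p a : pairing (eta a (gb_proj p)) p = Y a p by rewrite pairingE // eY.
have Yy p : V (gb_proj p) -> (\row_a Y a p) = y p.
  by move=> [_ Vp]; apply/rowP => a; rewrite mxE /Y (V0P _ Vp) mul1r.
have rowE p : (\row_a pairing (eta a (gb_proj p)) p) = (\row_a Y a p).
  by apply/rowP => a; rewrite !mxE pe.
exists V, y, psi, eta; split; first by [].
have evP p : V (gb_proj p) -> @is_eval R k (fibre_alg E (gb_proj p)) _ wgt
    (fun a => eta a (gb_proj p)) (y p) (fun v => pairing v p).
  move=> Vp; rewrite -(Yy p Vp) -rowE.
  exact: (character_eval (fibre_graded E _) (@dwt_gt0 _ _) (fun a => eG a _) (pairing_character p)).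
have chV : gb_chart V y psi.
  split=> //; last by move=> t p [Up _]; case: ch => _ _; exact.
  case: dU => s1 s2 K1 K2; have pMn : is_premanifold (prod_space M (euclidean R n)).
    exact: prod_premanifold pM (euclidean_premanifold R n).
  have oX (W : set M) : open W -> @open (prod_space M (euclidean R n)) (W `*` setT).
    move=> oW; rewrite openE => -[z v] [Wz _]; exists (W, setT) => //=; split; last exact: filterT.
    exact: open_nbhs_nbhs.
  split.
  - move/(smooth_onP _ pF pMn (open_gb_proj F oU)): s1 => s1.
    by apply/(smooth_onP _ pF pMn (open_gb_proj F oV)) => p [Up _]; exact: s1.
  - move/(smooth_onP _ pMn pF (oX _ oU)): s2 => s2.
    by apply/(smooth_onP _ pMn pF (oX _ oV)) => -[z v] [[Uz _] _]; exact: s2.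
  - by move=> p [Up Vp]; have [_ ?] := K1 p Up.
  - move=> [z v] [[Uz Vz] _]; have [pz yz] := gb_chart_psi ch v Uz.
    by split; [rewrite /preimage /= pz|rewrite pz yz].
split=> //.
move=> z Vz; split; last first.
    move=> c c0; apply: mono_indep => u.
    have [pz yu] := gb_chart_psi chV u Vz.
    have := evP (psi (z, u)); rewrite pz yu => /(_ Vz c); rewrite c0.
    have := character0 (pairing_character (psi (z, u))); rewrite pz => ->.
    by move=> <-.
  pose inspan (v : E z) := exists c : monomial k wgt -> R,
    v = \sum_al c al *: emono (A := fibre_alg E z) (fun a => eta a z) (mexpo al).
  have sp0 : inspan 0 by exists (fun=> 0); rewrite big1 // => al _; rewrite scale0r.
  have spL c u v : inspan u -> inspan v -> inspan (c *: u + v).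
    move=> [cu ->] [cv ->]; exists (fun al => c * cu al + cv al).
    by rewrite scaler_sumr -big_split; apply: eq_bigr => al _ /=; rewrite scalerDl scalerA.
  suff H w v : (1 <= w <= k)%N -> v \in gv_grade E z w -> inspan v.
    move=> v; rewrite (gr_pr_sum (fibre_graded E z) v).
    apply: (big_rec inspan) => // i u _ Hu; rewrite -[fibre_pr _ _]scale1r; apply: spL => //.
    by apply: (H i.+1); [exact: ltn_ord|exact: (gr_pr_in (fibre_graded E z))].
  (* Around [z] the function [Phi (extension v)] is a polynomial in [y]; as
     [Phi] is injective, [v] is the same polynomial in [eta]. *)
  move=> wk' vG; have [ss sz sG] := extensionP v.
  have gs : graded_section w (extension v) by split=> //; exact: sG.
  have [/(smooth_funP _ pF) sg hg] := Phi_hom wk' gs.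
  have sG' z' u : V z' -> @rsmooth_at R (prod_space M (euclidean R n)) (z', u) (Phi (extension v) \o psi).
    move=> Vz'; apply: rsmooth_at_pullback => //.
      exact: prod_premanifold pM (euclidean_premanifold R n).
    exact: (gb_chart_psi_smooth chV u Vz').
  have hG' t z' u : V z' -> (Phi (extension v) \o psi) (z', wscale wgt t u) =
      t ^+ w * (Phi (extension v) \o psi) (z', u).
    by move=> Vz' /=; rewrite (gb_chart_psi_act chV) // hg.
  have [l [Hl El]] := homogeneous_polynomial pM (@dwt_gt0 _ _) oV Vz sG' hG'.
  have nl : \forall z' \near z, List.Forall (fun c => rsmooth_at z' c.1 /\ mweight wgt c.2 = w) l.
    elim: Hl => [|c l' [sc wc] _ IH]; first by apply: filterE => z'; constructor.
    by apply: filterS2 (rsmooth_at_nearby pM sc) IH => z' sc' IH'; constructor.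
  have nV : \forall z' \near z, V z' by apply: open_nbhs_nbhs.
  have : nbhs z [set z' | [/\ V z', List.Forall (fun c => rsmooth_at z' c.1 /\ mweight wgt c.2 = w) l
      & forall u, (Phi (extension v) \o psi) (z', u) = \sum_(c <- l) c.1 z' * mono c.2 u]].
    by apply: filterS3 nV nl El => z' ? ? ?; split.
  rewrite nbhsE => -[B [oB Bz] BP].
  (* [Phi] is only known to be injective on global sections: both sides of the local expansion are
     multiplied by a function that is 1 at [z] and vanishes outside [B]. *)
  have [rho2 [sr2 r21 r20]] := bump_function oB Bz.
  pose l' := [seq ((fun x => rho2 x * c.1 x), c.2) | c : (M -> R) * ('I_n -> nat) <- l].
  have Hl' x' : List.Forall (fun c => rsmooth_at x' c.1 /\ mweight wgt c.2 = w) l'.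
    have [Bx'|nB] := pselect (B x').
      have [_ + _] := BP _ Bx'; rewrite /l'; elim: l {Hl El nl BP l'} => [|c l IH] H; first by constructor.
      inversion_clear H as [|? ? [sc wc] H']; constructor; last exact: IH.
      by split=> //=; exact: (rsmooth_atM pM).
    rewrite /l'; elim: Hl => [|c l0 [_ wc] _ IH]; constructor => //; split=> //=.
    apply: rsmooth_at_near (rsmooth_at_cst x' 0 pM).
    by apply: filterS (r20 _ nB) => q ->; rewrite mul0r.
  have wl' : List.Forall (fun c => mweight wgt c.2 = w) l'.
    by elim: (Hl' z) => [|c l0 [_ wc] _ IH]; constructor.
  have w0 : (0 < w)%N by case/andP: wk'.
  pose T x' := rho2 x' *: extension v x'; pose T' := poly_section eta l'.
  have gT : graded_section w T.
    split; last by move=> x'; apply: memvZ; exact: sG.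
    apply/smooth_sectionP => x'; apply: ssmooth_atZ => //.
    by move/smooth_sectionP: ss.
  have gT' : graded_section w T'.
    split; last by move=> x'; exact: (poly_graded (@dwt_gt0 _ _) (fun a => eG a x') w0 wl').
    apply/smooth_sectionP => x'; apply: ssmooth_at_poly => //.
    elim: (Hl' x') => [|c l0 [sc wc] _ IH]; constructor => //; split=> //.
    by apply: (mdeg_gt0 (wgt := wgt)); rewrite wc.
  have PT' : Phi T' = Phi T.
    apply/funext => p; rewrite -(pairingE p gT'.1).
    rewrite (character_poly (@dwt_gt0 _ _) (pairing_character p) (fun a => eG a _) wk' wl') rowE.
    rewrite (PhiZ p _ ss); last by apply/(smooth_funP _ pM).
    rewrite /l' big_map /=.
    have -> : \sum_(c <- l) rho2 (gb_proj p) * c.1 (gb_proj p) * mono c.2 (\row_a Y a p) =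
       rho2 (gb_proj p) * \sum_(c <- l) c.1 (gb_proj p) * mono c.2 (\row_a Y a p).
      by rewrite mulr_sumr; apply: eq_bigr => c _; rewrite mulrA.
    have [Bp|/r20 /nbhs_singleton ->] := pselect (B (gb_proj p)); last by rewrite !mul0r.
    have [Vp _ Ep] := BP _ Bp; rewrite Yy // -Ep /= (gb_chartK chV) //.
  have TT' : T = T'.
    have [s0 [_ us]] := Phi_bij wk' (Phi_hom wk' gT).
    by rewrite -(us T) // -(us T').
  have -> : v = T' z by rewrite -TT' /T (nbhs_singleton r21) scale1r.
  rewrite /T' /poly_section; elim: wl' => [|c l0 wc _ IH]; first by rewrite big_nil.
  rewrite big_cons; apply: spL => //.
  have [al Hal] : exists al : monomial k wgt, mexpo al =1 c.2.
    by apply: (monomialP (@dwt_gt0 _ _)); rewrite wc.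
  exists (fun be => (be == al)%:R); rewrite (bigD1 al) //= eqxx scale1r.
  rewrite [X in _ = _ + X](_ : _ = 0) ?addr0; first by rewrite (eq_emono _ Hal).
  by apply: big1 => be /negbTE ->; rewrite scale0r.
Qed.

End CorrespondsDual.

Theorem corresponds_dual (R : realType) (M : manifold R) (k : nat) (F : gradedBundle M k)
    (E : productBundle M k) : corresponds F E ->
  exists ev : forall x, E x -> F -> R, dual_pairing ev.
Proof.
by move=> [Phi [Pl Ph Pu Pm]]; exists (pairing Phi); exact: pairing_dual.
Qed.

(** * The product bundle of a graded bundle *)

Section TruncatedPolynomials.
Variables (R : realType) (k n : nat) (wgt : 'I_n -> nat).
Hypotheses (wgt_gt0 : forall a, (0 < wgt a)%N) (wgt_le : forall a, (wgt a <= k)%N).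
Local Notation mon := (monomial k wgt).

Definition tpoly : vectType R := {ffun mon -> R^o}.

Definition tbasis (al : mon) : tpoly := [ffun be => (be == al)%:R : R^o].

Definition is_sum (ga al be : mon) : bool :=
  [forall a, mexpo ga a == (mexpo al a + mexpo be a)%N].

(** The product of polynomials truncated above weight [k]: pairs of monomials whose weights add up
    to more than [k] match no [ga]. *)
Definition tpoly_mul (u v : tpoly) : tpoly :=
  [ffun ga => \sum_al \sum_be ((is_sum ga al be)%:R * (u al * v be) : R) : R^o].

Lemma tpoly_sum (v : tpoly) : v = \sum_al v al *: tbasis al.
Proof.
apply/ffunP => be; rewrite sum_ffunE (bigD1 be) //= !ffunE eqxx big1 ?addr0.
  by rewrite /GRing.scale /= mulr1.
by move=> al /negbTE ne; rewrite !ffunE eq_sym ne /GRing.scale /= mulr0.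
Qed.

Lemma tpoly_coef (c : mon -> R) be : (\sum_al c al *: tbasis al) be = c be.
Proof.
rewrite sum_ffunE (bigD1 be) //= !ffunE eqxx big1 ?addr0.
  by rewrite /GRing.scale /= mulr1.
by move=> al /negbTE ne; rewrite !ffunE eq_sym ne /GRing.scale /= mulr0.
Qed.

Lemma tpoly_mulC u v : tpoly_mul u v = tpoly_mul v u.
Proof.
apply/ffunP => ga; rewrite !ffunE exchange_big; apply: eq_bigr => be _; apply: eq_bigr => al _.
rewrite [u al * _]mulrC; congr ((nat_of_bool _)%:R * _).
by apply: eq_forallb => a; rewrite addnC.
Qed.

Lemma tpoly_mul_linear u : linear (tpoly_mul u).
Proof.
move=> c v w; apply/ffunP => ga; rewrite !ffunE /GRing.scale /= mulr_sumr -big_split.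
apply: eq_bigr => al _ /=; rewrite mulr_sumr -big_split; apply: eq_bigr => be _ /=.
by rewrite !ffunE /GRing.scale /=; ring.
Qed.

Lemma tpoly_mul_linear2 : linear (fun u => lfun_of (tpoly_mul_linear u)).
Proof.
move=> c u v; apply/lfunP => w.
rewrite add_lfunE scale_lfunE !lfun_ofE ![tpoly_mul _ w]tpoly_mulC.
by rewrite tpoly_mul_linear.
Qed.

Lemma is_sum_eq ga ga' al be : is_sum ga al be -> is_sum ga' al be -> ga = ga'.
Proof.
move=> /forallP H /forallP H'; apply: mexpo_inj => a.
by rewrite (eqP (H a)) (eqP (H' a)).
Qed.

(** An expression symmetric in the three factors, from which associativity follows with
    commutativity. Truncation does no harm: the intermediate monomial has weight at most that of
    [ga], so it exists. *)
Lemma tpoly_mul3E u v w ga : tpoly_mul (tpoly_mul u v) w ga =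
  \sum_al \sum_be \sum_de ([forall a, mexpo ga a == (mexpo al a + mexpo be a + mexpo de a)%N]%:R
    * (u al * v be * w de)) :> R.
Proof.
rewrite ffunE.
transitivity (\sum_al \sum_be \sum_de \sum_mu
   ((is_sum ga mu de)%:R * (is_sum mu al be)%:R * (u al * v be * w de)) : R).
  under eq_bigr do under eq_bigr do rewrite ffunE mulr_suml mulr_sumr.
  under eq_bigr do rewrite exchange_big /=.
  rewrite exchange_big /=; apply: eq_bigr => al _.
  under eq_bigr do under eq_bigr do rewrite mulr_suml mulr_sumr.
  under eq_bigr do rewrite exchange_big /=.
  rewrite exchange_big /=; apply: eq_bigr => be _.
  rewrite exchange_big /=; apply: eq_bigr => de _; apply: eq_bigr => m _.
  by rewrite -!mulrA.
apply: eq_bigr => al _; apply: eq_bigr => be _; apply: eq_bigr => de _.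
rewrite -mulr_suml; congr (_ * _); set P := [forall a, _].
have [HP|nP] := boolP P; last first.
  rewrite big1 // => m _; apply/eqP; rewrite -natrM pnatr_eq0 muln_eq0.
  apply: contraR nP; rewrite negb_or !eqb0 !negbK => /andP[/forallP H1 /forallP H2].
  by apply/forallP => a; rewrite (eqP (H1 a)) (eqP (H2 a)).
have [m Hm] : exists m : mon, mexpo m =1 (fun a => mexpo al a + mexpo be a)%N.
  apply: monomialP => //; rewrite mweightD addn_gt0.
  have /andP[-> _] /= := mexpo_weight al; have /andP[_ gk] := mexpo_weight ga.
  have wga : mweight wgt (mexpo ga) =
      (mweight wgt (fun a => mexpo al a + mexpo be a) + mweight wgt (mexpo de))%N.
    by rewrite -mweightD; apply: eq_mweight => a; apply/eqP; exact: (forallP HP a).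
  by apply: leq_trans gk; rewrite -mweightD wga leq_addr.
have s1 : is_sum m al be by apply/forallP => a; rewrite Hm.
have s2 : is_sum ga m de by apply/forallP => a; rewrite Hm; exact: (forallP HP a).
rewrite (bigD1 m) //= s1 s2 mulr1 big1 ?addr0 // => m' m'm.
case: (boolP (is_sum m' al be)) => [s3|_]; last by rewrite mulr0.
by rewrite (is_sum_eq s3 s1) eqxx in m'm.
Qed.

Lemma tpoly_mulA u v w : tpoly_mul (tpoly_mul u v) w = tpoly_mul u (tpoly_mul v w).
Proof.
rewrite [RHS]tpoly_mulC; apply/ffunP => ga; rewrite !tpoly_mul3E.
rewrite exchange_big /=; apply: eq_bigr => be _.
rewrite exchange_big /=; apply: eq_bigr => de _; apply: eq_bigr => al _.
congr (_ * _); last by rewrite [RHS]mulrC mulrA.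
by congr (nat_of_bool _)%:R; apply: eq_forallb => a; congr (_ == _); rewrite -addnA addnC.
Qed.

Definition tpoly_prod : 'Hom(tpoly, 'End(tpoly)) := lfun_of tpoly_mul_linear2.

Lemma tpoly_prodE u v : tpoly_prod u v = tpoly_mul u v.
Proof. by rewrite !lfun_ofE. Qed.

Lemma tpoly_prodC u v : tpoly_prod u v = tpoly_prod v u.
Proof. by rewrite !tpoly_prodE tpoly_mulC. Qed.

Lemma tpoly_prodA u v w : tpoly_prod (tpoly_prod u v) w = tpoly_prod u (tpoly_prod v w).
Proof. by rewrite !tpoly_prodE tpoly_mulA. Qed.

Definition tpoly_alg : nalg R := Nalg tpoly_prodC tpoly_prodA.

Definition tgrade (w : nat) : {vspace tpoly} :=
  <<[seq tbasis al | al <- enum mon & mweight wgt (mexpo al) == w]>>%VS.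

Lemma tgradeP w (v : tpoly) :
  v \in tgrade w <-> forall al, mweight wgt (mexpo al) != w -> v al = 0.
Proof.
split=> H; last first.
  rewrite (tpoly_sum v); apply: memv_suml => al _.
  have [wal|/H ->] := eqVneq (mweight wgt (mexpo al)) w; last by rewrite scale0r mem0v.
  apply/memvZ/memv_span/mapP; exists al => //.
  by rewrite mem_filter wal eqxx mem_enum.
move=> al; rewrite /tgrade in H; set X := [seq _ | _ <- _ & _] in H.
have -> := coord_span (H : v \in <<in_tuple X>>%VS); rewrite sum_ffunE => nal.
rewrite big1 // => i _; rewrite ffunE.
have : X`_i \in X by apply: mem_nth.
move=> /mapP [be]; rewrite mem_filter => /andP[/eqP wb _] ->; rewrite ffunE.
case: eqVneq => [E|]; last by rewrite /GRing.scale /= mulr0.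
by rewrite E wb eqxx in nal.
Qed.

Definition tpr (w : nat) (v : tpoly) : tpoly :=
  [ffun al => if mweight wgt (mexpo al) == w then v al else 0].

Lemma tpoly_graded : @is_graded_alg R k tpoly_alg tgrade tpr.
Proof.
split.
- move=> i j u v /tgradeP ui /tgradeP vj; rewrite /= tpoly_prodE; apply/tgradeP => ga nga.
  rewrite ffunE big1 // => al _; rewrite big1 // => be _.
  have [s|_] := boolP (is_sum ga al be); last by rewrite mul0r.
  have [wi|/ui ->] := eqVneq (mweight wgt (mexpo al)) i; last by rewrite mul0r mulr0.
  have [wj|/vj ->] := eqVneq (mweight wgt (mexpo be)) j; last by rewrite !mulr0.
  case/eqP: nga; rewrite -wi -wj -mweightD; apply: eq_mweight => a.
  by apply/eqP; exact: (forallP s a).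
- move=> w c u v; apply/ffunP => al; rewrite !ffunE; case: ifP => // _.
  by rewrite scaler0 addr0.
- by move=> w v; apply/tgradeP => al /negbTE nal; rewrite ffunE nal.
- by move=> w v /tgradeP vw; apply/ffunP => al; rewrite ffunE; case: eqVneq => // /vw ->.
- move=> w w' v /tgradeP vw ww'; apply/ffunP => al; rewrite !ffunE; case: eqP => // wal.
  by apply: vw; rewrite wal.
- move=> v; apply/ffunP => al; rewrite sum_ffunE.
  have /andP[w0 wk] := mexpo_weight al.
  have ik : ((mweight wgt (mexpo al)).-1 < k)%N by rewrite prednK.
  rewrite (bigD1 (Ordinal ik)) //= ffunE prednK // eqxx big1 ?addr0 // => i ni.
  rewrite ffunE; case: eqP => // wi; case/eqP: ni; apply: val_inj => /=.
  by rewrite wi.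
Qed.

Local Notation gen := (mgen wgt_gt0 wgt_le).

Definition tgen (a : 'I_n) : tpoly := tbasis (gen a).

Lemma tgen_in a : tgen a \in tgrade (wgt a).
Proof.
apply/tgradeP => al nal; rewrite ffunE; case: eqVneq => // E; case/eqP: nal.
by rewrite E (eq_mweight _ (mgenE wgt_gt0 wgt_le a)) mweight_single.
Qed.

Lemma tbasisM ga al be : is_sum ga al be -> tpoly_mul (tbasis al) (tbasis be) = tbasis ga.
Proof.
move=> s; apply/ffunP => de; rewrite !ffunE (bigD1 al) //= (bigD1 be) //= !ffunE !eqxx.
rewrite !mulr1 big1 ?addr0 => [|be' /negbTE nb]; last by rewrite !ffunE nb !mulr0.
rewrite big1 ?addr0 => [|al' /negbTE na]; last first.
  by rewrite big1 // => be' _; rewrite !ffunE na mul0r mulr0.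
congr (nat_of_bool _)%:R; apply/idP/eqP => [s'|->//]; exact: is_sum_eq s' s.
Qed.

Lemma emono_tgen (al : mon) : emono (A := tpoly_alg) tgen (mexpo al) = tbasis al.
Proof.
move: {-1}(mdeg (mexpo al)) (erefl (mdeg (mexpo al))) => j; elim: j al => [|j IH] al dj.
  have /andP[w0 _] := mexpo_weight al.
  by have := mdeg_gt0 w0; rewrite dj.
have [h Hh] := mcount_surj (mexpo al); move: h Hh; rewrite dj => h Hh.
pose b' := mcount (fun i => h (lift ord0 i)).
have bE : mexpo al =1 (fun a => msingle (h ord0) a + b' a)%N.
  by move=> a; rewrite -Hh /mcount big_ord_recl /= /msingle eq_sym.
have wE : mweight wgt (mexpo al) = (wgt (h ord0) + mweight wgt b')%N.
  by rewrite (eq_mweight _ bE) mweightD mweight_single.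
have dE : mdeg b' = j by exact: mdeg_count.
have [j0|j0] := posnP j.
  have b'0 a : b' a = 0%N.
    by apply/eqP; rewrite -leqn0 -j0 -dE /mdeg (bigD1 a) //= leq_addr.
  have aE : mexpo al =1 msingle (h ord0) by move=> a; rewrite bE b'0 addn0.
  rewrite (eq_emono _ aE) (@emono_single _ tpoly_alg) /tgen; congr tbasis; apply: mexpo_inj => a.
  by rewrite aE mgenE.
have b'w : (0 < mweight wgt b')%N by apply: mweight_gt0 => //; rewrite dE.
have [be Hbe] : exists be : mon, mexpo be =1 b'.
  apply: monomialP => //; rewrite b'w /=; have /andP[_] := mexpo_weight al.
  by rewrite wE; apply: leq_trans; exact: leq_addl.
have deb : mdeg (mexpo be) = j by rewrite (eq_mdeg Hbe).
rewrite (eq_emono _ bE) -(emonoM tpoly_graded wgt_gt0 tgen_in) ?mweight_single //.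
rewrite (@emono_single _ tpoly_alg) -(eq_emono _ Hbe) (IH _ deb) /= tpoly_prodE.
apply: tbasisM; apply/forallP => a; rewrite bE Hbe.
by rewrite (mgenE wgt_gt0 wgt_le).
Qed.

Lemma tpoly_free : is_basis (fun al : mon => emono (A := tpoly_alg) tgen (mexpo al)).
Proof.
split=> [v|c].
  exists v; rewrite {1}(tpoly_sum v); apply: eq_bigr => al _.
  by rewrite emono_tgen.
under eq_bigr do rewrite emono_tgen.
by move=> c0 al; rewrite -(tpoly_coef c al) c0 ffunE.
Qed.

Definition teval (v : tpoly) (y : 'rV[R]_n) : R := \sum_al v al * mono (mexpo al) y.

Lemma teval_is_eval y : is_eval (A := tpoly_alg) k wgt tgen y (fun v => teval v y).
Proof.
move=> c; apply: eq_bigr => al _; congr (_ * _); rewrite -[RHS](tpoly_coef c al).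
by congr (fun_of_fin _ _); apply: eq_bigr => be _; rewrite emono_tgen.
Qed.

Lemma teval_character y : is_character k (A := tpoly_alg) tgrade (fun v => teval v y).
Proof. exact: (eval_character tpoly_graded wgt_gt0 tgen_in tpoly_free (teval_is_eval y)). Qed.

Lemma teval_inj (u v : tpoly) : (forall y, teval u y = teval v y) -> u = v.
Proof.
move=> H; apply/ffunP => al; apply/eqP; rewrite -subr_eq0; apply/eqP.
apply: (mono_indep (c := fun al => u al - v al)) => y.
transitivity (teval u y - teval v y); last by rewrite H subrr.
by rewrite /teval -sumrB; apply: eq_bigr => be _; rewrite mulrBl.
Qed.

Lemma tpoly_induced_injective j : (0 < j)%N -> induced_injective k tgrade tpoly_prod j.
Proof.
have [X [XE XK XL]] := free_coord tpoly_free.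
exact: (free_induced_injective tpoly_graded wgt_gt0 wgt_le tgen_in XE XK XL).
Qed.

End TruncatedPolynomials.

(** Collects the list of [homogeneous_polynomial], where a monomial may occur several times, into
    one coefficient for each monomial. *)
Lemma homogeneous_coef (R : realType) (M : chartedSpace R) (k n : nat)
    (wgt : 'I_n -> nat) (U : set M) (x : M) (w : nat) (G : M * 'rV[R]_n -> R) :
  is_premanifold M -> (forall a, (0 < wgt a)%N) -> open U -> U x -> (1 <= w <= k)%N ->
  (forall z y, U z -> @rsmooth_at R (prod_space M (euclidean R n)) (z, y) G) ->
  (forall t z y, U z -> G (z, wscale wgt t y) = t ^+ w * G (z, y)) ->
  exists C : monomial k wgt -> M -> R,
    [/\ forall be, rsmooth_at x (C be),
        forall be z, mweight wgt (mexpo be) != w -> C be z = 0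
      & \forall z \near x, forall y, G (z, y) = \sum_be C be z * mono (mexpo be) y].
Proof.
move=> pM w0 oU Ux wk sG hG; have [l [Hl El]] := homogeneous_polynomial pM w0 oU Ux sG hG.
suff [C [sC C0 CE]] : exists C : monomial k wgt -> M -> R,
    [/\ forall be, rsmooth_at x (C be),
        forall be z, mweight wgt (mexpo be) != w -> C be z = 0
      & forall z y, \sum_(c <- l) c.1 z * mono c.2 y = \sum_be C be z * mono (mexpo be) y].
  by exists C; split=> //; apply: filterS El => z Ez y; rewrite Ez.
elim: Hl => [|c l' [sc wc] _ [C [sC C0 CE]]].
  exists (fun _ _ => 0); split=> // [_|z y]; first exact: rsmooth_at_cst.
  by rewrite big_nil big1 // => be _; rewrite mul0r.
have [al Hal] : exists al : monomial k wgt, mexpo al =1 c.2.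
  by apply: monomialP => //; rewrite wc.
exists (fun be z => (be == al)%:R * c.1 z + C be z); split.
- move=> be; apply: rsmooth_atD => //; apply: rsmooth_atM => //; exact: rsmooth_at_cst.
- move=> be z nbe; rewrite C0 // addr0; case: eqVneq => [E|_]; last by rewrite mul0r.
  by rewrite E (eq_mweight _ Hal) wc eqxx in nbe.
- move=> z y; rewrite big_cons CE.
  under [RHS]eq_bigr do rewrite mulrDl.
  rewrite big_split /=; congr (_ + _); rewrite (bigD1 al) //= eqxx mul1r big1 ?addr0.
    by congr (_ * _); apply: eq_bigr => a _; rewrite Hal.
  by move=> be /negbTE ->; rewrite !mul0r.
Qed.

Lemma lfun_invE (R : realType) (V W : vectType R) (f : 'Hom(V, W)) (g : W -> V) :
  cancel f g -> cancel g f -> (f^-1)%VF =1 g.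
Proof.
move=> fK gK u; rewrite -{1}(gK u) lker0_lfunK //; apply/lker0P; exact: can_inj fK.
Qed.

(** * The bundle of truncated polynomials *)

Section MonomialIndex.
Variables (k n : nat) (wgt : 'I_n -> nat).

Definition mon_rank (i : 'I_k) : nat := #|weight_monomial k wgt i.+1|.

Definition bmon_sig (p : {i : 'I_k & 'I_(mon_rank i)}) : monomial k wgt :=
  val (enum_val (tagged p : 'I_#|weight_monomial k wgt (tag p).+1|)).

(** Numbers the monomials so that those of weight [i.+1] form the block [i], the format imposed on
    the trivializations of a graded vector bundle. *)
Definition bmon (b : 'I_(\sum_i mon_rank i)) : monomial k wgt := bmon_sig (tagnat.sig b).

Lemma bmon_weight b : mweight wgt (mexpo (bmon b)) = dwt b.
Proof.
exact/eqP/(valP (enum_val (tagged (tagnat.sig b) :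
  'I_#|weight_monomial k wgt (tag (tagnat.sig b)).+1|))).
Qed.

Lemma bmon_surj al : exists b, bmon b = al.
Proof.
have /andP[w0 wk] := mexpo_weight al.
have ik : ((mweight wgt (mexpo al)).-1 < k)%N by rewrite prednK.
have wP : mweight wgt (mexpo al) == (Ordinal ik).+1 by rewrite /= prednK.
pose t : weight_monomial k wgt (Ordinal ik).+1 := exist _ al wP.
exists (tagnat.rank (Tagged (fun i => 'I_(mon_rank i)) (enum_rank t : 'I_(mon_rank (Ordinal ik))))).
by rewrite /bmon tagnat.rankK /bmon_sig /= enum_rankK.
Qed.

Lemma bmon_inj : injective bmon.
Proof.
move=> b b' E; apply: (can_inj (@tagnat.sigK k mon_rank)).
have : dwt b = dwt b' by rewrite -!bmon_weight E.
move: E; rewrite /bmon /dwt /tagnat.sig1.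
case: (tagnat.sig b) => i j; case: (tagnat.sig b') => i' j' /= E [/val_inj ii'].
subst i'; have -> // : j = j'.
by move: E => /val_inj /enum_val_inj.
Qed.

Definition monb (al : monomial k wgt) : 'I_(\sum_i mon_rank i) := sval (cid (bmon_surj al)).

Lemma monbK : cancel monb bmon.
Proof. by move=> al; rewrite /monb; case: cid. Qed.

Lemma bmonK : cancel bmon monb.
Proof. by move=> b; apply: bmon_inj; rewrite monbK. Qed.

End MonomialIndex.

Section BundleOfPolynomials.
Variables (R : realType) (M : manifold R) (k : nat) (F : gradedBundle M k).
Let pM : is_premanifold M := manifold_premanifold (mfd_axioms M).
Local Notation n := (\sum_i gb_rank F i)%N.
Local Notation wgt := (dwt (d := gb_rank F)).
Local Notation mon := (monomial k wgt).
Local Notation wgt_gt0 := (@dwt_gt0 k (gb_rank F)).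
Local Notation wgt_le := (@dwt_le k (gb_rank F)).
Variables (U : M -> set M) (y : M -> F -> 'rV[R]_n) (psi : M -> M * 'rV[R]_n -> F).
Hypotheses (ch : forall c, gb_chart (U c) (y c) (psi c)) (Uc : forall c, U c c).

(** A monomial in the coordinates of the chart [c'] is a homogeneous function in the chart [c],
    hence a combination of monomials of the same weight. *)
Lemma tcoef_exists c' c : exists C : mon -> mon -> M -> R, forall al be z, U c z -> U c' z ->
  [/\ forall u, mono (mexpo al) (y c' (psi c (z, u))) = \sum_be C al be z * mono (mexpo be) u,
      rsmooth_at z (C al be)
    & mweight wgt (mexpo al) != mweight wgt (mexpo be) -> C al be z = 0].
Proof.
pose V := U c `&` U c'; have oV : open V by apply: openI; exact: gb_chart_open (ch _).
pose G al (p : M * 'rV[R]_n) := mono (mexpo (al : mon)) (y c' (psi c p)).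
have loc al z : V z -> exists C : mon -> M -> R,
    [/\ forall be, rsmooth_at z (C be),
        forall be x, mweight wgt (mexpo be) != mweight wgt (mexpo al) -> C be x = 0
      & \forall x \near z, forall u, G al (x, u) = \sum_be C be x * mono (mexpo be) u].
  move=> Vz; apply: (homogeneous_coef pM wgt_gt0 oV Vz (mexpo_weight al)).
    move=> x u [Ux Ux']; have [px _] := gb_chart_psi (ch c) u Ux.
    have pMn : is_premanifold (prod_space M (euclidean R n)).
      exact: prod_premanifold pM (euclidean_premanifold R n).
    apply: (rsmooth_at_prod pMn) => a _; apply: (rsmooth_atX pMn).
    have H : rsmooth_at (psi c (x, u)) (fun q => y c' q 0 a).
      by apply: (gb_chart_coord (ch c')); rewrite px.
    exact: (rsmooth_at_pullback pMn (gb_chart_psi_smooth (ch c) u Ux) H).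
  move=> t x u [Ux Ux']; have [px yu] := gb_chart_psi (ch c) u Ux.
  by rewrite /G (gb_chart_psi_act (ch c)) // (gb_chart_act (ch c')) ?px // mono_wscale.
have [C HC] : exists C : mon -> M -> mon -> M -> R, forall al z, V z ->
    [/\ forall be, rsmooth_at z (C al z be),
        forall be x, mweight wgt (mexpo be) != mweight wgt (mexpo al) -> C al z be x = 0
      & \forall x \near z, forall u, G al (x, u) = \sum_be C al z be x * mono (mexpo be) u].
  have H (p : mon * M) : exists C : mon -> M -> R, V p.2 ->
    [/\ forall be, rsmooth_at p.2 (C be),
        forall be x, mweight wgt (mexpo be) != mweight wgt (mexpo p.1) -> C be x = 0
      & \forall x \near p.2, forall u, G p.1 (x, u) = \sum_be C be x * mono (mexpo be) u].
    have [Vz|nV] := pselect (V p.2); last by exists (fun _ _ => 0).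
    by have [C HC] := loc p.1 p.2 Vz; exists C.
  have [C HC] := boolp.choice H; exists (fun al z => C (al, z)) => al z Vz.
  exact: HC (al, z) Vz.
(* One expansion was chosen around each point. Monomials being independent functions, nearby
   expansions have the same coefficients, so that the diagonal choice is smooth. *)
exists (fun al be z => C al z be z) => al be z Uz U'z; have Vz : V z by [].
have [sC C0 CE] := HC al z Vz; split.
- by move=> u; exact: (nbhs_singleton CE u).
- apply: rsmooth_at_near (sC be).
  have nV : \forall x \near z, V x by apply: open_nbhs_nbhs.
  apply: filterS2 nV CE => x Vx Ex; have [_ _ /nbhs_singleton Ex'] := HC al x Vx.
  apply/eqP; rewrite -subr_eq0; apply/eqP.
  apply: (mono_indep (c := fun be => C al z be x - C al x be x)) => u.
  transitivity (G al (x, u) - G al (x, u)); last by rewrite subrr.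
  rewrite {1}Ex Ex' -sumrB; apply: eq_bigr => ga _.
  by rewrite mulrBl.
- by rewrite eq_sym; exact: C0.
Qed.

Definition tcoef c' c : mon -> mon -> M -> R := sval (cid (tcoef_exists c' c)).

Lemma tcoefP c' c al be z : U c z -> U c' z ->
  [/\ forall u, mono (mexpo al) (y c' (psi c (z, u))) = \sum_be tcoef c' c al be z * mono (mexpo be) u,
      rsmooth_at z (tcoef c' c al be)
    & mweight wgt (mexpo al) != mweight wgt (mexpo be) -> tcoef c' c al be z = 0].
Proof. by rewrite /tcoef; case: cid => C; exact. Qed.

Local Notation P := (tpoly R k wgt).

(* Rewrites a polynomial in the coordinates of the chart [c'] in those of [c]. *)
Definition trans c' c z (v : P) : P := [ffun be => \sum_al v al * tcoef c' c al be z : R^o].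

Lemma trans_linear c' c z : linear (trans c' c z).
Proof.
move=> a u v; apply/ffunP => be; rewrite !ffunE /GRing.scale /= mulr_sumr -big_split.
by apply: eq_bigr => al _; rewrite !ffunE /= mulrDl mulrA.
Qed.

Lemma trans_tbasis c' c z al be : trans c' c z (tbasis R al) be = tcoef c' c al be z.
Proof.
rewrite ffunE (bigD1 al) //= ffunE eqxx mul1r big1 ?addr0 // => ga /negbTE ne.
by rewrite ffunE ne mul0r.
Qed.

(** As polynomials are determined by their values, the cocycle identities and the multiplicativity
    of [trans] reduce to identities between points of [F]. *)
Lemma teval_trans c' c z v u : U c z -> U c' z ->
  teval (trans c' c z v) u = teval v (y c' (psi c (z, u))).
Proof.
move=> Uz U'z; rewrite /teval.
rewrite (eq_bigr (fun be => \sum_al v al * tcoef c' c al be z * mono (mexpo be) u)); last first.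
  by move=> be _; rewrite ffunE mulr_suml.
rewrite exchange_big /=; apply: eq_bigr => al _.
have [-> _ _] := tcoefP al al Uz U'z; rewrite mulr_sumr; apply: eq_bigr => be _.
by rewrite mulrA.
Qed.

Lemma trans_comp c1 c2 c3 z v : U c1 z -> U c2 z -> U c3 z ->
  trans c2 c3 z (trans c1 c2 z v) = trans c1 c3 z v.
Proof.
move=> U1 U2 U3; apply: teval_inj => u; rewrite !teval_trans //.
have [p3 _] := gb_chart_psi (ch c3) u U3.
by rewrite -{1}p3 (gb_chartK (ch c2)) // p3.
Qed.

Lemma trans_id c z v : U c z -> trans c c z v = v.
Proof.
move=> Uz; apply: teval_inj => u; rewrite teval_trans //.
by have [_ ->] := gb_chart_psi (ch c) u Uz.
Qed.

Lemma trans_grade c' c z w v : U c z -> U c' z ->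
  v \in tgrade R k wgt w -> trans c' c z v \in tgrade R k wgt w.
Proof.
move=> Uz U'z /tgradeP vw; apply/tgradeP => be nbe; rewrite ffunE big1 // => al _.
have [wal|/vw ->] := eqVneq (mweight wgt (mexpo al)) w; last by rewrite mul0r.
by have [_ _ ->] := tcoefP al be Uz U'z; rewrite ?mulr0 // wal eq_sym.
Qed.

Lemma trans_mul c' c z u v : U c z -> U c' z ->
  trans c' c z (tpoly_prod R k wgt u v) =
  tpoly_prod R k wgt (trans c' c z u) (trans c' c z v).
Proof.
move=> Uz U'z; have gA := tpoly_graded R k wgt_gt0.
apply: (@character_morphism R k (tpoly_alg R k wgt_gt0) (tpoly_alg R k wgt_gt0) _ _ _ _
  (trans c' c z) 'rV[R]_n (fun i v => teval v (y c' (psi c (z, i)))) (fun i v => teval v i) gA gA).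
- exact: trans_linear.
- by move=> w a; exact: trans_grade.
- by move=> i; exact: (teval_character wgt_gt0 wgt_le).
- by move=> i; exact: (teval_character wgt_gt0 wgt_le).
- by move=> i a; exact: teval_trans.
- by move=> a b; exact: teval_inj.
Qed.

Local Notation N := (\sum_i mon_rank wgt i)%N.
Local Notation bm := (@bmon k n wgt).
Local Notation mb := (@monb k n wgt).

Definition to_row (v : P) : 'rV[R]_N := \row_b v (bm b).
Definition of_row (u : 'rV[R]_N) : P := [ffun al => u 0 (mb al) : R^o].

Lemma to_rowK : cancel to_row of_row.
Proof. by move=> v; apply/ffunP => al; rewrite ffunE mxE monbK. Qed.

Lemma of_rowK : cancel of_row to_row.
Proof. by move=> u; apply/rowP => b; rewrite mxE ffunE bmonK. Qed.

Lemma poly_triv_linear c x : linear (fun v => to_row (trans x c x v)).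
Proof.
by move=> a u v; rewrite trans_linear; apply/rowP => b; rewrite !mxE !ffunE.
Qed.

(** All fibres are the space [P], but a vector at [x] stands for a polynomial in the coordinates of
    the chart chosen at [x]; hence the factor [trans x c x]. This replaces a quotient of the
    disjoint union of the local models. *)
Definition poly_triv (c : M) : trivialization (fun _ : M => P) N :=
  Trivialization (U c) (fun x => lfun_of (poly_triv_linear c x)).

Lemma poly_trivE c x v : poly_triv c x v = to_row (trans x c x v).
Proof. exact: lfun_ofE. Qed.

Lemma poly_trivK c x : U c x ->
  cancel (poly_triv c x) (fun u => trans c x x (of_row u)) /\
  cancel (fun u => trans c x x (of_row u)) (poly_triv c x).
Proof.
move=> Ux; split=> u; rewrite poly_trivE.
  by rewrite to_rowK trans_comp // trans_id.
by rewrite trans_comp // trans_id // of_rowK.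
Qed.

Lemma poly_triv_inv c x u : U c x -> ((poly_triv c x)^-1)%VF u = trans c x x (of_row u).
Proof. by move=> Ux; have [K1 K2] := poly_trivK Ux; exact: (lfun_invE K1 K2 u). Qed.

Lemma smooth_on_rV (O : set M) m (f : M -> 'rV[R]_m) : open O ->
  (forall x, O x -> forall b, rsmooth_at x (fun z => f z 0 b)) ->
  @smooth_on R M (euclidean R m) O f.
Proof.
move=> oO H; apply/(smooth_onP _ pM (euclidean_premanifold R m) oO) => x Ox.
by apply/(smooth_at_euclidean _ _ pM); exact: H.
Qed.

Lemma open_U c : open (U c). Proof. exact: gb_chart_open (ch c). Qed.

Lemma poly_transition c c' x (u : P) be : U c x -> U c' x ->
  rsmooth_at x (fun z => trans c c' z u be : R).
Proof.
move=> Ux U'x; under eq_fun do rewrite ffunE.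
apply: (rsmooth_at_sum pM) => al _; apply: (rsmooth_atM pM); first exact: rsmooth_at_cst.
by have [_ ? _] := tcoefP al be U'x Ux.
Qed.

Definition poly_bundle : gradedVectorBundle M k.
Proof.
refine (@GradedVectorBundle R M k (fun _ => P) (fun _ => tgrade R k wgt) (mon_rank wgt)
  [set phi | exists c, phi = poly_triv c] _ _ _ _ _).
- by move=> x; exists (poly_triv x) => /=; [exists x|exact: Uc].
- by move=> _ [c ->]; exact: open_U.
- by move=> _ [c ->] x Ux; have [K1 K2] := poly_trivK Ux; exact: Bijective K1 K2.
- move=> _ [c ->] x Ux w v.
  have H : (v \in tgrade R k wgt w) <-> (forall b, dwt b != w -> poly_triv c x v 0 b = 0).
    rewrite poly_trivE; split.
      move=> /(trans_grade Ux (Uc x)) /tgradeP H b nb.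
      by rewrite mxE H // bmon_weight.
    move=> H; rewrite -[v](trans_id v (Uc x)) -(trans_comp (c2 := c)) //.
    apply: trans_grade => //; apply/tgradeP => al nal; rewrite -[al]monbK.
    have E : to_row (trans x c x v) 0 (mb al) = 0 by apply: H; rewrite -bmon_weight monbK.
    by move: E; rewrite mxE.
  rewrite H; split=> {}H.
    move=> i ni; apply/matrixP => r j; rewrite !mxE !ord1; apply: H.
    by rewrite /dwt tagnat.Rank1K.
  move=> b nb; have /matrixP/(_ 0 (tagnat.sig2 b)) := H (tagnat.sig1 b) nb.
  by rewrite !mxE tagnat.sig2K.
- move=> _ _ [c ->] [c' ->] u; apply: smooth_on_rV; first by apply: openI; exact: open_U.
  move=> x [Ux U'x] b.
  apply: (@rsmooth_at_near _ _ _ (fun z => trans c c' z (of_row u) (bm b) : R)).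
    have nU : \forall z \near x, U c z /\ U c' z.
      by apply: filterI; apply: open_nbhs_nbhs; split=> //; exact: open_U.
    apply: filterS nU => z [Uz U'z]; rewrite poly_triv_inv // poly_trivE mxE.
    by rewrite trans_comp.
  exact: poly_transition.
Defined.

Definition poly_product_bundle : productBundle M k.
Proof.
refine (@ProductBundle R M k poly_bundle (fun _ => tpoly_prod R k wgt) _ _ _ _).
- split; first by move=> x a b; exact: tpoly_prodC.
  move=> _ [c ->] u v; apply: smooth_on_rV; first exact: open_U.
  move=> x Ux b.
  (* As [trans] is multiplicative, the structure constants of the product are constant in every
     trivialization. *)
  apply: (@rsmooth_at_near _ _ _ (fun z => tpoly_prod R k wgt (of_row u) (of_row v) (bm b) : R)).
    have nU : \forall z \near x, U c z by apply: open_nbhs_nbhs; split=> //; exact: open_U.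
    apply: filterS nU => z Uz; rewrite !poly_triv_inv // poly_trivE mxE.
    by rewrite trans_mul // !trans_comp // !trans_id.
  exact: rsmooth_at_cst.
- by move=> x i j a b; exact: (gr_mul (tpoly_graded R k wgt_gt0)).
- by move=> x a b c; exact: (tpoly_prodA wgt_gt0).
- move=> x j /andP[j2 _]; apply: (tpoly_induced_injective R wgt_gt0 wgt_le).
  exact: ltnW.
Defined.

Definition poly_ev (x : M) (v : poly_product_bundle x) (p : F) : R := teval (v : P) (y x p).

Lemma poly_dual : dual_pairing poly_ev.
Proof.
(* The generators of the chart [c], written at [z] in the coordinates of the chart chosen at [z]. *)
move=> c; pose eta a z : poly_product_bundle z := trans c z z (tgen R wgt_gt0 wgt_le a).
exists (U c), (y c), (psi c), eta; split; first exact: Uc.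
have em z b : U c z -> emono (A := fibre_alg poly_product_bundle z) (fun a => eta a z) b =
    trans c z z (emono (A := tpoly_alg R k wgt_gt0) (tgen R wgt_gt0 wgt_le) b).
  move=> Uz; apply: (@emono_morph R (tpoly_alg R k wgt_gt0) (fibre_alg poly_product_bundle z) (trans c z z)).
    exact: trans_linear.
  by move=> u v; exact: trans_mul.
have sumE z (a : mon -> R) : U c z ->
    \sum_al a al *: emono (A := fibre_alg poly_product_bundle z) (fun a => eta a z) (mexpo al) =
    trans c z z ([ffun al => a al : R^o] : P) :> P.
  move=> Uz; apply/ffunP => be; rewrite sum_ffunE [RHS]ffunE; apply: eq_bigr => al _.
  by rewrite em // emono_tgen [LHS]ffunE trans_tbasis ffunE.
split.
- exact: ch.
- move=> z a Uz; exists (poly_triv c); split=> [|//|b]; first by exists c.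
  apply: (@rsmooth_at_near _ _ _ (fun _ => tgen R wgt_gt0 wgt_le a (bm b) : R)).
    have nU : \forall x \near z, U c x by apply: open_nbhs_nbhs; split=> //; exact: open_U.
    apply: filterS nU => x Ux; rewrite poly_trivE mxE.
    by rewrite trans_comp // trans_id.
  exact: rsmooth_at_cst.
- move=> z a Uz; apply: trans_grade => //; exact: tgen_in.
- move=> z Uz; split=> [v|a].
    exists (trans z c z v); rewrite sumE //.
    have -> : [ffun al => trans z c z v al : R^o] = trans z c z v by apply/ffunP => al; rewrite ffunE.
    by rewrite trans_comp // trans_id.
  rewrite sumE // => E al.
  have : trans z c z (trans c z z ([ffun al => a al : R^o] : P)) = 0.
    by rewrite E -(lfun_ofE (trans_linear z c z)) linear0.
  by rewrite trans_comp // trans_id // => /ffunP /(_ al); rewrite !ffunE.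
- move=> p Up a; rewrite sumE // /poly_ev teval_trans //.
  rewrite (gb_chartK (ch (gb_proj p))) //.
  by apply: eq_bigr => al _; rewrite ffunE.
Qed.

End BundleOfPolynomials.

Theorem gradedBundle_dual (R : realType) (M : manifold R) (k : nat) (F : gradedBundle M k) :
  exists (E : productBundle M k) (ev : forall x, E x -> F -> R), dual_pairing ev.
Proof.
have ex c : exists t : set M * (F -> 'rV[R]_(\sum_i gb_rank F i)) *
    (M * 'rV[R]_(\sum_i gb_rank F i) -> F), gb_chart t.1.1 t.1.2 t.2 /\ t.1.1 c.
  have [U [y [psi [oU Ux dU aU]]]] := @gb_locally_trivial _ _ _ F c.
  by exists (U, y, psi).
have [t Ht] := boolp.choice ex.
have ch c : gb_chart (t c).1.1 (t c).1.2 (t c).2 by case: (Ht c).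
have Uc c : (t c).1.1 c by case: (Ht c).
by exists (poly_product_bundle ch Uc), (@poly_ev _ _ _ _ _ _ _ ch Uc); exact: poly_dual.
Qed.

(** * The graded bundle of a product bundle *)

(** Boxes with rational ends are a countable base of R^n, from which the second countability of the
    glued space is derived. *)
Definition rat_box (R : realType) n (q : {ffun 'I_n -> rat * rat}) : set 'rV[R]_n :=
  [set u | forall i, u 0 i \in `]ratr (q i).1, ratr (q i).2[].

Arguments rat_box R {n} q.

Lemma open_rat_box (R : realType) n (q : {ffun 'I_n -> rat * rat}) : open (rat_box R q).
Proof.
rewrite (_ : rat_box R q = \bigcap_(i in [set: 'I_n]) [set u | u 0 i \in `]ratr (q i).1, ratr (q i).2[]).
  apply: open_bigcap_fin => i; rewrite -[X in open X]setTI.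
  apply: (open_preimageI (f := fun u : 'rV[R]_n => u 0 i)
    (W := [set` `](ratr (q i).1 : R), (ratr (q i).2 : R)[])).
  - exact: openT.
  - exact: interval_open.
  - by move=> u _; exact: coord_continuous.
by apply/seteqP; split=> [u H i _|u H i]; [exact: H|exact: (H i I)].
Qed.

Lemma rat_box_nbhs (R : realType) n (u : 'rV[R]_n) (A : set 'rV[R]_n) : nbhs u A ->
  exists q, rat_box R q u /\ rat_box R q `<=` A.
Proof.
move=> /nbhs_ballP [e /= e0 eA].
have lt1 i : u 0 i - e < u 0 i by rewrite ltrBlDr ltrDl.
have lt2 i : u 0 i < u 0 i + e by rewrite ltrDl.
have H1 i : exists q : rat, u 0 i - e < ratr q < u 0 i.
  by have [q] := rat_in_itvoo (lt1 i); rewrite in_itv /= => ?; exists q.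
have H2 i : exists q : rat, u 0 i < ratr q < u 0 i + e.
  by have [q] := rat_in_itvoo (lt2 i); rewrite in_itv /= => ?; exists q.
have [q1 Hq1] := boolp.choice H1; have [q2 Hq2] := boolp.choice H2.
exists [ffun i => (q1 i, q2 i)]; split.
  by move=> i; rewrite ffunE in_itv /=; have /andP[_ ->] := Hq1 i; have /andP[-> _] := Hq2 i.
move=> v Hv; apply: eA; apply/ball_rVP => // i; have := Hv i; rewrite ffunE in_itv /= => /andP[v1 v2].
have /andP[a1 a2] := Hq1 i; have /andP[b1 b2] := Hq2 i.
by rewrite ltr_norml; apply/andP; split; lra.
Qed.

(** [cc_map c1 c2 z] turns the fibre coordinates of the chart [c1] over [z] into those of [c2].
    Charts are indexed by points of [M] lying in their domains, so that every point has a preferred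
    chart. *)
Record cocycle (R : realType) (M : manifold R) (n : nat) := Cocycle {
  cc_dom : M -> set M;
  cc_map : M -> M -> M -> 'rV[R]_n -> 'rV[R]_n;
  cc_open : forall c, open (cc_dom c);
  cc_mem : forall c, cc_dom c c;
  cc_id : forall c z u, cc_dom c z -> cc_map c c z u = u;
  cc_comp : forall c1 c2 c3 z u, cc_dom c1 z -> cc_dom c2 z -> cc_dom c3 z ->
    cc_map c2 c3 z (cc_map c1 c2 z u) = cc_map c1 c3 z u;
  cc_smooth : forall c1 c2 z u a, cc_dom c1 z -> cc_dom c2 z ->
    @rsmooth_at R (prod_space M (euclidean R n)) (z, u) (fun p => cc_map c1 c2 p.1 p.2 0 a) }.

(* The point [(z, u)] is the one of coordinate [u] in the chart indexed by [z]. *)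
Definition glued (R : realType) (M : manifold R) (n : nat) (C : cocycle M n) : Type :=
  (M * 'rV[R]_n)%type.

HB.instance Definition _ (R : realType) (M : manifold R) (n : nat) (C : cocycle M n) :=
  Choice.copy (glued C) (M * 'rV[R]_n)%type.

Section Glue.
Variables (R : realType) (M : manifold R) (n : nat) (C : cocycle M n).
Let pM : is_premanifold M := manifold_premanifold (mfd_axioms M).
Local Notation MR := (prod_space M (euclidean R n)).
Let pMR : is_premanifold MR := prod_premanifold pM (euclidean_premanifold R n).
Local Notation X := (glued C).
Local Notation U := (cc_dom C).
Local Notation tr := (cc_map C).

Definition glue_coord (c : M) (p : X) : 'rV[R]_n := tr p.1 c p.1 p.2.
Definition glue_point (c : M) (q : M * 'rV[R]_n) : X := (q.1, tr c q.1 q.1 q.2).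

Lemma glue_coordK c p : U c p.1 -> glue_point c (p.1, glue_coord c p) = p.
Proof.
move=> Up; have Um := cc_mem C p.1; rewrite /glue_point /glue_coord /= cc_comp // cc_id //.
by case: p Up Um.
Qed.

Lemma glue_pointK c z u : U c z -> glue_coord c (glue_point c (z, u)) = u.
Proof. by move=> Uz; rewrite /glue_coord /= cc_comp ?cc_id //; exact: cc_mem. Qed.

Definition glue_preim (c : M) (V : set X) : set MR := [set q | U c q.1 /\ V (glue_point c q)].

(** The final topology for the parametrizations [glue_point c], each restricted to its domain. *)
Definition glue_open : set (set X) := [set V | forall c, open (glue_preim c V)].

Lemma open_base (O : set M) : open O -> open ([set q | O q.1] : set MR).
Proof.
move=> oO; rewrite openE => -[z u] Oz; exists (O, setT) => /=; last by move=> [? ?] [].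
by split; [exact: open_nbhs_nbhs|exact: filterT].
Qed.

Lemma glue_openT : glue_open setT.
Proof.
move=> c; rewrite (_ : glue_preim c setT = [set q | U c q.1]); first exact/open_base/cc_open.
by apply/seteqP; split=> [q []|q ?].
Qed.

Lemma glue_openI : setI_closed glue_open.
Proof.
move=> V W oV oW c; rewrite (_ : glue_preim c _ = glue_preim c V `&` glue_preim c W); first exact: openI.
by apply/seteqP; split=> [q [? []]|q [[? ?] [? ?]]].
Qed.

Lemma glue_open_bigU (I : Type) (f : I -> set X) : (forall i, glue_open (f i)) ->
  glue_open (\bigcup_i f i).
Proof.
move=> of_ c; rewrite (_ : glue_preim c _ = \bigcup_i glue_preim c (f i)).
  by apply: bigcup_open => i _; exact: of_.
by apply/seteqP; split=> [q [? [i ? ?]]|q [i ? [? ?]]]; [exists i|split=> //; exists i].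
Qed.

HB.instance Definition _ := isOpenTopological.Build X glue_openT glue_openI glue_open_bigU.

Lemma glue_openE (V : set X) : open V = glue_open V.
Proof. by []. Qed.

Lemma glue_point_continuous c q : U c q.1 ->
  {for (q : MR), continuous (glue_point c : MR -> X)}.
Proof.
move=> Uq A; rewrite nbhsE => -[B [oB Bq] BA].
have oP : open (glue_preim c B) by exact: oB.
apply: filterS (open_nbhs_nbhs (conj oP (conj Uq Bq))) => q' [_ /BA]; exact.
Qed.

Definition cc_change c c' (q : MR) : MR := (q.1, tr c c' q.1 q.2).

Lemma cc_change_smooth c c' (q : MR) : U c q.1 -> U c' q.1 ->
  @smooth_at R MR MR q (cc_change c c').
Proof.
case: q => z u /= Uz U'z.
have S1 := @smooth_at_fst R M (euclidean R n) (z, u) (euclidean_premanifold R n).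
have S2 : @smooth_at R MR (euclidean R n) (z, u) (fun q => tr c c' q.1 q.2).
  by apply/(smooth_at_euclidean _ _ pMR) => a; exact: cc_smooth.
exact: smooth_at_pair S1 S2.
Qed.

(** Read in another chart, the image is the inverse image of [A] under the change of coordinates,
    which is continuous. *)
Lemma glue_point_open c (A : set MR) : open A -> A `<=` [set q | U c q.1] ->
  open (glue_point c @` A : set X).
Proof.
move=> oA AU; rewrite glue_openE => c'.
rewrite (_ : glue_preim c' _ = ([set q | U c' q.1] `&` [set q | U c q.1]) `&` cc_change c' c @^-1` A).
  apply: open_preimageI => //; first by apply: openI; exact/open_base/cc_open.
  by move=> q [? ?]; have [] := cc_change_smooth (c := c') (c' := c) (q := q).
apply/seteqP; split=> [[z u] [/= U'z [[z' u'] Aq E]]|[z u] [/= [U'z Uz] Aq]].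
  have zz : z' = z by case: E.
  have Uz : U c z by rewrite -zz; exact: (AU _ Aq).
  split=> //; rewrite /cc_change /=; subst z'.
  have <- : u' = tr c' c z u; last by [].
  rewrite -(glue_pointK u' Uz) E /glue_coord /glue_point /=.
  by rewrite cc_comp //; exact: cc_mem.
split=> //; exists (cc_change c' c (z, u)) => //.
rewrite /glue_point /cc_change /=; congr pair.
by rewrite cc_comp //; exact: cc_mem.
Qed.

Definition glue_chart (c : M) (p : X) : MR := (p.1, glue_coord c p).

Lemma glue_chart_continuous c p : U c p.1 -> {for p, continuous (glue_chart c)}.
Proof.
move=> Up A; rewrite nbhsE => -[B [oB Bp] BA].
pose B' := B `&` [set q : MR | U c q.1].
have oB' : open B' by apply: openI => //; exact/open_base/cc_open.
have oP : open (glue_point c @` B' : set X) by apply: glue_point_open => // q [].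
have Pp : (glue_point c @` B') p by exists (glue_chart c p) => //; exact: glue_coordK.
apply: filterS (open_nbhs_nbhs (conj oP Pp)) => _ [[z u] [Bq Uq] <-]; apply: BA.
by rewrite /glue_chart /= glue_pointK.
Qed.

Lemma glue_chart_image c (V : set X) : V `<=` [set p | U c p.1] ->
  glue_chart c @` V = glue_preim c V.
Proof.
move=> VU; apply/seteqP; split=> [_ [p Vp <-]|[z u] [/= Uz Vq]].
  by split; [exact: (VU p Vp)|rewrite /glue_chart glue_coordK //; exact: (VU p Vp)].
by exists (glue_point c (z, u)) => //; rewrite /glue_chart glue_pointK.
Qed.

Lemma glue_fst_continuous : continuous (fst : X -> M).
Proof.
move=> p A; rewrite nbhsE => -[B [oB Bp] BA].
have oP : open ([set q | B q.1] : set X).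
  rewrite glue_openE => c; rewrite (_ : glue_preim c _ = [set q | U c q.1] `&` [set q | B q.1]).
    by apply: openI; apply: open_base => //; exact: cc_open.
  by apply/seteqP; split=> q [].
by apply: filterS (open_nbhs_nbhs (conj oP Bp)) => q; exact: BA.
Qed.

Definition euclid_id : chart R 'rV[R]_n n := Chart setT id.

Definition glued_space : chartedSpace R :=
  @ChartedSpace R X (mdim M + n)
    [set a | exists (b : chart R M (mdim M)) (c : M), atlas M b /\
       a = Chart [set p | chart_dom b p.1 /\ U c p.1]
                 (fun p => row_mx (b p.1) (glue_coord c p))].

(** Points over different base points are separated in [M], those over the same one by their
    coordinates in a common chart. *)
Lemma glued_hausdorff : hausdorff_space X.
Proof.
rewrite open_hausdorff => p q pq.
have [E|ne] := eqVneq p.1 q.1; last first.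
  have := mfd_hausdorff (mfd_axioms M); rewrite open_hausdorff => /(_ _ _ ne) [[A B] /= [pA qB]].
  move=> [oA oB /eqP AB]; exists ([set p | A p.1], [set p | B p.1]) => /=.
    by move: pA qB; rewrite !inE.
  have o (O : set M) : open O -> open ([set p | O p.1] : set X).
    move=> oO; rewrite -[X in open X]setTI; apply: open_preimageI => //; first exact: openT.
    by move=> r _; exact: glue_fst_continuous.
  split; [exact: o|exact: o|]; apply/eqP/seteqP; split=> // r [Ar Br].
  by have : (A `&` B) r.1 by []; rewrite AB.
have hE : hausdorff_space 'rV[R]_n by exact: norm_hausdorff.
pose c := p.1; have Up : U c p.1 by exact: cc_mem.
have Uq : U c q.1 by rewrite -E.
have : glue_coord c p != glue_coord c q.
  apply: contraNneq pq => Epq.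
  by rewrite -(glue_coordK Up) -(glue_coordK Uq) Epq E.
move: hE; rewrite open_hausdorff => /[apply] -[[A B] /= [pA qB] [oA oB /eqP AB]].
have o (O : set 'rV[R]_n) : open O ->
    open ([set r | U c r.1 /\ O (glue_coord c r)] : set X).
  move=> oO; rewrite (_ : [set _ | _] = [set r : X | U c r.1] `&` glue_chart c @^-1` [set s : MR | O s.2]).
    apply: open_preimageI => [||r]; last exact: glue_chart_continuous.
      rewrite -[X in open X]setTI; apply: open_preimageI; [exact: openT|exact: cc_open|].
      by move=> r _; exact: glue_fst_continuous.
    rewrite openE => -[z u] Ou; exists (setT, O) => /=; last by move=> [? ?] [].
    by split; [exact: filterT|exact: open_nbhs_nbhs].
  by apply/seteqP; split=> r [].
exists ([set r | U c r.1 /\ A (glue_coord c r)], [set r | U c r.1 /\ B (glue_coord c r)]) => /=.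
  by move: pA qB; rewrite !inE.
split; [exact: o|exact: o|]; apply/eqP/seteqP; split=> // r [[_ Ar] [_ Br]].
by have : (A `&` B) (glue_coord c r) by []; rewrite AB.
Qed.

(** There is a chart for each point of [M], possibly uncountably many. One is selected by [h] for
    each basic open set of [M] contained in some domain; the products of smaller basic open sets and
    rational boxes, read in the selected charts, form a countable base. *)
Lemma glued_second_countable : @second_countable X.
Proof.
have [BM cBM [oBM bBM]] := mfd_second_countable (mfd_axioms M).
have exB (B : set M) : exists c : option M, forall c', B `<=` U c' -> exists2 c0, c = Some c0 & B `<=` U c0.
  have [[c Bc]|n0] := pselect (exists c, B `<=` U c); first by exists (Some c) => ? _; exists c.
  by exists None => c' Bc'; case: n0; exists c'.
have [h Hh] := boolp.choice exB.
pose W (t : (set M * set M) * {ffun 'I_n -> rat * rat}) : set X :=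
  if h t.1.1 is Some c then
    glue_point c @` [set q : MR | (t.1.1 `&` t.1.2) q.1 /\ rat_box R t.2 q.2] else set0.
pose D := [set t : (set M * set M) * {ffun 'I_n -> rat * rat} |
  [/\ BM t.1.1, BM t.1.2 & exists c, t.1.1 `<=` U c]].
exists (W @` D).
  apply: sub_countable (card_image_le W D) _.
  apply: (@sub_countable _ _ D ((BM `*` BM) `*` setT)).
    by apply: subset_card_le => -[[A B] q] [/= ? ? _].
  by apply: countableX; [exact: countableX|exact: countableP].
have opA (A : set M) (B : set 'rV[R]_n) : open A -> open B -> open ([set q | A q.1 /\ B q.2] : set MR).
  move=> oA oB; rewrite openE => -[z u] [Az Bu]; exists (A, B) => //=.
  by split; exact: open_nbhs_nbhs.
split.
  move=> _ [[[B0 B] q] [/= B0M BM' [c B0c]] <-]; rewrite /W /=.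
  have [c0 -> B0c0] := Hh B0 c B0c; apply: glue_point_open.
    exact: (opA (B0 `&` B) _ (openI (oBM _ B0M) (oBM _ BM')) (@open_rat_box R n q)).
  by move=> [z u] [[/B0c0 ? _] _].
move=> p V nV; have [B0 [[B0M B0p] B0U]] : exists B0, [/\ BM B0 /\ B0 p.1 & B0 `<=` U p.1].
  have : nbhs p.1 (U p.1) by apply: open_nbhs_nbhs; split; [exact: cc_open|exact: cc_mem].
  by move=> /bBM [B0 [? ?] ?]; exists B0.
have [c hc B0c] := Hh B0 _ B0U; have Ucp : U c p.1 by exact: B0c.
have := glue_point_continuous (q := glue_chart c p) Ucp.
rewrite /prop_for /continuous_at /= glue_coordK // => /(_ V nV).
rewrite nbhs_simpl /= => -[[A Q] /= [nA nQ] AQ].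
have [B [BMB Bp] BA] := bBM _ _ nA; have [q [qp qQ]] := rat_box_nbhs nQ.
exists (W ((B0, B), q)).
  split; last first.
    rewrite /W /= hc; exists (glue_chart c p); last exact: glue_coordK.
    by split.
  by exists ((B0, B), q) => //; split=> //; exists p.1.
rewrite /W /= hc => _ [[z u] [[_ /BA Az] /qQ Qu] <-].
by apply: (AQ (z, u)); split.
Qed.

Lemma glued_manifold : is_manifold glued_space.
Proof.
split.
- exact: glued_hausdorff.
- exact: glued_second_countable.
- move=> p; have [b Ab bp] := pmf_cover pM p.1.
  exists (Chart [set q | chart_dom b q.1 /\ U p.1 q.1] (fun q => row_mx (b q.1) (glue_coord p.1 q))).
    by exists b, p.1.
  by split=> //; exact: cc_mem.
- move=> _ [b [c [Ab ->]]] /=.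
  rewrite -[X in open X]setTI; apply: (open_preimageI (f := fst : X -> M) (W := chart_dom b `&` U c)).
  + exact: openT.
  + by apply: openI; [exact: (pmf_open_dom pM)|exact: cc_open].
  + by move=> r _; exact: glue_fst_continuous.
- move=> _ [b [c [Ab ->]]] p q /= [bp cp] [bq cq] /eq_row_mx [E1 E2].
  have E : p.1 = q.1 by exact: (pmf_chart_inj pM Ab).
  by rewrite -(glue_coordK cp) -(glue_coordK cq) E2 E.
- move=> _ [b [c [Ab ->]]] p /= [bp cp].
  have Ap : atlas MR (prod_chart b euclid_id) by exists b, euclid_id.
  apply: (continuous_comp (f := glue_chart c) (g := prod_chart b euclid_id)).
    exact: glue_chart_continuous.
  by apply: (pmf_chart_continuous pMR Ap).
- move=> _ [b [c [Ab ->]]] V oV /= VD.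
  have Ap : atlas MR (prod_chart b euclid_id) by exists b, euclid_id.
  rewrite (_ : _ @` V = prod_chart b euclid_id @` (glue_chart c @` V)); last by rewrite image_comp.
  apply: (pmf_chart_open pMR Ap).
    by rewrite glue_chart_image => [|p /VD []//]; exact: oV.
  by move=> _ [p /VD [bp _] <-].
- move=> _ _ [b [c [Ab ->]]] [b' [c' [Ab' ->]]].
  have Ap : atlas MR (prod_chart b euclid_id) by exists b, euclid_id.
  have Ap' : atlas MR (prod_chart b' euclid_id) by exists b', euclid_id.
  pose V := [set q : MR | U c q.1] `&` [set q : MR | U c' q.1].
  have oV : open V by apply: openI; exact/open_base/cc_open.
  have [_ S] : smooth_on V (cc_change c c').
    by apply/(smooth_onP _ pMR pMR oV) => q [? ?]; exact: cc_change_smooth.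
  have [tau st Et] := S _ _ Ap Ap'; exists tau.
    move=> i r; apply: Cr_sub (st i r) => _ [p [[[/= bp cp] _] [/= bp' cp']] <-].
    by exists (glue_chart c p).
  move=> p [[[/= bp cp] _] [/= bp' cp']].
  rewrite -(Et (glue_chart c p)) /=; last by split; [split|split].
  congr row_mx; rewrite /glue_coord cc_comp //; exact: cc_mem.
Qed.

Definition glued_mfd : manifold R := Manifold glued_manifold.

Let pX : is_premanifold glued_mfd := manifold_premanifold glued_manifold.

Lemma glued_coord_smooth (c : M) (p : glued_mfd) a : U c p.1 ->
  rsmooth_at p (fun q : glued_mfd => glue_coord c q 0 a).
Proof.
move=> Up; have [b Ab bp] := pmf_cover pM p.1.
pose ch : chart R glued_mfd (mdim M + n) :=
  Chart [set q : X | chart_dom b q.1 /\ U c q.1] (fun q : X => row_mx (b q.1) (glue_coord c q)).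
have Ac : atlas glued_mfd ch by exists b, c.
have := @rsmooth_at_chartE R glued_mfd p ch (rshift (mdim M) a) Ac (conj bp Up).
by apply: rsmooth_at_near; apply: filterE => q /=; rewrite row_mxEr.
Qed.

Lemma glued_proj_smooth (p : glued_mfd) : @smooth_at R glued_mfd M p fst.
Proof.
split; first exact: glue_fst_continuous.
move=> b Ab bp i; have Up := cc_mem C p.1.
pose ch : chart R glued_mfd (mdim M + n) :=
  Chart [set q : X | chart_dom b q.1 /\ U p.1 q.1] (fun q : X => row_mx (b q.1) (glue_coord p.1 q)).
have Ac : atlas glued_mfd ch by exists b, p.1.
have := @rsmooth_at_chartE R glued_mfd p ch (lshift n i) Ac (conj bp Up).
by apply: rsmooth_at_near; apply: filterE => q /=; rewrite row_mxEl.
Qed.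

Lemma glue_point_smooth c q : U c q.1 -> @smooth_at R MR glued_mfd q (glue_point c).
Proof.
case: q => z u Uz; have [b Ab bz] := pmf_cover pM z.
pose ch : chart R glued_mfd (mdim M + n) :=
  Chart [set q : X | chart_dom b q.1 /\ U c q.1] (fun q : X => row_mx (b q.1) (glue_coord c q)).
have Ac : atlas glued_mfd ch by exists b, c.
apply: (smooth_at_chart (b := ch) pMR pX (glue_point_continuous Uz) Ac (conj bz Uz)) => i.
have Ap : atlas MR (prod_chart b euclid_id) by exists b, euclid_id.
have := @rsmooth_at_chartE R MR (z, u) (prod_chart b euclid_id) i Ap (conj bz I).
apply: rsmooth_at_near.
have nU : \forall q \near ((z, u) : MR), U c q.1.
  by apply: open_nbhs_nbhs; split=> //; exact/open_base/cc_open.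
by apply: filterS nU => -[z' u'] /= Uz'; rewrite glue_pointK.
Qed.

End Glue.

(** * Gluing along an equivariant cocycle *)

Section GluedBundle.
Variables (R : realType) (M : manifold R) (k : nat) (d : 'I_k -> nat).
Local Notation n := (\sum_i d i)%N.
Local Notation wgt := (dwt (d := d)).
Variable C : cocycle M n.
Hypothesis equi : forall c1 c2 z t u, cc_dom C c1 z -> cc_dom C c2 z ->
  cc_map C c1 c2 z (wscale wgt t u) = wscale wgt t (cc_map C c1 c2 z u).
Let pM : is_premanifold M := manifold_premanifold (mfd_axioms M).
Local Notation X := (glued_mfd C).
Let pX : is_premanifold X := manifold_premanifold (mfd_axioms X).
Local Notation MR := (prod_space M (euclidean R n)).
Let pMR : is_premanifold MR := prod_premanifold pM (euclidean_premanifold R n).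
Local Notation U := (cc_dom C).

Definition glued_act (t : R) (p : X) : X := (p.1, wscale wgt t p.2).

Lemma glue_coord_act c t (p : X) : U c p.1 ->
  glue_coord c (glued_act t p) = wscale wgt t (glue_coord c p).
Proof. by move=> Up; rewrite /glue_coord /= equi //; exact: cc_mem. Qed.

Lemma wscale0 (u : 'rV[R]_n) : wscale wgt 0 u = 0.
Proof. by apply/rowP => a; rewrite !mxE expr0n /= mul0r. Qed.

Lemma wscale1 (u : 'rV[R]_n) : wscale wgt 1 u = u.
Proof. by apply/rowP => a; rewrite !mxE expr1n mul1r. Qed.

Lemma wscaleM (s t : R) (u : 'rV[R]_n) : wscale wgt t (wscale wgt s u) = wscale wgt (t * s) u.
Proof. by apply/rowP => a; rewrite !mxE exprMn mulrA. Qed.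

(** The formula of [glued_act] uses a different chart over each base point; by equivariance it is
    rewritten near [p] in the single chart [p.1]. *)
Lemma glued_act_smooth (q : R * X) :
  @smooth_at R (prod_space (real_line R) X) X q (fun p => glued_act p.1 p.2).
Proof.
case: q => t p; have Up := cc_mem C p.1.
have pRX : is_premanifold (prod_space (real_line R) X) := prod_premanifold (real_line_premanifold R) pX.
have sfst := @smooth_at_fst R (real_line R) X (t, p) pX.
have ssnd := @smooth_at_snd R (real_line R) X (t, p) (real_line_premanifold R).
have sproj : @smooth_at R (prod_space (real_line R) X) M (t, p) (fun q => q.2.1).
  exact: smooth_at_comp pRX ssnd (glued_proj_smooth p).
pose f (q : R * X) : MR := (q.2.1, wscale wgt q.1 (glue_coord p.1 q.2)).
have sf : @smooth_at R (prod_space (real_line R) X) MR (t, p) f.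
  apply: smooth_at_pair => //; apply/(smooth_at_euclidean _ _ pRX) => a.
  apply: (@rsmooth_at_near R (prod_space (real_line R) X) (t, p) (fun q => q.1 ^+ wgt a * glue_coord p.1 q.2 0 a)).
    by apply: filterE => q; rewrite mxE.
  apply: (rsmooth_atM pRX).
    apply: (rsmooth_atX pRX).
    exact: (rsmooth_at_pullback pRX sfst (rsmooth_at_real_id t)).
  exact: (rsmooth_at_pullback pRX ssnd (glued_coord_smooth a Up)).
apply: (@smooth_at_near R (prod_space (real_line R) X) X (t, p) (glue_point C p.1 \o f)).
  have nU : \forall q \near ((t, p) : prod_space (real_line R) X), U p.1 q.2.1.
    by apply: sproj.1; apply: open_nbhs_nbhs; split=> //; exact: cc_open.
  apply: filterS nU => -[s q] /= Uq.
  rewrite /f /= -glue_coord_act //.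
  exact: (glue_coordK (p := glued_act s q) (c := p.1)).
by apply: (smooth_at_comp pRX sf); exact: glue_point_smooth.
Qed.

Lemma glued_chart c :
  @diffeo_on R X MR ((fst : X -> M) @^-1` U c) (U c `*` setT)
    (fun p => (p.1, glue_coord c p)) (glue_point C c).
Proof.
have oU : open ((fst : X -> M) @^-1` U c).
  rewrite -[X in open X]setTI; apply: open_preimageI; [exact: openT|exact: cc_open|].
  by move=> p _; have [] := glued_proj_smooth p.
have oV : @open MR (U c `*` setT).
  rewrite (_ : _ `*` _ = [set q | U c q.1]); first exact/open_base/cc_open.
  by apply/seteqP; split=> q /=; [case|].
split.
- apply/(smooth_onP _ pX pMR oU) => p Up; apply: smooth_at_pair; first exact: glued_proj_smooth.
  by apply/(smooth_at_euclidean _ _ pX) => a; exact: glued_coord_smooth.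
- by apply/(smooth_onP _ pMR pX oV) => q [Uq _]; exact: glue_point_smooth.
- by move=> p Up; split=> //; exact: glue_coordK.
- by move=> [z u] [Uz _]; split=> //; congr pair; exact: glue_pointK.
Qed.

Definition glued_bundle : gradedBundle M k.
Proof.
refine (@GradedBundle R M k X fst glued_act d _ _ _ _ _ _ _).
- by apply/(smooth_onP _ pX pM openT) => p _; exact: glued_proj_smooth.
- apply/(smooth_onP _ (prod_premanifold (real_line_premanifold R) pX) pX openT) => q _.
  exact: glued_act_smooth.
- by move=> [z u]; rewrite /glued_act wscale1.
- by move=> t s [z u]; rewrite /glued_act /= wscaleM.
- by move=> x; exists (x, 0).
- move=> [z u] [z' u']; rewrite /glued_act /= !wscale0.
  by split=> [->|[]].
- move=> x; exists (U x), (@glue_coord R M n C x), (glue_point C x); split.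
  + exact: cc_open.
  + exact: cc_mem.
  + exact: glued_chart.
  + by move=> t p Up; rewrite weighted_scalingE glue_coord_act.
Defined.

End GluedBundle.

(** * Free generators near each point of the base *)

Section Frame.
Variables (R : realType) (M : manifold R) (k : nat) (E : productBundle M k).
Let pM : is_premanifold M := manifold_premanifold (mfd_axioms M).
Local Notation N := (\sum_i gv_rank E i)%N.

Lemma dim_grade x (i : 'I_k) : \dim (gv_grade E x i.+1) = gv_rank E i.
Proof.
have Ap := fibre_triv_atlas E x; have px := fibre_triv_dom E x; set phi := fibre_triv E x in Ap px.
pose b (j : 'I_(gv_rank E i)) : E x := (phi x)^-1%VF (delta_mx 0 (tagnat.Rank i j)).
have bE (c : 'I_(gv_rank E i) -> R) l :
    phi x (\sum_j c j *: b j) 0 l = \sum_j c j * (l == tagnat.Rank i j)%:R.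
  rewrite linear_sum summxE; apply: eq_bigr => j _.
  transitivity ((c j *: phi x (b j)) 0 l).
    by congr (fun_of_matrix _ _ _); exact: linearZ_LR.
  by rewrite /b triv_invK // !mxE eqxx.
have RI (j j' : 'I_(gv_rank E i)) : (tagnat.Rank i j == tagnat.Rank i j') = (j == j').
  apply/eqP/eqP => [/(congr1 (fun l => nat_of_ord (tagnat.sig2 l)))|-> //].
  by rewrite !tagnat.Rank2K /= => /val_inj.
have sum1 (g : 'I_(gv_rank E i) -> R) j :
    \sum_l g l * (tagnat.Rank i j == tagnat.Rank i l)%:R = g j.
  rewrite (bigD1 j) //= eqxx mulr1 big1 ?addr0 // => j' nj.
  by rewrite RI eq_sym (negbTE nj) mulr0.
rewrite (dim_of_basis (b := b)) ?card_ord // => [j|v /(gv_gradeP _ _ Ap px) vi|c c0 j].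
- apply/(gv_gradeP _ _ Ap px) => l nl; rewrite /b triv_invK // mxE eqxx /=.
  by case: eqP => // lE; case/eqP: nl; rewrite lE /dwt tagnat.Rank1K.
- exists (fun j => phi x v 0 (tagnat.Rank i j)).
  apply: (can_inj (fun u => triv_Kinv u Ap px)); apply/rowP => l; rewrite bE; have [il|nl] := eqVneq (tagnat.sig1 l) i; last first.
    have nli : dwt l != i.+1 by apply: contraNneq nl => -[/val_inj ->].
    rewrite (vi l nli) big1 // => j _; case: eqP => [lE|_]; last by rewrite mulr0.
    by rewrite lE tagnat.Rank1K eqxx in nl.
  have [j ->] : exists j, l = tagnat.Rank i j.
    by subst i; exists (tagnat.sig2 l); rewrite tagnat.sig2K.
  by rewrite (sum1 (fun j => phi x v 0 (tagnat.Rank i j))).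
- by have := bE c (tagnat.Rank i j); rewrite c0 linear0 mxE sum1.
Qed.

(** The same [d] serves all fibres: it is determined by the dimensions of the graded pieces, which
    are the ranks of the bundle. *)
Lemma generators_exist : exists d : 'I_k -> nat, forall c, exists e : 'I_(\sum_i d i) -> E c,
  (forall a, e a \in gv_grade E c (dwt a)) /\
  is_basis (fun al : monomial k (dwt (d := d)) => emono (A := fibre_alg E c) e (mexpo al)).
Proof.
have H c : exists (d : 'I_k -> nat) (e : 'I_(\sum_i d i) -> fibre_alg E c),
    (forall a, e a \in gv_grade E c (dwt a)) /\ free_gens k (dwt (d := d)) e.
  by apply: (free_gens_exist (fibre_graded E c)) => j; exact: pb_injective.
(* Over an empty base any [d] will do; otherwise [d] is taken from one fibre. *)
have [[c0 _]|nM] := pselect (exists c : M, True); last first.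
  by exists (fun=> 0%N) => c; case: nM; exists c.
have [d [e0 [e0G f0]]] := H c0; exists d => c; have [d' [e [eG f]]] := H c.
have dd : d' = d.
  apply: weight_monomial_rank_inj => i.
  rewrite -(dim_graded_piece i.+1 (fibre_graded E c) (@dwt_gt0 _ _) eG f).
  by rewrite -(dim_graded_piece i.+1 (fibre_graded E c0) (@dwt_gt0 _ _) e0G f0) !dim_grade.
by subst d'; exists e; split=> //; case: f.
Qed.

(* Obtained by extending generators of one fibre
   constantly in a trivialization. *)
Lemma frames_exist : exists (d : 'I_k -> nat) (U : M -> set M)
    (eta : M -> 'I_(\sum_i d i) -> forall x, E x),
  [/\ forall c, open (U c), forall c, U c c,
      forall c z a, U c z -> ssmooth_at z (eta c a),
      forall c z a, U c z -> eta c a z \in gv_grade E z (dwt a)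
    & forall c z, U c z -> is_basis (fun al : monomial k (dwt (d := d)) =>
        emono (A := fibre_alg E z) (fun a => eta c a z) (mexpo al))].
Proof.
have [d Hd] := generators_exist; exists d.
have [e He] : exists e : forall c, 'I_(\sum_i d i) -> E c, forall c,
   (forall a, e c a \in gv_grade E c (dwt a)) /\
   is_basis (fun al : monomial k (dwt (d := d)) => emono (A := fibre_alg E c) (e c) (mexpo al)).
  by exists (fun c => sval (cid (Hd c))) => c; case: cid.
pose phi c := fibre_triv E c.
pose eta c a z : E z := (phi c z)^-1%VF (phi c c (e c a)).
have Ap c := fibre_triv_atlas E c; have pc c := fibre_triv_dom E c.
have etac c a : eta c a c = e c a by exact: triv_Kinv.
have se c z a : triv_dom (phi c) z -> ssmooth_at z (eta c a) by move=> pz; exact: ssmooth_at_const.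
have ex c : exists O : set M, [/\ open O, O c & forall z, O z -> triv_dom (phi c) z /\
    is_basis (fun al : monomial k (dwt (d := d)) =>
        emono (A := fibre_alg E z) (fun a => eta c a z) (mexpo al))].
  have b0 : is_basis (fun al : monomial k (dwt (d := d)) =>
      emono (A := fibre_alg E c) (fun a => eta c a c) (mexpo al)).
    have -> : (fun a => eta c a c) = e c by apply/funext => a; exact: etac.
    by case: (He c).
  have sm (al : monomial k (dwt (d := d))) : ssmooth_at c
      (fun z => emono (A := fibre_alg E z) (fun a => eta c a z) (mexpo al)).
    apply: ssmooth_at_emono => [a|]; first exact: se.
    by apply: (mdeg_gt0 (wgt := dwt (d := d))); have /andP[] := mexpo_weight al.
  have nb := frame_near (S := fun (al : monomial k (dwt (d := d))) z =>
     emono (A := fibre_alg E z) (fun a => eta c a z) (mexpo al)) sm b0.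
  have np : \forall z \near c, triv_dom (phi c) z.
    by apply: open_nbhs_nbhs; split=> //; exact: gv_open (Ap c).
  have : nbhs c [set z | triv_dom (phi c) z /\
    is_basis (fun al : monomial k (dwt (d := d)) =>
        emono (A := fibre_alg E z) (fun a => eta c a z) (mexpo al))].
    by apply: filterS2 np nb => z ? ?; split.
  by rewrite nbhsE => -[B [oB Bc] BP]; exists B.
have [U HU] := boolp.choice ex; exists U, eta; split.
- by move=> c; case: (HU c).
- by move=> c; case: (HU c).
- by move=> c z a Uz; apply: se; have [_ _ /(_ z Uz) []] := HU c.
- move=> c z a Uz; have [_ _ /(_ z Uz) [pz _]] := HU c.
  apply/(gv_gradeP _ _ (Ap c) pz) => b nb; rewrite /eta triv_invK //.
  by have [/(_ a) /(gv_gradeP _ _ (Ap c) (pc c)) H _] := He c; exact: H.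
- by move=> c z Uz; have [_ _ /(_ z Uz) []] := HU c.
Qed.

End Frame.

(** * The bundle of characters *)

Section FrameDual.
Variables (R : realType) (M : manifold R) (k : nat) (E : productBundle M k).
Let pM : is_premanifold M := manifold_premanifold (mfd_axioms M).
Variables (d : 'I_k -> nat) (U : M -> set M).
Local Notation n := (\sum_i d i)%N.
Local Notation wgt := (dwt (d := d)).
Local Notation mon := (monomial k wgt).
Variable eta : M -> 'I_n -> forall x, E x.
Hypotheses (oU : forall c, open (U c)) (Uc : forall c, U c c).
Hypothesis seta : forall c z a, U c z -> ssmooth_at z (eta c a).
Hypothesis geta : forall c z a, U c z -> eta c a z \in gv_grade E z (wgt a).
Local Notation em c z := (fun al : mon =>
  emono (A := fibre_alg E z) (fun a => eta c a z) (mexpo al)).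
Hypothesis beta : forall c z, U c z -> is_basis (em c z).

Lemma frame_coords_exist (c z : M) : exists X : E z -> mon -> R, U c z ->
  (forall v, v = \sum_al X v al *: em c z al) /\
  (forall a al, X (\sum_al a al *: em c z al) al = a al).
Proof.
have [Uz|nU] := pselect (U c z); last by exists (fun _ _ => 0).
by have [X [XE XK _]] := free_coord (beta Uz); exists X.
Qed.

Definition fcoord (c z : M) : E z -> mon -> R := sval (cid (frame_coords_exist c z)).

Lemma fcoordP c z : U c z -> (forall v, v = \sum_al fcoord c v al *: em c z al) /\
  (forall a al, fcoord c (\sum_al a al *: em c z al) al = a al).
Proof. by rewrite /fcoord; case: cid. Qed.

Definition feval (c z : M) (v : E z) (u : 'rV[R]_n) : R :=
  \sum_al fcoord c v al * mono (mexpo al) u.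

Lemma feval_is_eval c z u : U c z ->
  @is_eval R k (fibre_alg E z) n wgt (fun a => eta c a z) u (fun v => feval c v u).
Proof.
by move=> Uz a; apply: eq_bigr => al _; congr (_ * _); exact: (fcoordP Uz).2.
Qed.

Lemma feval_character c z u : U c z ->
  is_character k (A := fibre_alg E z) (gv_grade E z) (fun v => feval c v u).
Proof.
move=> Uz; exact: (eval_character (fibre_graded E z) (@dwt_gt0 _ _) (fun a => geta a Uz)
  (beta Uz) (feval_is_eval u Uz)).
Qed.

(** The coordinates in the frame [c'] of the character whose coordinates in the frame [c] are
    [u]. *)
Definition frame_change (c c' z : M) (u : 'rV[R]_n) : 'rV[R]_n :=
  \row_a feval c (eta c' a z) u.

(** A character is the evaluation at its values on the generators, in whichever frame these are
    taken. *)
Lemma feval_change c c' z (v : E z) u : U c z -> U c' z ->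
  feval c' v (frame_change c c' z u) = feval c v u.
Proof.
move=> Uz U'z; have e1 := feval_is_eval (frame_change c c' z u) U'z.
have e2 := character_eval (fibre_graded E z) (@dwt_gt0 _ _) (fun a => geta a U'z)
  (feval_character u Uz).
exact: (is_eval_uniq (beta U'z) e1 e2).
Qed.

Lemma fcoord_smooth c z s al : U c z -> ssmooth_at z s ->
  rsmooth_at z (fun x => fcoord c (s x) al).
Proof.
move=> Uz ss; apply: (frame_coord (S := fun al x => em c x al) (c := fun x => fcoord c (s x)) _ (beta Uz) ss).
  move=> be; apply: ssmooth_at_emono => [a|]; first exact: seta.
  by apply: (mdeg_gt0 (wgt := wgt)); have /andP[] := mexpo_weight be.
have nU : \forall x \near z, U c x by apply: open_nbhs_nbhs.
by apply: filterS nU => x Ux; exact: (fcoordP Ux).1.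
Qed.

Lemma frame_change_id c z u : U c z -> frame_change c c z u = u.
Proof.
move=> Uz; apply/rowP => a; rewrite mxE.
by rewrite (eval_gen (@dwt_gt0 _ _) (feval_is_eval u Uz)) ?dwt_le.
Qed.

Lemma frame_change_comp c1 c2 c3 z u : U c1 z -> U c2 z -> U c3 z ->
  frame_change c2 c3 z (frame_change c1 c2 z u) = frame_change c1 c3 z u.
Proof. by move=> U1 U2 U3; apply/rowP => a; rewrite !mxE feval_change. Qed.

Lemma frame_change_smooth c1 c2 z u a : U c1 z -> U c2 z ->
  @rsmooth_at R (prod_space M (euclidean R n)) (z, u) (fun p => frame_change c1 c2 p.1 p.2 0 a).
Proof.
move=> U1 U2; have pMn : is_premanifold (prod_space M (euclidean R n)).
  exact: prod_premanifold pM (euclidean_premanifold R n).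
have sfst := @smooth_at_fst R M (euclidean R n) (z, u) (euclidean_premanifold R n).
have ssnd := @smooth_at_snd R M (euclidean R n) (z, u) pM.
apply: (@rsmooth_at_near R (prod_space M (euclidean R n)) (z, u)
  (fun p => \sum_al fcoord c1 (eta c2 a p.1) al * mono (mexpo al) p.2)).
  by apply: filterE => p; rewrite mxE.
apply: (rsmooth_at_sum pMn) => al _; apply: (rsmooth_atM pMn).
  exact: (rsmooth_at_pullback pMn sfst (fcoord_smooth al U1 (seta a U2))).
apply: (rsmooth_at_prod pMn) => b _; apply: (rsmooth_atX pMn).
by move/(smooth_at_euclidean _ _ pMn): ssnd; exact.
Qed.

Lemma frame_change_equi c1 c2 z t u : U c1 z -> U c2 z ->
  frame_change c1 c2 z (wscale wgt t u) = wscale wgt t (frame_change c1 c2 z u).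
Proof.
move=> U1 U2; apply/rowP => a; rewrite !mxE.
exact: (eval_wscale (fibre_graded E z) (@dwt_gt0 _ _) (fun a => geta a U1) (beta U1)
  (feval_is_eval u U1) (feval_is_eval _ U1) (geta a U2)).
Qed.

Definition frame_cocycle : cocycle M n :=
  @Cocycle R M n U frame_change oU Uc frame_change_id frame_change_comp frame_change_smooth.

Definition frame_bundle : gradedBundle M k := @glued_bundle R M k d frame_cocycle frame_change_equi.

Definition frame_pairing (x : M) (v : E x) (p : frame_bundle) : R :=
  feval x v (p : M * 'rV[R]_n).2.

Lemma frame_dual : dual_pairing frame_pairing.
Proof.
move=> c; exists (U c), (@glue_coord R M n frame_cocycle c), (glue_point frame_cocycle c), (eta c).
split; first exact: Uc.
split.
- split; [exact: oU|exact: (glued_chart frame_cocycle c)|].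
  move=> t p Up; rewrite weighted_scalingE.
  exact: (glue_coord_act (C := frame_cocycle) frame_change_equi).
- by move=> z a Uz; exact: seta.
- by move=> z a Uz; exact: geta.
- by move=> z Uz; exact: beta.
- move=> p Up a; rewrite -(feval_is_eval _ Up a).
  by rewrite /frame_pairing -(@feval_change _ c) //; exact: Uc.
Qed.

End FrameDual.

Theorem productBundle_dual (R : realType) (M : manifold R) (k : nat) (E : productBundle M k) :
  exists (F : gradedBundle M k) (ev : forall x, E x -> F -> R), dual_pairing ev.
Proof.
have [d [U [eta [oU Uc se ge be]]]] := frames_exist E.
by do 2 eexists; exact: (frame_dual oU Uc se ge be).
Qed.

Theorem theorem4p19 (R : realType) (M : manifold R) (k : nat) (k_gt0 : (1 <= k)%N) :
  [/\ forall F : gradedBundle M k, exists E : productBundle M k, corresponds F E,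
      forall E : productBundle M k, exists F : gradedBundle M k, corresponds F E
    & forall (F F' : gradedBundle M k) (E E' : productBundle M k),
        corresponds F E -> corresponds F' E' ->
        (gb_isomorphic F F' <-> pb_isomorphic E E')].
Proof.
split.
- by move=> F; have [E [ev dE]] := gradedBundle_dual F; exists E; exact: dual_corresponds dE.
- by move=> E; have [F [ev dE]] := productBundle_dual E; exists F; exact: dual_corresponds dE.
(* The given isomorphism brings both product bundles to the same [F'], or both graded bundles to the
   same [E']; uniqueness of the partner then applies. *)
move=> F F' E E' cE cE'; split=> [FF'|EE'].
  have [ev dE] := corresponds_dual (corresponds_gb_transport cE FF').
  have [ev' dE'] := corresponds_dual cE'.
  exact: dual_pb_isomorphic dE dE'.
have [ev dE] := corresponds_dual cE; have [ev' dE'] := corresponds_dual cE'.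
have [ev2 dE2] := dual_pb_transport dE EE'.
exact: dual_gb_isomorphic dE2 dE'.
Qed.
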